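(* There is a constant $c_n$ depending only on the dimension $n$ such that for every set $E\subset\mathbb{R}^n$ of finite perimeter (and finite Lebesgue measure), $$\lim_{\varepsilon\to0}\frac{1}{|\log\varepsilon|}\,\|\gamma_\varepsilon*\mathbf{1}_E\|_{H^{1/2}}^2=c_nP(E).$$
   Context: $P(E)$ is the perimeter of $E$ in $\mathbb{R}^n$ and $\mathbf{1}_E$ its indicator function. $\gamma$ is the standard Gaussian on $\mathbb{R}^n$ and $\gamma_\varepsilon(x)=\varepsilon^{-n}\gamma(x/\varepsilon)$. The (homogeneous) norm is $\|u\|_{H^{1/2}}^2=\int_{\mathbb{R}^n}|\xi|\,|\widehat u(\xi)|^2\,d\xi$, where $\widehat u$ is the Fourier transform of $u$ (with any fixed normalization). *)

(* Defs.v *)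
From HB Require Import structures.
From mathcomp Require Import all_boot all_order all_algebra.
From mathcomp Require Import all_classical all_reals all_analysis.
From mathcomp Require Import measurable_realfun complex.

Set Implicit Arguments.
Unset Strict Implicit.
Unset Printing Implicit Defensive.

Import Order.TTheory GRing.Theory Num.Theory.
Import numFieldNormedType.Exports.

Local Open Scope classical_set_scope.
Local Open Scope ring_scope.

(* R^n is 'rV[R]_n, with the sigma-algebra generated by the coordinate maps:
   the product Borel sigma-algebra, i.e. the Borel sigma-algebra of R^n. *)
Section measurable_rV.
Context (R : realType) (n : nat).

Let coord (i : 'I_n) (x : 'rV[R]_n) : R := x ord0 i.

Let rV_set0 : g_sigma_preimage coord set0.
Proof. exact: sigma_algebra0. Qed.

Let rV_setC A : g_sigma_preimage coord A -> g_sigma_preimage coord (~` A).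
Proof. exact: sigma_algebraC. Qed.

Let rV_bigcup (F : (set 'rV[R]_n)^nat) :
  (forall i, g_sigma_preimage coord (F i)) ->
  g_sigma_preimage coord (\bigcup_i (F i)).
Proof. exact: sigma_algebra_bigcup. Qed.

HB.instance Definition _ := @isMeasurable.Build default_measure_display
  'rV[R]_n (g_sigma_preimage coord) rV_set0 rV_setC rV_bigcup.

Lemma measurable_coord (i : 'I_n) :
  measurable_fun [set: 'rV[R]_n] (fun x => x ord0 i).
Proof.
move=> _ Y mY; rewrite setTI; apply: sub_sigma_algebra => /=.
rewrite -bigcup_seq/=; exists i => /=; first by rewrite mem_index_enum.
by exists Y => //; rewrite setTI.
Qed.

Lemma measurable_fun_rVP d (T : measurableType d) (f : T -> 'rV[R]_n) :
  (forall i, measurable_fun [set: T] (fun x => f x ord0 i)) ->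
  measurable_fun [set: T] f.
Proof.
move=> mf _ A mA.
suff : g_sigma_preimage (fun i => coord i \o f) `<=` measurable.
  by apply; rewrite g_sigma_preimage_comp; exists A.
apply: smallest_sub; first exact: sigma_algebra_measurable.
rewrite -bigcup_seq => B [i /= _ [C mC <-]].
exact: mf.
Qed.

End measurable_rV.

Section lebesgue_measure_rV.
Context {R : realType}.
Local Open Scope ereal_scope.

Definition rV_cons n (p : measurableTypeR R * 'rV[R]_n) : 'rV[R]_n.+1 :=
  row_mx (p.1)%:M p.2.

Fixpoint lebesgue_rV n : set 'rV[R]_n -> \bar R :=
  match n with
  | 0 => \d_ (0%R : 'rV[R]_0)
  | m.+1 => pushforward (lebesgue_measure \x @lebesgue_rV m) (@rV_cons m)
  end.

Lemma rV_cons0 n p : @rV_cons n p ord0 ord0 = p.1.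
Proof.
transitivity ((p.1%:M : 'M[R]_1) ord0 ord0); last by rewrite mxE eqxx mulr1n.
rewrite -(@row_mxEl _ 1%N 1%N n _ p.2) /rV_cons; congr (row_mx _ _ _ _).
exact: val_inj.
Qed.

Lemma rV_consS n p j : @rV_cons n p ord0 (lift ord0 j) = p.2 ord0 j.
Proof.
rewrite -[RHS](@row_mxEr _ 1%N 1%N n p.1%:M) /rV_cons.
by congr (row_mx _ _ _ _); exact: val_inj.
Qed.

Lemma measurable_rV_cons n : measurable_fun setT (@rV_cons n).
Proof.
apply: measurable_fun_rVP => i; case: (unliftP ord0 i) => [j|] ->.
  under eq_fun do rewrite rV_consS.
  apply: (@measurableT_comp _ _ _ _ _ _ (fun x : 'rV[R]_n => x ord0 j)) => //.
  exact: measurable_coord.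
under eq_fun do rewrite rV_cons0.
exact: measurable_fst.
Qed.

Let pack_sigma_finite d (T : measurableType d) (nu : {measure set T -> \bar R}) :
  sigma_finite setT nu ->
  exists m : {sigma_finite_measure set T -> \bar R}, nu = m :> (set T -> \bar R).
Proof.
move=> nu_sf.
pose H1 := isSFinite.Build _ _ _ _ (sfinite_measure_sigma_finite nu_sf).
pose H2 := isSigmaFinite.Build _ _ _ _ nu_sf.
pose m := HB.pack_for (SigmaFiniteMeasure.type T R) (Measure.sort nu) H1 H2.
by exists m.
Qed.

Let product_sigma_finite d1 d2 (T1 : measurableType d1) (T2 : measurableType d2)
    (m1 : {sigma_finite_measure set T1 -> \bar R})
    (m2 : {sigma_finite_measure set T2 -> \bar R}) :
  sigma_finite setT (m1 \x m2).
Proof.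
have /sigma_finiteP[F [TF ndF Foo]] := sigma_finiteT m1.
have /sigma_finiteP[G [TG ndG Goo]] := sigma_finiteT m2.
exists (fun n => F n `*` G n).
 rewrite -setXTT TF TG predeqE => -[x y]; split.
    move=> [/= [n _ Fnx] [k _ Gky]]; exists (maxn n k) => //; split.
    - by move: x Fnx; exact/subsetPset/ndF/leq_maxl.
    - by move: y Gky; exact/subsetPset/ndG/leq_maxr.
  by move=> [n _ []/= ? ?]; split; exists n.
move=> k; have [? ?] := Foo k; have [? ?] := Goo k.
split; first exact: measurableX.
by rewrite product_measure1E// lte_mul_pinfty// ge0_fin_numE.
Qed.

Let rV_cons_spec n (m : {sigma_finite_measure set 'rV[R]_n -> \bar R}) :
  exists m' : {sigma_finite_measure set 'rV[R]_n.+1 -> \bar R},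
    pushforward (lebesgue_measure \x m) (@rV_cons n) = m'.
Proof.
pose uncons (x : 'rV[R]_n.+1) : measurableTypeR R * 'rV[R]_n :=
  (x ord0 ord0, \row_j x ord0 (lift ord0 j)).
have consK p : uncons (rV_cons p) = p.
  case: p => x y; rewrite /uncons rV_cons0; congr pair.
  by apply/rowP => j; rewrite mxE rV_consS.
have muncons : measurable_fun setT uncons.
  apply: measurable_fun_pair; first exact: measurable_coord.
  apply: measurable_fun_rVP => i.
  rewrite [X in measurable_fun _ X](_ : _ = (fun x : 'rV[R]_n.+1 => x ord0 (lift ord0 i))).
    exact: measurable_coord.
  by apply/funext => x; rewrite mxE.
have nu_sf : sigma_finite setT (pushforward (lebesgue_measure \x m) (@rV_cons n)).
  have [F FT Foo] := product_sigma_finite (@lebesgue_measure R) m.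
  exists (fun k => uncons @^-1` F k).
    by rewrite -preimage_bigcup -FT preimage_setT.
  move=> k; have [mFk Fk] := Foo k; split.
    by rewrite -[X in measurable X]setTI; exact: muncons.
  rewrite /pushforward -comp_preimage.
  by rewrite (_ : _ \o _ = id)//; apply/funext => p /=; rewrite consK.
pose nu : {measure set 'rV[R]_n.+1 -> \bar R} :=
  measure_function_pushforward__canonical__measure_function_Measure (lebesgue_measure \x m)
    (@measurable_rV_cons n).
exact: (@pack_sigma_finite _ _ nu).
Qed.

Let lebesgue_rV_spec n : exists m : {sigma_finite_measure set 'rV[R]_n -> \bar R},
  @lebesgue_rV n = m.
Proof.
elim: n => [|n [m mE]]; first by exists (\d_ (0%R : 'rV[R]_0)).
rewrite /= mE.
exact: rV_cons_spec.
Qed.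

Let lebesgue_rV0 n : @lebesgue_rV n set0 = 0.
Proof. by have [m ->] := lebesgue_rV_spec n; exact: measure0. Qed.

Let lebesgue_rV_ge0 n A : 0 <= @lebesgue_rV n A.
Proof. by have [m ->] := lebesgue_rV_spec n; exact: measure_ge0. Qed.

Let lebesgue_rV_sigma_additive n : semi_sigma_additive (@lebesgue_rV n).
Proof.
by have [m ->] := lebesgue_rV_spec n; exact: measure_semi_sigma_additive.
Qed.

HB.instance Definition _ n := isMeasure.Build _ _ _ (@lebesgue_rV n)
  (lebesgue_rV0 n) (@lebesgue_rV_ge0 n) (@lebesgue_rV_sigma_additive n).

Let lebesgue_rV_sigma_finite n : sigma_finite setT (@lebesgue_rV n).
Proof. by have [m ->] := lebesgue_rV_spec n; exact: sigma_finiteT. Qed.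

HB.instance Definition _ n := Measure_isSigmaFinite.Build _ _ _
  (@lebesgue_rV n) (@lebesgue_rV_sigma_finite n).

Lemma lebesgue_rV_box n (A : 'I_n -> set R) : (forall i, measurable (A i)) ->
  @lebesgue_rV n [set x | forall i, A i (x ord0 i)] =
  \prod_(i < n) lebesgue_measure (A i).
Proof.
elim: n A => [|n IHn] A mA.
  rewrite big_ord0 /= diracE mem_set//=.
  by case.
rewrite big_ord_recl -IHn//= /pushforward.
have mbox : measurable [set x : 'rV[R]_n | forall i, A (lift ord0 i) (x ord0 i)].
  rewrite (_ : [set _ | _] =
      \bigcap_(i in [set: 'I_n]) (fun x : 'rV[R]_n => x ord0 i) @^-1` A (lift ord0 i)).
    apply: fin_bigcap_measurable => // i _.
    by rewrite -[X in measurable X]setTI; exact: measurable_coord.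
  by apply/seteqP; split => x /= xA i; [move=> _; exact: xA|exact: xA].
rewrite -product_measure1E//; last exact: mA.
congr (_ _); apply/seteqP; split => -[x y] /= xyA.
  by split=> [|i]; [have := xyA ord0|have := xyA (lift ord0 i)];
    rewrite ?rV_cons0 ?rV_consS.
move=> i; case: (unliftP ord0 i) => [j|] ->; rewrite ?rV_cons0 ?rV_consS.
- exact: xyA.2.
- exact: xyA.1.
Qed.

End lebesgue_measure_rV.
Arguments lebesgue_rV {R n}.

(* Lebesgue measurable: measurable for the completion of the Borel measure
   lebesgue_rV; the Lebesgue measure of such a set is its outer measure
   lebesgue_rV^*.  The library integral is a difference of suprema over
   measurable simple functions, so on functions that are only measurable for
   the completion it still agrees with the completed Lebesgue integral. *)
Definition lebesgue_measurable (R : realType) (n : nat) (E : set 'rV[R]_n) :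
    Prop :=
  completed_algebra_gen lebesgue_rV E.

Section perimeter.
Context {R : realType} {n : nat}.
Local Notation V := 'rV[R]_n.

Definition dotv (x y : V) : R := \sum_(i < n) x ord0 i * y ord0 i.

(* the Euclidean norm; the library norm `|x| of a row vector is the sup norm *)
Definition enorm (x : V) : R := Num.sqrt (dotv x x).

Definition divergence (phi : V -> V) (x : V) : R :=
  \sum_(i < n) ('D_(delta_mx ord0 i) phi x) ord0 i.

Definition C1c (phi : V -> V) : Prop :=
  [/\ forall x, differentiable phi x,
      forall v : V, continuous ('D_v phi) &
      compact (closure [set x | phi x != 0])].

Definition perimeter (E : set V) : \bar R :=
  ereal_sup [set (\int[lebesgue_rV]_(x in E) (divergence phi x)%:E)%E |
    phi in [set phi : V -> V | C1c phi /\ forall x, enorm (phi x) <= 1]].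

End perimeter.

Section mollified_energy.
Context {R : realType} {n : nat}.
Local Notation V := 'rV[R]_n.

Definition gauss (x : V) : R :=
  Num.sqrt (2 * pi) ^- n * expR (- (enorm x ^+ 2 / 2)).

Definition gauss_scaled (eps : R) (x : V) : R :=
  eps ^- n * gauss (eps^-1 *: x).

Definition convolution (f g : V -> R) (x : V) : R :=
  \int[lebesgue_rV]_y (f (x - y) * g y).

(* a * \int u(x) e^{- i b x.xi} dx, for integrable u.  The pair (a, b) is the
   normalization: (1, 2 pi), (1, 1), ((2 pi)^(-n/2), 1), ... *)
Definition fourier (a b : R) (u : V -> R) (xi : V) : R[i] :=
  Complex (a * \int[lebesgue_rV]_x (cos (b * dotv x xi) * u x))
          (- (a * \int[lebesgue_rV]_x (sin (b * dotv x xi) * u x))).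

Definition Hhalf_norm_sq (a b : R) (u : V -> R) : \bar R :=
  (\int[lebesgue_rV]_xi
     (enorm xi * ComplexField.Normc.normc (fourier a b u xi) ^+ 2)%:E)%E.

End mollified_energy.

(* Main.v *)
From HB Require Import structures.
Require Import Defs.
From mathcomp Require Import all_boot all_order all_algebra.
From mathcomp Require Import all_classical all_reals all_analysis.
From mathcomp Require Import complex ring lra measurable_realfun.

Set Implicit Arguments.
Unset Strict Implicit.
Unset Printing Implicit Defensive.

Import Order.TTheory GRing.Theory Num.Theory.
Import numFieldNormedType.Exports.

Local Open Scope classical_set_scope.
Local Open Scope ring_scope.

(* Write D(h) for the L^1 norm of 1_E(. + h) - 1_E and Phi(t) for the mean of
   D(sqrt 2 t Z), Z a standard Gaussian vector. By Tonelli, the integral of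
   e^{-t^2 lam} |F 1_E|^2, lam proportional to |xi|^2, is an affine function of
   Phi(t). Since k sqrt lam = int_0^oo (1 - e^{-r^2 lam}) dr / r^2, the energy is a
   multiple of int_0^oo (Phi(sqrt(eps^2 + r^2)) - Phi(eps)) dr / r^2. If Phi(t) ~ L t
   at 0, then the range eps < r < 1 contributes L |log eps|, while the ranges
   r < eps (by convexity of e^{-s lam} in s) and r > 1 (as Phi is bounded) are O(1).

   That L is proportional to the perimeter is seen on u = rho * 1_E, rho a
   mollifier, with gradient g: the L^1 norm of u(. + h) - u is h.g up to O(|h|^2),
   an error that subadditivity in h removes from the upper bound, and the mean of
   |Z.w| is a multiple of |w|. Finally ||g||_1 <= P(E) by testing the perimeter
   against - rho * (g / |g|), and P(E) <= ||g||_1 + o(1) by integrating a test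
   field by parts against u. *)

(** * Integration over row vectors *)

(** Neither Plancherel nor a structure theorem for sets of finite perimeter enters: the Fourier
    transform is met only under Gaussian weights, where Tonelli computes the integrals, and the
    gradient of the indicator function only through mollification. In these computations 1 + cos
    replaces cos, so that the integrands are nonnegative; the finite contribution of the constant is
    subtracted afterwards. The Gaussian is transformed up to an unspecified sigma > 0, and k is only
    known to be positive and finite, so c_n is obtained without being evaluated.

    The obstacle in the energy is the range r < eps: an increment of Phi of order r leaves the
    divergent dr / r, whereas convexity gives the order r^2 / eps, which the weight turns into O(1 /
    eps) on an interval of length eps. On the geometric side, Phi(t) <= L t is used for every t,
    while the constant in the Taylor bound of a mollifier grows as the mollifier concentrates; so no
    error containing it is tolerable there. The lower bound is asymptotic, and the mollifier can be
    fixed before t tends to 0. *)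

Section affine1.
Context {R : realType}.
Notation mu := (@lebesgue_measure R).
Notation gR := (measurableTypeR R).

Lemma measurable_affine1 (s v : R) :
  measurable_fun [set: gR] (fun t : gR => (s * t + v : gR)).
Proof. by apply: measurable_funD => //; exact: measurable_funM. Qed.

(** Both sides are measures, so half-open intervals suffice. A negative slope reverses the interval,
    which moves the closed end from right to left. *)
Lemma lebesgue_measure_affine (s v : R) : s != 0 -> forall A : set gR, measurable A ->
  mu A = (`|s|%:E * mu ((fun t => s * t + v)%R @^-1` A))%E.
Proof.
move=> s0 A mA.
pose nu : {measure set gR -> \bar R} := mscale (NngNum (normr_ge0 s))
  (measure_function_pushforward__canonical__measure_function_Measure mu
     (measurable_affine1 s v)).
have := @lebesgue_measure_unique R nu.
apply => // _ [[a b]] _ <-.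
rewrite /nu /= /mscale /= /pushforward.
have [s_gt0|s_lt0|s00] := ltrgtP s 0; last by rewrite s00 eqxx in s0.
- rewrite (_ : _ @^-1` _ = `[(b - v) / s, (a - v) / s[%classic).
    rewrite !lebesgue_measure_itv /= !lte_fin ltr_nM2r ?invr_lt0// ltrD2r ltr0_norm//.
    case: ifPn => ab; last by rewrite mule0.
    by rewrite -!EFinB -EFinM; congr EFin; field.
  apply/seteqP; split => t /=; rewrite !in_itv /= ler_ndivrMr// ltr_ndivlMr//;
    rewrite (mulrC t); lra.
- rewrite (_ : _ @^-1` _ = `](a - v) / s, (b - v) / s]%classic).
    rewrite !lebesgue_measure_itv /= !lte_fin ltr_pM2r ?invr_gt0// ltrD2r gtr0_norm//.
    case: ifPn => ab; last by rewrite mule0.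
    by rewrite -!EFinB -EFinM; congr EFin; field.
  apply/seteqP; split => t /=; rewrite !in_itv /= ltr_pdivrMr// ler_pdivlMr//;
    rewrite (mulrC t); lra.
Qed.

Local Open Scope ereal_scope.

Lemma ge0_integral_affine1 (f : gR -> \bar R) (s v : R) : s != 0%R ->
  measurable_fun setT f -> (forall t, 0 <= f t) ->
  `|s|%:E * \int[mu]_t f (s * t + v)%R = \int[mu]_t f t.
Proof.
move=> s0 mf f0.
pose nu0 : {measure set gR -> \bar R} :=
  (measure_function_pushforward__canonical__measure_function_Measure mu
     (measurable_affine1 s v)).
pose nu : {measure set gR -> \bar R} := mscale (NngNum (normr_ge0 s)) nu0.
rewrite [RHS](@eq_measure_integral _ _ _ setT nu); last first.
  by move=> A mA _; exact: lebesgue_measure_affine.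
rewrite [RHS](@ge0_integral_mscale _ _ _ nu0 setT _ (NngNum (normr_ge0 s)))//.
rewrite (@ge0_integral_pushforward _ _ gR gR R _ (measurable_affine1 s v) mu setT) //.
Qed.

End affine1.

Section vector.
Context {R : realType} {n : nat}.
Notation V := 'rV[R]_n.
Context d (T : measurableType d).

Lemma measurable_fun_coord (f : T -> V) i : measurable_fun setT f ->
  measurable_fun setT (fun x => f x ord0 i).
Proof.
by move=> mf; apply: (@measurableT_comp _ _ _ _ _ _ (fun x : V => x ord0 i)) => //; exact: measurable_coord.
Qed.

Lemma measurable_fun_addv (f g : T -> V) : measurable_fun setT f ->
  measurable_fun setT g -> measurable_fun setT (fun x => f x + g x).
Proof.
move=> mf mg; apply: measurable_fun_rVP => i.
under eq_fun do rewrite mxE.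
by apply: measurable_funD; exact: measurable_fun_coord.
Qed.

Lemma measurable_fun_scalev (a : T -> R) (f : T -> V) : measurable_fun setT a ->
  measurable_fun setT f -> measurable_fun setT (fun x => a x *: f x).
Proof.
move=> ma mf; apply: measurable_fun_rVP => i.
under eq_fun do rewrite mxE.
by apply: measurable_funM => //; exact: measurable_fun_coord.
Qed.

Lemma measurable_fun_oppv (f : T -> V) : measurable_fun setT f ->
  measurable_fun setT (fun x => - f x).
Proof.
move=> mf; apply: measurable_fun_rVP => i.
under eq_fun do rewrite mxE.
by apply: measurableT_comp => //; exact: measurable_fun_coord.
Qed.

Lemma measurable_fun_dotv (f g : T -> V) : measurable_fun setT f ->
  measurable_fun setT g -> measurable_fun setT (fun x => dotv (f x) (g x)).
Proof.
move=> mf mg; apply: measurable_sum => i.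
by apply: measurable_funM; exact: measurable_fun_coord.
Qed.

Lemma measurable_fun_enorm (f : T -> V) : measurable_fun setT f ->
  measurable_fun setT (fun x => enorm (f x)).
Proof.
move=> mf; apply: (@measurableT_comp _ _ _ _ _ _ (@Num.sqrt R)).
  exact: (continuous_measurable_fun (@sqrt_continuous R)).
exact: measurable_fun_dotv.
Qed.

End vector.

Section integral_rV.
Context {R : realType}.
Notation gR := (measurableTypeR R).
Local Open Scope ereal_scope.

Lemma ge0_integral_rVS n (f : 'rV[R]_n.+1 -> \bar R) :
  measurable_fun setT f -> (forall x, 0 <= f x) ->
  \int[lebesgue_rV]_x f x =
  \int[@lebesgue_measure R]_t \int[@lebesgue_rV R n]_y f (rV_cons (t, y)).
Proof.
move=> mf f0.
rewrite (@ge0_integral_pushforward _ _ _ _ R _ (@measurable_rV_cons R n)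
   (lebesgue_measure \x @lebesgue_rV R n) setT)//.
rewrite preimage_setT fubini_tonelli1//; last by move=> x; exact: f0.
by apply: measurableT_comp => //; exact: measurable_rV_cons.
Qed.

Lemma rV_cons_affine n (s : R) (v : 'rV[R]_n.+1) t y :
  (s *: rV_cons (t, y) + v = rV_cons (s * t + v ord0 ord0, s *: y + \row_j v ord0 (lift ord0 j)))%R.
Proof.
apply/rowP => i; rewrite [LHS]mxE [X in (X + _)%R]mxE.
case: (unliftP ord0 i) => [j|] ->.
  by rewrite !rV_consS /= !mxE.
by rewrite !rV_cons0.
Qed.

(** Induction on the dimension: Tonelli splits off the first coordinate, where the map is affine on
    the line, and [rV_cons_affine] leaves a map of the same kind on the other coordinates. *)
Lemma ge0_integral_affine n (f : 'rV[R]_n -> \bar R) (s : R) (v : 'rV[R]_n) :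
  s != 0%R -> measurable_fun setT f -> (forall t, 0 <= f t) ->
  (`|s| ^+ n)%:E * \int[lebesgue_rV]_x f (s *: x + v)%R = \int[lebesgue_rV]_x f x.
Proof.
move=> s0; elim: n f v => [|n IH] f v mf f0.
  rewrite expr0 mul1e; apply: eq_integral => x _; congr f.
  by apply/rowP; case.
have maff : measurable_fun setT (fun x : 'rV[R]_n.+1 => s *: x + v)%R.
  by apply: measurable_fun_addv => //; exact: measurable_fun_scalev.
rewrite ge0_integral_rVS//; last exact: measurableT_comp.
rewrite [RHS]ge0_integral_rVS//.
pose h (t : gR) := \int[@lebesgue_rV R n]_y f (rV_cons (t, y)).
have mcons : measurable_fun setT (fun p => f (@rV_cons R n p)).
  by apply: measurableT_comp => //; exact: measurable_rV_cons.
have mh : measurable_fun setT h.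
  exact: (@measurable_fun_fubini_tonelli_F _ _ gR _ _ _ (fun p => f (@rV_cons R n p))).
have h0 t : 0 <= h t by apply: integral_ge0 => y _; exact: f0.
rewrite -[RHS](@ge0_integral_affine1 _ h s (v ord0 ord0) s0 mh h0).
rewrite exprS EFinM -muleA; congr (_ * _).
rewrite -ge0_integralZl; last 4 first.
- by [].
- apply: (@measurable_fun_fubini_tonelli_F _ _ gR _ _ _ (fun p => f (s *: (@rV_cons R n p) + v)%R)); last by move=> x; exact: f0.
  apply: measurableT_comp mf _; apply: measurableT_comp maff _.
  exact: measurable_rV_cons.
- by move=> t _; apply: integral_ge0 => y _; exact: f0.
- by rewrite lee_fin exprn_ge0.
apply: eq_integral => t _.
pose fc (y : 'rV[R]_n) := f (rV_cons (s * t + v ord0 ord0, y)%R).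
have mfc : measurable_fun setT fc.
  by apply: measurableT_comp mcons _; apply: measurable_fun_pair.
have fc0 y : 0 <= fc y by exact: f0.
rewrite -[RHS](IH fc (\row_j v ord0 (lift ord0 j))%R mfc fc0).
by congr (_ * _); apply: eq_integral => y _; rewrite rV_cons_affine.
Qed.

Lemma integral_affine n (f : 'rV[R]_n -> \bar R) (s : R) (v : 'rV[R]_n) :
  s != 0%R -> measurable_fun setT f ->
  \int[lebesgue_rV]_x f (s *: x + v)%R = (`|s| ^- n)%:E * \int[lebesgue_rV]_x f x.
Proof.
move=> s0 mf.
have sn0 : (`|s| ^+ n != 0)%R by rewrite expf_neq0// normr_eq0.
have E g : measurable_fun setT g -> (forall t, 0 <= g t) ->
    \int[lebesgue_rV]_x g (s *: x + v)%R = (`|s| ^- n)%:E * \int[lebesgue_rV]_x g x.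
  move=> mg g0; rewrite -(ge0_integral_affine v s0 mg g0) muleA -EFinM mulVf//.
  by rewrite mul1e.
rewrite [LHS]integralE [in RHS]integralE.
rewrite [X in X - _](_ : _ = \int[lebesgue_rV]_x f^\+ (s *: x + v)%R); last first.
  by apply: eq_integral => x _; rewrite !funeposE.
rewrite [X in _ - X](_ : _ = \int[lebesgue_rV]_x f^\- (s *: x + v)%R); last first.
  by apply: eq_integral => x _; rewrite !funenegE.
rewrite !E//; [|exact: measurable_funeneg|exact: measurable_funepos].
have : (0 < `|s| ^- n)%R by rewrite invr_gt0 exprn_gt0// normr_gt0.
have : 0 <= \int[@lebesgue_rV R n]_x f^\+ x by exact: integral_ge0.
have : 0 <= \int[@lebesgue_rV R n]_x f^\- x by exact: integral_ge0.
move: (`|s| ^- n)%R => k.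
(* Either part may be infinite; in each case the factor [k > 0] still distributes over the
   difference. *)
case: (integral _ _ _) => [b||]//; case: (integral _ _ _) => [c||]// _ _ k0.
- by congr EFin; rewrite mulrBr.
- by rewrite gt0_muley ?lte_fin.
- by rewrite /= gt0_muley ?lte_fin//= gt0_muleNy ?lte_fin.
- by rewrite gt0_muley ?lte_fin//= gt0_muleNy ?lte_fin.
Qed.

End integral_rV.

Lemma measurable_cosR (R : realType) : measurable_fun [set: R] (@cos R).
Proof. exact: (continuous_measurable_fun (@continuous_cos R)). Qed.

Lemma measurable_sinR (R : realType) : measurable_fun [set: R] (@sin R).
Proof. exact: (continuous_measurable_fun (@continuous_sin R)). Qed.

Lemma measurable_sqrtR (R : realType) : measurable_fun [set: R] (@Num.sqrt R).
Proof. exact: (continuous_measurable_fun (@sqrt_continuous R)). Qed.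

Lemma measurable_normrR (R : realType) : measurable_fun [set: R] (fun x : R => `|x|).
Proof. exact: measurableT_comp. Qed.

(** Measurability is read off the outermost operation. For any other function it is taken from the
    context, whence the measurability facts introduced shortly before [mfun]. *)
Ltac mfun_step :=
  match goal with
  | mh : measurable_fun ?D ?h |- measurable_fun ?D ?h => exact mh
  | mh : measurable_fun ?D ?h |- measurable_fun ?D (fun x => ?h x) => exact mh
  | _ =>
    lazymatch goal with
    | |- measurable_fun _ (fun x => x) => exact: measurable_id
    | |- measurable_fun _ (fun x => x.1) => exact: measurable_fst
    | |- measurable_fun _ (fun x => x.2) => exact: measurable_snd
    | |- measurable_fun _ (fun x => (@?f x + @?g x)%R) =>
        first [apply: (@measurable_funD _ _ _ _ f g) | apply: (@measurable_fun_addv _ _ _ _ f g)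
              | apply: (@emeasurable_funD _ _ _ _ f g)]
    | |- measurable_fun _ (fun x => (@?f x + @?g x)%E) => apply: (@emeasurable_funD _ _ _ _ f g)
    | |- measurable_fun _ (fun x => (@?f x * @?g x)%R) => apply: (@measurable_funM _ _ _ _ f g)
    | |- measurable_fun _ (fun x => (@?f x * @?g x)%E) => apply: (@emeasurable_funM _ _ _ _ f g)
    | |- measurable_fun _ (fun x => (@?f x *: @?g x)%R) => apply: (@measurable_fun_scalev _ _ _ _ f g)
    | |- measurable_fun _ (fun x => (- @?f x)%R) =>
        first [apply: (@measurable_funN _ _ _ _ f) | apply: (@measurable_fun_oppv _ _ _ _ f)]
    | |- measurable_fun _ (fun x => (@?f x ^+ ?k)%R) => apply: (@measurable_funX _ _ _ _ f k)
    | |- measurable_fun _ (fun x => dotv (@?f x) (@?g x)) => apply: (@measurable_fun_dotv _ _ _ _ f g)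
    | |- measurable_fun _ (fun x => enorm (@?f x)) => apply: (@measurable_fun_enorm _ _ _ _ f)
    | |- measurable_fun _ (fun x => fun_of_matrix (@?f x) ord0 ?i) => apply: (@measurable_fun_coord _ _ _ _ f i)
    | |- measurable_fun _ (fun x => (@?f x)%:E) => apply/measurable_EFinP
    | |- measurable_fun _ (fun x => expR (@?f x)) => apply: (@measurableT_comp _ _ _ _ _ _ _ _ f (@measurable_expR _))
    | |- measurable_fun _ (fun x => cos (@?f x)) => apply: (@measurableT_comp _ _ _ _ _ _ _ _ f (@measurable_cosR _))
    | |- measurable_fun _ (fun x => sin (@?f x)) => apply: (@measurableT_comp _ _ _ _ _ _ _ _ f (@measurable_sinR _))
    | |- measurable_fun _ (fun x => Num.sqrt (@?f x)) => apply: (@measurableT_comp _ _ _ _ _ _ _ _ f (@measurable_sqrtR _))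
    | |- measurable_fun _ (fun x => `|@?f x|%R) => apply: (@measurableT_comp _ _ _ _ _ _ _ _ f (@measurable_normrR _))
    | |- measurable_fun _ (fun x => `|@?f x|%E) => apply: (@measurableT_comp _ _ _ _ _ _ abse _ f (@abse_measurable _ setT))
    | |- measurable_fun _ (fun x => (@?f x, @?g x)) => apply: (@measurable_fun_pair _ _ _ _ _ _ f g)
    | mh : measurable_fun setT ?h |- measurable_fun _ (fun x => ?h (@?g x)) =>
        apply: (@measurableT_comp _ _ _ _ _ _ h _ g mh)
    end
  | _ => assumption
  | _ => exact: measurable_cst
  | _ => exact: measurable_id
  end.
Ltac mfun := repeat mfun_step.

Section integral_tools.
Context {R : realType} d (T : measurableType d) (mu : {measure set T -> \bar R}).
Local Open Scope ereal_scope.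

(** The supremum over simple functions below the integrand is itself monotone in the integrand, so
    no measurability has to be checked at the many uses. *)
Lemma ge0_le_integralW (D : set T) (f g : T -> \bar R) :
  (forall x, D x -> 0 <= f x) -> (forall x, D x -> f x <= g x) ->
  \int[mu]_(x in D) f x <= \int[mu]_(x in D) g x.
Proof.
move=> f0 fg.
rewrite !ge0_integralE//; last by move=> x Dx; exact: le_trans (f0 _ Dx) (fg _ Dx).
apply: ereal_sup_le => _ /= [h hf <-]; exists h => // x.
apply: (le_trans (hf x)); rewrite /patch; case: ifPn => // xD.
by apply: fg; rewrite inE in xD.
Qed.

End integral_tools.

Section shift.
Context {R : realType} {n : nat}.
Notation V := 'rV[R]_n.
Notation mu := (@lebesgue_rV R n).
Local Open Scope ereal_scope.

Lemma integral_shift (f : V -> \bar R) v : measurable_fun setT f ->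
  \int[mu]_x f (x + v)%R = \int[mu]_x f x.
Proof.
move=> mf; have := @integral_affine R n f 1%R v (oner_neq0 _) mf.
rewrite normr1 expr1n invr1 mul1e => <-.
by apply: eq_integral => x _; rewrite scale1r.
Qed.

Lemma integral_reflect (f : V -> \bar R) v : measurable_fun setT f ->
  \int[mu]_x f (v - x)%R = \int[mu]_x f x.
Proof.
move=> mf; have := @integral_affine R n f (-1)%R v _ mf.
rewrite normrN1 expr1n invr1 mul1e oppr_eq0 oner_eq0 => <- //.
by apply: eq_integral => x _; rewrite scaleN1r addrC.
Qed.

Lemma integral_scale (f : V -> \bar R) s : (0 < s)%R -> measurable_fun setT f ->
  \int[mu]_x f (s *: x)%R = (s ^- n)%:E * \int[mu]_x f x.
Proof.
move=> s0 mf; rewrite -{2}(gtr0_norm s0) -(integral_affine 0%R _ mf) ?gt_eqF//.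
by apply: eq_integral => x _; rewrite addr0.
Qed.

End shift.

(** * The Euclidean inner product and norm *)

Section dotv.
Context {R : realType} {n : nat}.
Implicit Types x y z : 'rV[R]_n.

Lemma dotvC x y : dotv x y = dotv y x.
Proof. by apply: eq_bigr => i _; rewrite mulrC. Qed.

Lemma dotvDl x y z : dotv (x + y) z = dotv x z + dotv y z.
Proof. by rewrite -big_split; apply: eq_bigr => i _; rewrite mxE mulrDl. Qed.

Lemma dotvZl (a : R) x y : dotv (a *: x) y = a * dotv x y.
Proof. by rewrite mulr_sumr; apply: eq_bigr => i _; rewrite mxE mulrA. Qed.

Lemma dotvNl x y : dotv (- x) y = - dotv x y.
Proof. by rewrite -scaleN1r dotvZl mulN1r. Qed.

Lemma dotvDr x y z : dotv z (x + y) = dotv z x + dotv z y.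
Proof. by rewrite dotvC dotvDl !(dotvC z). Qed.

Lemma dotvZr (a : R) x y : dotv x (a *: y) = a * dotv x y.
Proof. by rewrite dotvC dotvZl dotvC. Qed.

Lemma dotvNr x y : dotv x (- y) = - dotv x y.
Proof. by rewrite dotvC dotvNl dotvC. Qed.

Lemma dotv0l x : dotv 0 x = 0.
Proof. by rewrite -(scale0r 0) dotvZl mul0r. Qed.

Lemma dotv0r x : dotv x 0 = 0.
Proof. by rewrite dotvC dotv0l. Qed.

Lemma dotv_ge0 x : 0 <= dotv x x.
Proof. by apply: sumr_ge0 => i _; rewrite -expr2 sqr_ge0. Qed.

Lemma enorm_sqr x : enorm x ^+ 2 = dotv x x.
Proof. by rewrite sqr_sqrtr// dotv_ge0. Qed.

Lemma enorm_ge0 x : 0 <= enorm x. Proof. exact: sqrtr_ge0. Qed.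

Lemma enormZ (a : R) x : enorm (a *: x) = `|a| * enorm x.
Proof. by rewrite /enorm dotvZl dotvZr mulrA -expr2 sqrtrM ?sqr_ge0// sqrtr_sqr. Qed.

Lemma enormN x : enorm (- x) = enorm x.
Proof. by rewrite -scaleN1r enormZ normrN1 mul1r. Qed.

Lemma enorm0 : enorm (0 : 'rV[R]_n) = 0.
Proof. by rewrite /enorm dotv0l sqrtr0. Qed.

Lemma dotv_eq0 x : dotv x x = 0 -> x = 0.
Proof.
move=> /eqP; rewrite psumr_eq0; last by move=> i _; rewrite -expr2 sqr_ge0.
move=> /allP x0; apply/rowP => i; rewrite mxE.
by have /= := x0 i (mem_index_enum _); rewrite mulf_eq0 orbb => /eqP.
Qed.

Lemma enorm_eq0 x : enorm x = 0 -> x = 0.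
Proof. by move=> x0; apply: dotv_eq0; rewrite -enorm_sqr x0 expr0n. Qed.

Lemma cauchy_schwarz x y : `|dotv x y| <= enorm x * enorm y.
Proof.
have [y0|y0] := eqVneq (enorm y) 0.
  by rewrite (enorm_eq0 y0) dotv0r normr0 enorm0 mulr0.
rewrite -[leLHS]sqrtr_sqr -[leRHS]ger0_norm ?mulr_ge0 ?enorm_ge0//.
rewrite -[leRHS]sqrtr_sqr ler_wsqrtr// exprMn !enorm_sqr.
have yy : 0 < dotv y y.
  by rewrite -enorm_sqr exprn_gt0// lt_neqAle eq_sym y0 enorm_ge0.
(* The component of [x] orthogonal to [y], multiplied by [dotv y y] to avoid a division. *)
have := dotv_ge0 (dotv y y *: x - dotv x y *: y).
rewrite !(dotvDl, dotvDr, dotvNl, dotvNr, dotvZl, dotvZr) (dotvC y x).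
set a := dotv x x; set b := dotv y y in yy *; set c := dotv x y.
rewrite (_ : _ + _ = b * (a * b - c ^+ 2)); last by ring.
by rewrite pmulr_rge0// subr_ge0.
Qed.

Lemma enormD x y : enorm (x + y) <= enorm x + enorm y.
Proof.
rewrite -[leRHS]ger0_norm ?addr_ge0 ?enorm_ge0// -sqrtr_sqr ler_wsqrtr//.
rewrite dotvDl !dotvDr sqrrD !enorm_sqr (dotvC y x).
have : dotv x y <= enorm x * enorm y := le_trans (ler_norm _) (cauchy_schwarz x y).
by lra.
Qed.

Lemma dotv_delta x i : dotv x (delta_mx ord0 i) = x ord0 i.
Proof.
rewrite /dotv (bigD1 i)//= [X in _ * X]mxE !eqxx mulr1 big1 ?addr0// => j ji.
by rewrite [X in _ * X]mxE eqxx (negbTE ji) mulr0.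
Qed.

Lemma normr_coord_le_enorm x i : `|x ord0 i| <= enorm x.
Proof.
rewrite -ler_sqr ?nnegrE ?enorm_ge0// enorm_sqr real_normK ?num_real//.
by rewrite /dotv (bigD1 i)//= expr2 lerDl sumr_ge0// => j _; rewrite -expr2 sqr_ge0.
Qed.

End dotv.

(** * Gaussian integrals *)

Section gauss1.
Context {R : realType}.
Notation gR := (measurableTypeR R).
Notation mu := (@lebesgue_measure R).

Definition gauss1 (t : R) : R := (Num.sqrt (2 * pi))^-1 * expR (- (t ^+ 2 / 2)).

Lemma gauss1_ge0 t : 0 <= gauss1 t.
Proof. by rewrite mulr_ge0 ?invr_ge0 ?sqrtr_ge0 ?expR_ge0. Qed.

Lemma sqrt2pi_gt0 : 0 < Num.sqrt (2 * pi) :> R.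
Proof. by rewrite sqrtr_gt0 mulr_gt0 ?pi_gt0. Qed.

Lemma measurable_gauss1 : measurable_fun [set: gR] gauss1.
Proof. by rewrite /gauss1; mfun. Qed.

Lemma gauss1N t : gauss1 (- t) = gauss1 t.
Proof. by rewrite /gauss1 sqrrN. Qed.

Lemma integral_gauss1 : (\int[mu]_t (gauss1 t)%:E = 1)%E.
Proof.
rewrite -(@integral_normal_pdf R 0 1); apply: eq_integral => t _.
rewrite normal_pdfE ?oner_eq0// /gauss1 /normal_peak /normal_fun expr1n mul1r subr0.
by rewrite mulr_natl mulNr.
Qed.

Local Open Scope ereal_scope.

(** Rotation invariance of the planar Gaussian: a combination of two independent standard Gaussians
    is again Gaussian. The rotation is factored into two shears, so that only affine substitutions
    on the line and Tonelli occur. *)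
Lemma ge0_integral_gauss1_rotation (f : gR -> \bar R) (a b : R) :
  measurable_fun setT f -> (forall t, 0 <= f t) ->
  \int[mu]_z \int[mu]_s (f (a * z + b * s)%R * (gauss1 z * gauss1 s)%:E) =
  \int[mu]_s (f (Num.sqrt (a ^+ 2 + b ^+ 2) * s)%R * (gauss1 s)%:E).
Proof.
move=> mf f0.
have mg := measurable_gauss1.
(* The shears divide by [a]. For [a = 0] the two variables separate, and evenness of [gauss1]
   absorbs the sign of [b]. *)
have [->|a0] := eqVneq a 0%R.
  rewrite expr0n add0r sqrtr_sqr.
  under eq_integral => z _.
    under eq_integral => s _ do rewrite mul0r add0r EFinM (muleC (gauss1 z)%:E) muleA.
    rewrite ge0_integralZr//; last 3 first.
    - by mfun.
    - by move=> s _; rewrite mule_ge0 ?lee_fin ?gauss1_ge0.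
    - by rewrite lee_fin gauss1_ge0.
    over.
  rewrite /= ge0_integralZl//; last 3 first.
  - by mfun.
  - by move=> s _; rewrite lee_fin gauss1_ge0.
  - by apply: integral_ge0 => s _; rewrite mule_ge0 ?lee_fin ?gauss1_ge0.
  rewrite integral_gauss1 mule1.
  have [b0|b0] := leP 0%R b; first by rewrite ger0_norm.
  rewrite ltr0_norm//.
  pose h s := f (b * s)%R * (gauss1 s)%:E.
  have mh : measurable_fun [set: gR] h by rewrite /h; mfun.
  have h0 s : 0 <= h s by rewrite mule_ge0 ?lee_fin ?gauss1_ge0.
  have N10 : (-1 != 0 :> R)%R by rewrite oppr_eq0 oner_eq0.
  rewrite -[LHS](ge0_integral_affine1 0%R N10 mh h0) normrN1 mul1e.
  by apply: eq_integral => s _; rewrite /h addr0 mulN1r gauss1N mulrN mulNr.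
set c := Num.sqrt _.
have c2 : (c ^+ 2 = a ^+ 2 + b ^+ 2)%R by rewrite sqr_sqrtr// addr_ge0// sqr_ge0.
have c0 : (c != 0)%R.
  rewrite sqrtr_eq0 -ltNge ltr_wpDr ?sqr_ge0// exprn_even_gt0//.
(* shear z = (c r - b s) / a, then s = (a q + b r) / c *)
pose k (p : gR * gR) := f (a * p.1 + b * p.2)%R * (gauss1 p.1 * gauss1 p.2)%:E.
have mk : measurable_fun setT k by rewrite /k; mfun.
have k0 p : 0 <= k p by rewrite mule_ge0 ?lee_fin ?mulr_ge0 ?gauss1_ge0.
rewrite -[LHS]/(\int[mu]_z \int[mu]_s k (z, s)).
rewrite (@sfinite_Fubini _ _ gR gR R mu mu k k0 mk).
have ca0 : (c / a != 0)%R by rewrite mulf_neq0 ?invr_eq0.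
have ac0 : (a / c != 0)%R by rewrite mulf_neq0 ?invr_eq0.
pose l (p : gR * gR) := k (c / a * p.1 + - (b / a) * p.2, p.2)%R.
have ml : measurable_fun setT l.
  by apply: measurableT_comp mk _; mfun.
have l0 p : 0 <= l p by exact: k0.
transitivity (`|c / a|%:E * \int[mu]_s \int[mu]_r l (r, s)).
  rewrite -ge0_integralZl//; last 2 first.
  - exact: (@measurable_fun_fubini_tonelli_G _ _ gR gR _ mu l ml l0).
  - by move=> s _; apply: integral_ge0.
  apply: eq_integral => s _.
  have mks : measurable_fun [set: gR] (fun z => k (z, s)) by apply: measurableT_comp mk _; mfun.
  by rewrite -(ge0_integral_affine1 (- (b / a) * s)%R ca0 mks (fun z => k0 _)).
rewrite -(@sfinite_Fubini _ _ gR gR R mu mu l l0 ml).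
rewrite -ge0_integralZl//; last 2 first.
- exact: (@measurable_fun_fubini_tonelli_F _ _ gR gR _ mu l ml l0).
- by move=> s _; apply: integral_ge0.
apply: eq_integral => r _.
have mlr : measurable_fun [set: gR] (fun s => l (r, s)) by apply: measurableT_comp ml _; mfun.
rewrite -(ge0_integral_affine1 (b / c * r)%R ac0 mlr (fun z => l0 _)).
rewrite muleA -EFinM -normrM (_ : c / a * (a / c) = 1)%R; last by field; rewrite a0 c0.
rewrite normr1 mul1e.
transitivity (\int[mu]_q (f (c * r)%R * (gauss1 r)%:E * (gauss1 q)%:E)).
  apply: eq_integral => q _; rewrite /l /k /= -muleA -EFinM.
  congr (f _ * _%:E).
    by field; rewrite a0 c0.
  rewrite /gauss1 mulrACA -expRD [RHS]mulrACA -expRD; congr (_ * expR _)%R.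
  rewrite -!opprD -!mulrDl; congr (- (_ / _))%R.
  have -> : (c / a * r + - (b / a) * (a / c * q + b / c * r) = (a * r - b * q) / c)%R.
    transitivity ((c ^+ 2 * r - b * (a * q + b * r)) / (a * c))%R.
      by field; rewrite a0 c0.
    by rewrite c2; field; rewrite a0 c0.
  transitivity ((r ^+ 2 + q ^+ 2) * ((a ^+ 2 + b ^+ 2) / c ^+ 2))%R.
    by field; rewrite c0.
  by rewrite -c2 divff ?mulr1// expf_neq0.
rewrite ge0_integralZl//; last 3 first.
- by mfun.
- by move=> s _; rewrite lee_fin gauss1_ge0.
- by rewrite mule_ge0 ?lee_fin ?gauss1_ge0.
by rewrite integral_gauss1 mule1.
Qed.

End gauss1.

Section gauss.
Context {R : realType}.
Notation gR := (measurableTypeR R).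
Notation mu1 := (@lebesgue_measure R).

Lemma gauss_ge0 n (x : 'rV[R]_n) : 0 <= gauss x.
Proof. by rewrite mulr_ge0 ?expR_ge0// invr_ge0 exprn_ge0// sqrtr_ge0. Qed.

Lemma measurable_gauss n : measurable_fun [set: 'rV[R]_n] (@gauss R n).
Proof. by rewrite /gauss; mfun. Qed.

Lemma gaussN n (x : 'rV[R]_n) : gauss (- x) = gauss x.
Proof. by rewrite /gauss enormN. Qed.

Lemma dotv_cons n (t s : R) (x y : 'rV[R]_n) :
  dotv (rV_cons (t, x)) (rV_cons (s, y)) = t * s + dotv x y.
Proof.
rewrite /dotv big_ord_recl !rV_cons0; congr (_ + _).
by apply: eq_bigr => i _; rewrite !rV_consS.
Qed.

Lemma gauss_cons n (t : R) (y : 'rV[R]_n) : gauss (rV_cons (t, y)) = gauss1 t * gauss y.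
Proof.
rewrite /gauss /gauss1 exprS invfM mulrACA -expRD; congr (_ * expR _).
by rewrite !enorm_sqr dotv_cons -opprD -mulrDl -expr2.
Qed.

Lemma rV_cons_surj n (w : 'rV[R]_n.+1) : exists t y, w = rV_cons (t, y).
Proof.
exists (w ord0 ord0), (\row_j w ord0 (lift ord0 j)); apply/rowP => i.
by case: (unliftP ord0 i) => [j|] ->; rewrite ?rV_cons0 ?rV_consS /= ?mxE.
Qed.

Local Open Scope ereal_scope.

(** The law of [dotv z w] under the Gaussian depends on [w] only through its length. Induction on
    the dimension: by the rotation lemma, the first coordinate and the Gaussian of size [enorm w']
    coming from the others combine into one. *)
Lemma ge0_integral_gauss_dotv n (f : gR -> \bar R) (w : 'rV[R]_n) :
  measurable_fun setT f -> (forall t, 0 <= f t) ->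
  \int[lebesgue_rV]_z (f (dotv z w) * (gauss z)%:E) =
  \int[mu1]_s (f (enorm w * s)%R * (gauss1 s)%:E).
Proof.
have mg1 := @measurable_gauss1 R.
elim: n f w => [|n IH] f w mf f0.
  have -> : w = 0%R by apply/rowP; case.
  rewrite enorm0.
  rewrite /= integral_dirac//; last first.
    by have mg := @measurable_gauss 0; mfun.
  rewrite diracT mul1e dotv0l.
  under eq_integral do rewrite mul0r.
  rewrite ge0_integralZl//; last 2 first.
  - by mfun.
  - by move=> s _; rewrite lee_fin gauss1_ge0.
  by rewrite integral_gauss1 /gauss expr0 invr1 mul1r enorm0 expr0n mul0r oppr0 expR0.
have [w0 [w' ->]] := rV_cons_surj w.
have mg := @measurable_gauss n.+1.
have mgn := @measurable_gauss n.
rewrite ge0_integral_rVS//; last 2 first.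
- by mfun.
- by move=> x; rewrite mule_ge0 ?lee_fin ?gauss_ge0.
transitivity (\int[mu1]_z \int[mu1]_s (f (w0 * z + enorm w' * s)%R * (gauss1 z * gauss1 s)%:E)).
  apply: eq_integral => t _.
  under eq_integral => y _ do rewrite gauss_cons dotv_cons (mulrC t) EFinM muleCA.
  rewrite ge0_integralZl//; last 3 first.
  - by mfun.
  - by move=> s _; rewrite mule_ge0 ?lee_fin ?gauss_ge0.
  - by rewrite lee_fin gauss1_ge0.
  rewrite (IH (fun r => f (w0 * t + r)%R) w')//; last by mfun.
  rewrite -ge0_integralZl//; last 3 first.
  - by mfun.
  - by move=> s _; rewrite mule_ge0 ?lee_fin ?gauss1_ge0.
  - by rewrite lee_fin gauss1_ge0.
  by apply: eq_integral => s _; rewrite muleCA EFinM.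
rewrite ge0_integral_gauss1_rotation//.
congr (integral _ _ _); apply/funext => s; congr (f (_ * _)%R * _).
by rewrite enorm_sqr /enorm dotv_cons -expr2.
Qed.

Lemma integral_gauss n : \int[@lebesgue_rV R n]_z (gauss z)%:E = 1.
Proof.
have m1 : measurable_fun [set: gR] (fun=> 1 : \bar R) by exact: measurable_cst.
have := @ge0_integral_gauss_dotv n _ 0%R m1 (fun=> lee01).
under eq_integral do rewrite mul1e; move=> ->.
by under eq_integral do rewrite mul1e; rewrite integral_gauss1.
Qed.

End gauss.

Lemma integrable_le d (T : measurableType d) (R : realType)
    (mu : {measure set T -> \bar R}) (f g : T -> R) :
  measurable_fun setT f -> (forall x, `|f x| <= g x) ->
  mu.-integrable setT (EFin \o g) -> mu.-integrable setT (EFin \o f).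
Proof.
move=> mf fg; apply: le_integrable => //; first exact/measurable_EFinP.
by move=> x _ /=; rewrite lee_fin (le_trans (fg x))// ler_norm.
Qed.

Lemma ge0_integrable d (T : measurableType d) (R : realType)
    (mu : {measure set T -> \bar R}) (f : T -> R) :
  measurable_fun setT f -> (forall x, 0 <= f x) ->
  (\int[mu]_x (f x)%:E < +oo)%E -> mu.-integrable setT (EFin \o f).
Proof.
move=> mf f0 foo; apply/integrableP; split; first exact/measurable_EFinP.
by under eq_integral => x _ do rewrite /= ger0_norm//.
Qed.

Lemma EFin_Rintegral d (T : measurableType d) (R : realType)
    (mu : {measure set T -> \bar R}) (f : T -> R) :
  mu.-integrable setT (EFin \o f) ->
  (\int[mu]_x (f x)%:E)%E = (\int[mu]_x f x)%:E.
Proof. by move=> fi; rewrite fineK// integrable_fin_num. Qed.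

(** Cauchy's functional equation for a nonnegative, hence monotone, solution. With [k] the integer
    part of [N u], both [L (N u)] and [N u L 1] lie between [k L 1] and [(k + 1) L 1], so N times
    the defect is at most [L 1] for every N. *)
Lemma additive_ge0_linear (R : realType) (L : R -> R) :
  (forall u, 0 <= u -> 0 <= L u) ->
  (forall u v, 0 <= u -> 0 <= v -> L (u + v) = L u + L v) ->
  forall u, 0 <= u -> L u = u * L 1.
Proof.
move=> L0 LD u u0.
have LM (m : nat) v : 0 <= v -> L (m%:R * v) = m%:R * L v.
  move=> v0; elim: m => [|m IH].
    rewrite !mul0r; have := LD 0 0 (lexx _) (lexx _); rewrite addr0 => /eqP.
    by rewrite -subr_eq subrr eq_sym => /eqP.
  by rewrite -natr1 !mulrDl !mul1r LD ?mulr_ge0// IH.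
have L1 := L0 1 ler01.
have Lmono x y : 0 <= x -> x <= y -> L x <= L y.
  move=> x0 xy; rewrite -(subrK x y) LD ?subr_ge0//.
  by rewrite lerDr L0// subr_ge0.
have key (N : nat) : N%:R * `|L u - u * L 1| <= L 1.
  rewrite -[N%:R]ger0_norm// -normrM mulrBr -LM//.
  have Nu0 : 0 <= N%:R * u by rewrite mulr_ge0.
  have /andP[k1 k2] := truncn_itv Nu0.
  set k := Num.truncn (N%:R * u) in k1 k2.
  have l1 : k%:R * L 1 <= L (N%:R * u).
    by rewrite -LM ?ler01// mulr1 Lmono.
  have l2 : L (N%:R * u) <= k.+1%:R * L 1.
    by rewrite -LM ?ler01// mulr1 Lmono// ltW.
  have l3 : k%:R * L 1 <= N%:R * u * L 1 by rewrite ler_wpM2r.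
  have l4 : N%:R * u * L 1 <= k.+1%:R * L 1 by rewrite ler_wpM2r// ltW.
  rewrite -natr1 mulrDl mul1r in l2 l4.
  by rewrite mulrA ler_norml; apply/andP; split; lra.
apply/eqP; rewrite -subr_eq0 -normr_eq0; apply/eqP/le_anti.
rewrite normr_ge0 andbT leNgt; apply/negP => e0.
have := key (Num.truncn (L 1 / `|L u - u * L 1|)).+1.
by apply/negP; rewrite -ltNge -ltr_pdivrMr// truncnS_gt.
Qed.

Lemma sin_le_id (R : realType) (x : R) : 0 <= x -> sin x <= x.
Proof.
rewrite le_eqVlt => /predU1P[<-|x0]; first by rewrite sin0.
have [|c _] := @MVT R sin cos 0 x x0.
- by apply: continuous_subspaceT => y; exact: continuous_sin.
by rewrite sin0 !subr0 => ->; rewrite ler_piMl ?cos_le1// ltW.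
Qed.

Lemma sin_sqr_le (R : realType) (x : R) : sin x ^+ 2 <= x ^+ 2.
Proof.
wlog x0 : x / 0 <= x => [H|].
  have [/H//|x0] := leP 0 x.
  by have := H (- x); rewrite sinN !sqrrN; apply; rewrite oppr_ge0 ltW.
have := sin_le_id x0; have [s0|s0 _] := leP 0 (sin x).
  by move=> sx; rewrite ler_sqr// nnegrE.
have := sin_le1 x; have := sin_geN1 x; have := pi_ge2 R.
(* A negative sine at [x >= 0] forces [x > pi], so that [x ^+ 2] exceeds 1 and the bound is
   trivial. *)
have xpi : pi < x.
  by rewrite ltNge; apply/negP => xpi; have := @sin_ge0_pi R x; rewrite x0 xpi => /(_ isT); lra.
by move=> *; nra.
Qed.

Lemma one_sub_cos_le (R : realType) (x : R) : 1 - cos x <= x ^+ 2 / 2.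
Proof.
have := sin_sqr_le (x / 2).
have -> : cos x = cos (x / 2 + x / 2) by congr cos; lra.
rewrite cosD; have := cos2Dsin2 (x / 2); rewrite -!expr2.
have -> : (x / 2) ^+ 2 = x ^+ 2 / 4 by field.
by lra.
Qed.

Section gauss_moments.
Context {R : realType}.
Notation gR := (measurableTypeR R).
Notation mu1 := (@lebesgue_measure R).
Local Open Scope ereal_scope.

Lemma gauss1_moment2_lty : \int[mu1]_s (s ^+ 2 * gauss1 s)%:E < +oo.
Proof.
pose a : R := (Num.sqrt 2)^-1%R.
have a0 : (0 < a)%R by rewrite invr_gt0 sqrtr_gt0.
have a2 : (a ^+ 2 = 2^-1)%R by rewrite exprVn sqr_sqrtr.
have mg := @measurable_gauss1 R.
(* Half of the exponent absorbs the square, as s^2 / 4 <= exp (s^2 / 4); the other half is the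
   Gaussian dilated by [a]. *)
apply: (@le_lt_trans _ _ (\int[mu1]_s (4 * gauss1 (a * s + 0))%:E)).
  apply: ge0_le_integralW => s _; rewrite lee_fin.
    by rewrite mulr_ge0 ?sqr_ge0 ?gauss1_ge0.
  rewrite /gauss1 mulrCA (mulrCA 4%R) ler_wpM2l ?invr_ge0 ?sqrtr_ge0//.
  rewrite addr0 exprMn a2.
  have -> : (- (s ^+ 2 / 2) = - (2^-1 * s ^+ 2 / 2) - s ^+ 2 / 4)%R by field.
  rewrite expRD mulrCA [leRHS]mulrC ler_wpM2l ?expR_ge0// expRN.
  rewrite ler_pdivrMr ?expR_gt0//.
  have := expR_ge1Dx (s ^+ 2 / 4); lra.
under eq_integral do rewrite EFinM.
rewrite ge0_integralZl//; last 2 first.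
- by mfun.
- by move=> s _; rewrite lee_fin gauss1_ge0.
have mg' : measurable_fun [set: gR] (fun s => (gauss1 s)%:E) by mfun.
have := @ge0_integral_affine1 R (fun s => (gauss1 s)%:E) a 0%R (lt0r_neq0 a0) mg' (fun s => ltac:(by rewrite lee_fin gauss1_ge0)).
rewrite integral_gauss1 => aI.
have -> : \int[mu1]_x (gauss1 (a * x + 0))%:E = (`|a|^-1)%:E.
  rewrite -[LHS]mul1e -(@mulVf _ `|a|%R) ?normr_eq0 ?gt_eqF//.
  by rewrite EFinM -muleA aI mule1.
by rewrite -EFinM ltry.
Qed.

Lemma gauss1_absmoment_lty : \int[mu1]_s (`|s| * gauss1 s)%:E < +oo.
Proof.
have mg := @measurable_gauss1 R.
apply: (@le_lt_trans _ _ (\int[mu1]_s ((gauss1 s)%:E + (s ^+ 2 * gauss1 s)%:E))).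
  apply: ge0_le_integralW => s _.
    by rewrite lee_fin mulr_ge0 ?gauss1_ge0.
  rewrite -EFinD lee_fin -{2}(mul1r (gauss1 s)) -mulrDl ler_wpM2r ?gauss1_ge0//.
  by rewrite -(real_normK (num_real s)); have := sqr_ge0 (`|s| - 1)%R; nra.
rewrite ge0_integralD//; first last.
- by mfun.
- by move=> s _; rewrite lee_fin mulr_ge0 ?sqr_ge0 ?gauss1_ge0.
- by mfun.
- by move=> s _; rewrite lee_fin gauss1_ge0.
by rewrite integral_gauss1 lte_add_pinfty ?ltry// gauss1_moment2_lty.
Qed.

Definition gauss1_absmoment : R := (\int[mu1]_s (`|s| * gauss1 s))%R.

Lemma integral_gauss1_absmoment : \int[mu1]_s (`|s| * gauss1 s)%:E = gauss1_absmoment%:E.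
Proof.
rewrite fineK// ge0_fin_numE ?gauss1_absmoment_lty//.
by apply: integral_ge0 => s _; rewrite lee_fin mulr_ge0 ?gauss1_ge0.
Qed.

(** The isotropic mean over directions turns directional variations into Euclidean length; this is
    how the Euclidean norm in the perimeter arises from [L1diff]. *)
Lemma integral_gauss_abs_dotv n (w : 'rV[R]_n) :
  \int[lebesgue_rV]_z (`|dotv z w| * gauss z)%:E = (gauss1_absmoment * enorm w)%:E.
Proof.
have mg := @measurable_gauss1 R.
have mabs : measurable_fun [set: gR] (fun s : gR => `|s|%:E) by mfun.
rewrite mulrC EFinM -integral_gauss1_absmoment -ge0_integralZl//; last 3 first.
- by mfun.
- by move=> s _; rewrite lee_fin mulr_ge0 ?gauss1_ge0.
- by rewrite lee_fin enorm_ge0.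
have := @ge0_integral_gauss_dotv R n (fun s : gR => `|s|%:E) w mabs (fun s => ltac:(by rewrite lee_fin)).
under eq_integral do rewrite -EFinM; move=> ->.
apply: eq_integral => s _.
by rewrite -!EFinM normrM (ger0_norm (enorm_ge0 _)) -mulrA.
Qed.

Lemma gauss_moment2_lty n : \int[lebesgue_rV]_z (dotv z z * @gauss R n z)%:E < +oo.
Proof.
have mg1 := @measurable_gauss1 R.
have mg := @measurable_gauss R n.
under eq_integral do rewrite mulr_suml -sumEFin.
rewrite ge0_integral_sum//; last 2 first.
- by move=> i; mfun.
- by move=> i z _; rewrite lee_fin -expr2 mulr_ge0 ?sqr_ge0 ?gauss_ge0.
apply: lte_sum_pinfty => i _.
have msq : measurable_fun [set: gR] (fun s : gR => (s ^+ 2)%:E) by mfun.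
have := @ge0_integral_gauss_dotv R n (fun s : gR => (s ^+ 2)%:E) (delta_mx ord0 i) msq (fun s => ltac:(by rewrite lee_fin sqr_ge0)).
have -> : enorm (delta_mx ord0 i) = 1%R :> R by rewrite /enorm dotv_delta mxE !eqxx sqrtr1.
rewrite (_ : \int[_]_x _ = \int[lebesgue_rV]_x (x ord0 i * x ord0 i * gauss x)%:E); last first.
  by apply: eq_integral => z _; rewrite dotv_delta -EFinM expr2.
move=> ->; rewrite (_ : \int[_]_x _ = \int[mu1]_s (s ^+ 2 * gauss1 s)%:E); last first.
  by apply: eq_integral => z _; rewrite mul1r -EFinM.
exact: gauss1_moment2_lty.
Qed.

End gauss_moments.

(** * Fourier transform of the Gaussian from its rotation invariance *)

Section gauss_fourier.
Context {R : realType}.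
Notation gR := (measurableTypeR R).
Notation mu1 := (@lebesgue_measure R).

Let phi (t : R) : R := \int[mu1]_s (cos (t * s) * gauss1 s).

Let integrable_gauss1 : mu1.-integrable [set: gR] (EFin \o @gauss1 R).
Proof.
apply: ge0_integrable; [exact: measurable_gauss1|exact: gauss1_ge0|].
by rewrite integral_gauss1 ltry.
Qed.

Let integrable_cos t : mu1.-integrable [set: gR] (fun s => (cos (t * s) * gauss1 s)%:E).
Proof.
have mg := @measurable_gauss1 R.
apply: (integrable_le _ _ integrable_gauss1); first by mfun.
by move=> s; rewrite normrM (ger0_norm (gauss1_ge0 _)) ler_piMl ?gauss1_ge0// cos_max.
Qed.

Let integrable_lin A B t :
  mu1.-integrable [set: gR] (fun s => ((A + B * cos (t * s)) * gauss1 s)%:E).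
Proof.
have := integrableD measurableT (integrableZl measurableT A integrable_gauss1)
  (integrableZl measurableT B (integrable_cos t)).
by apply: eq_integrable => // s _; rewrite /= mulrDl -mulrA EFinD !EFinM.
Qed.

Let phiL A B t : (\int[mu1]_s ((A + B * cos (t * s)) * gauss1 s)%:E = (A + B * phi t)%:E)%E.
Proof.
rewrite (EFin_Rintegral (integrable_lin A B t)); congr EFin.
under eq_Rintegral do rewrite mulrDl -mulrA.
rewrite RintegralD//; last 2 first.
- exact: (integrableZl measurableT A integrable_gauss1).
- exact: (integrableZl measurableT B (integrable_cos t)).
rewrite (RintegralZl _ measurableT integrable_gauss1).
rewrite (RintegralZl _ measurableT (integrable_cos t)); congr (_ + _).
by rewrite /Rintegral integral_gauss1 mulr1.
Qed.

Let phiE t : (\int[mu1]_s ((1 + cos (t * s)) * gauss1 s)%:E = (1 + phi t)%:E)%E.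
Proof. by rewrite -[phi t]mul1r -phiL; under [RHS]eq_integral do rewrite mul1r. Qed.

(** The rotation lemma for [b] and for [- b] gives the same value. Adding the two, cos (x + y) + cos
    (x - y) = 2 cos x cos y leaves the product. The function [1 + cos] meets the nonnegativity that
    the rotation lemma asks for. *)
Let phiM a b : phi a * phi b = phi (Num.sqrt (a ^+ 2 + b ^+ 2)).
Proof.
have mg := @measurable_gauss1 R.
have cos1 (x : R) : (0 <= 1 + cos x) by have := cos_geN1 x; lra.
have mcos : measurable_fun [set: gR] (fun s : gR => (1 + cos s)%:E) by mfun.
have rot c := ge0_integral_gauss1_rotation a c mcos (fun s => ltac:(by rewrite lee_fin)).
have E c : (\int[mu1]_z \int[mu1]_s ((1 + cos (a * z + c * s)) * (gauss1 z * gauss1 s))%:E = (1 + phi (Num.sqrt (a ^+ 2 + c ^+ 2)))%:E)%E.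
  rewrite -phiE -rot.
  by apply: eq_integral => z _.
have E1 := E b; have E2 := E (- b).
rewrite sqrrN in E2.
suff : (2 + 2 * (phi a * phi b))%:E = (2 + 2 * phi (Num.sqrt (a ^+ 2 + b ^+ 2)))%:E.
  by move=> [] ?; lra.
have -> : (2 + 2 * phi (Num.sqrt (a ^+ 2 + b ^+ 2)))%R =
  (1 + phi (Num.sqrt (a ^+ 2 + b ^+ 2))) + (1 + phi (Num.sqrt (a ^+ 2 + b ^+ 2))) by lra.
rewrite [RHS]EFinD -{1}E1 -E2.
pose k c (p : gR * gR) : \bar R := ((1 + cos (a * p.1 + c * p.2)) * (gauss1 p.1 * gauss1 p.2))%:E.
have mk c : measurable_fun setT (k c) by rewrite /k; mfun.
have k0 c p : (0 <= k c p)%E by rewrite lee_fin mulr_ge0 ?mulr_ge0 ?gauss1_ge0.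
rewrite -[X in (_ = X + _)%E]/(\int[mu1]_z \int[mu1]_s k b (z, s))%E.
rewrite -[X in (_ = _ + X)%E]/(\int[mu1]_z \int[mu1]_s k (- b)%R (z, s))%E.
rewrite -ge0_integralD//; first last.
- exact: (@measurable_fun_fubini_tonelli_F _ _ gR gR _ mu1 (k (- b)) (mk _) (k0 _)).
- by move=> z _; apply: integral_ge0.
- exact: (@measurable_fun_fubini_tonelli_F _ _ gR gR _ mu1 (k b) (mk _) (k0 _)).
- by move=> z _; apply: integral_ge0.
transitivity (\int[mu1]_z ((2 + 2 * cos (a * z) * phi b) * gauss1 z)%:E)%E.
  have -> : (2 + 2 * (phi a * phi b)) = 2 + 2 * phi b * phi a by lra.
  by rewrite -phiL; apply: eq_integral => z _; congr EFin; lra.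
apply: eq_integral => z _.
rewrite -ge0_integralD//; first last.
- by apply: measurableT_comp (mk _) _; mfun.
- by apply: measurableT_comp (mk _) _; mfun.
have -> : ((2 + 2 * cos (a * z) * phi b) * gauss1 z) = 2 * gauss1 z + (2 * gauss1 z * cos (a * z)) * phi b by lra.
rewrite -phiL.
apply: eq_integral => s _; rewrite /k /= -!EFinD; congr EFin.
by rewrite mulNr !cosD cosN sinN; lra.
Qed.

Let phi0 : phi 0 = 1.
Proof.
rewrite /phi /Rintegral.
under eq_integral do rewrite mul0r cos0 mul1r.
by rewrite integral_gauss1.
Qed.

Let phiB t : (1 - phi t)%:E = (\int[mu1]_s ((1 - cos (t * s)) * gauss1 s)%:E)%E.
Proof.
rewrite -[phi t]mul1r -mulNr -phiL.
by under [RHS]eq_integral do rewrite -[X in (1 - X)%R]mul1r -mulNr.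
Qed.

Let phi_near0 : exists M, forall t, 1 - phi t <= t ^+ 2 * M.
Proof.
have mg := @measurable_gauss1 R.
exists (\int[mu1]_s (s ^+ 2 * gauss1 s)); move=> t.
have I0 : (0 <= \int[mu1]_s (s ^+ 2 * gauss1 s)%:E)%E.
  by apply: integral_ge0 => s _; rewrite lee_fin mulr_ge0 ?sqr_ge0 ?gauss1_ge0.
rewrite -lee_fin phiB EFinM fineK; last by rewrite ge0_fin_numE// gauss1_moment2_lty.
rewrite -ge0_integralZl//; last 3 first.
- by mfun.
- by move=> s _; rewrite lee_fin mulr_ge0 ?sqr_ge0 ?gauss1_ge0.
- by rewrite lee_fin sqr_ge0.
apply: ge0_le_integralW => s _; rewrite -?EFinM lee_fin.
  by rewrite mulr_ge0 ?gauss1_ge0// subr_ge0 cos_le1.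
rewrite [leRHS]mulrA ler_wpM2r ?gauss1_ge0// -exprMn.
by rewrite (le_trans (one_sub_cos_le _))//; have := sqr_ge0 (t * s); lra.
Qed.

Let phi1_lt1 : phi 1 < 1.
Proof.
rewrite -subr_gt0 -lte_fin phiB.
have cos1 : cos 1 < 1 :> R.
  by rewrite -[ltRHS](@cos0 R) ltr_cos ?ltr01// in_itv/=; have := pi_ge2 R; lra.
have mg := @measurable_gauss1 R.
have g2 : 0 < gauss1 (2 : R) by rewrite mulr_gt0 ?invr_gt0 ?sqrt2pi_gt0 ?expR_gt0.
apply: (@lt_le_trans _ _ (\int[mu1]_(s in `[1%R, 2%R]) ((1 - cos 1) * gauss1 2)%:E)%E).
  rewrite integral_cst//= lebesgue_measure_itv/= lte_fin ltr1n -EFinB -EFinM lte_fin.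
  have c0 : 0 < 1 - cos 1 :> R by rewrite subr_gt0.
  by apply: mulr_gt0; [exact: mulr_gt0|lra].
apply: (@le_trans _ _ (\int[mu1]_(s in `[1%R, 2%R]) ((1 - cos (1 * s)) * gauss1 s)%:E)%E).
  apply: ge0_le_integralW => s /=; rewrite in_itv/= => /andP[s1 s2]; rewrite lee_fin.
    by rewrite mulr_ge0 ?subr_ge0 ?cos_le1// ltW.
  rewrite ler_pM ?subr_ge0 ?cos_le1 ?gauss1_ge0//.
    rewrite mul1r lerD2l lerN2 leNgt ltr_cos -?leNgt// in_itv/=; have := pi_ge2 R; lra.
  rewrite /gauss1 ler_wpM2l ?invr_ge0 ?sqrtr_ge0// ler_expR.
  by nra.
apply: ge0_subset_integral => //.
- by mfun.
- by move=> s _; rewrite lee_fin mulr_ge0 ?gauss1_ge0// subr_ge0 cos_le1.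
Qed.

(** By [phiM], the function [psi u = phi (sqrt u)] is multiplicative; it takes values in ]0, 1], so
    [- ln psi] is nonnegative and additive, hence linear. The slope is left unevaluated. *)
Lemma gauss1_cos : exists2 sigma : R, 0 < sigma &
  forall t, \int[mu1]_s (cos (t * s) * gauss1 s) = expR (- (sigma * t ^+ 2)).
Proof.
pose psi u := phi (Num.sqrt u).
have psiD u v : 0 <= u -> 0 <= v -> psi (u + v) = psi u * psi v.
  by move=> u0 v0; rewrite /psi phiM !sqr_sqrtr.
have psi0 : psi 0 = 1 by rewrite /psi sqrtr0 phi0.
have psiM m v : 0 <= v -> psi (m%:R * v) = psi v ^+ m.
  move=> v0; elim: m => [|m IH]; first by rewrite mul0r psi0 expr0.
  by rewrite -natr1 mulrDl mul1r psiD ?mulr_ge0// IH exprSr.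
have [M HM] := phi_near0.
(* [phi_near0] makes [psi] positive near 0. The integer [m] brings [u / m] into that range, and
   [psi u] is the m-th power of [psi (u / m)]. *)
have psi_gt0 u : 0 <= u -> 0 < psi u.
  move=> u0; pose m := (Num.truncn (u * `|M|)).+1.
  have m0 : 0 < m%:R :> R by rewrite ltr0n.
  have -> : u = m%:R * (u / m%:R) by field; rewrite gt_eqF.
  have um0 : 0 <= u / m%:R by rewrite divr_ge0// ltW.
  rewrite psiM// exprn_gt0//.
  have := HM (Num.sqrt (u / m%:R)); rewrite sqr_sqrtr// => H.
  have : u / m%:R * M < 1.
    rewrite mulrAC ltr_pdivrMr// mul1r (le_lt_trans _ (truncnS_gt _))//.
    by rewrite ler_wpM2l// ler_norm.
  by rewrite /psi; lra.
have psi_le1 u : psi u <= 1.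
  rewrite -subr_ge0 -lee_fin phiB; apply: integral_ge0 => s _.
  by rewrite lee_fin mulr_ge0 ?gauss1_ge0// subr_ge0 cos_le1.
pose L u := - ln (psi u).
have L0 u : 0 <= u -> 0 <= L u.
  by move=> u0; rewrite oppr_ge0 ln_le0.
have LD u v : 0 <= u -> 0 <= v -> L (u + v) = L u + L v.
  by move=> u0 v0; rewrite /L psiD// lnM ?posrE ?psi_gt0// opprD.
(* The slope is positive because [phi 1 < 1]. *)
exists (L 1).
  rewrite oppr_gt0 ln_lt0// psi_gt0 ?ler01//=.
  by rewrite /psi sqrtr1; exact: phi1_lt1.
move=> t; rewrite -/(phi t).
have E u : 0 <= u -> phi u = expR (- (L 1 * u ^+ 2)).
  move=> u0; rewrite mulrC -(additive_ge0_linear L0 LD) ?sqr_ge0//.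
  rewrite opprK lnK ?posrE ?psi_gt0 ?sqr_ge0//.
  by rewrite /psi sqrtr_sqr ger0_norm.
have [/E//|t0] := leP 0 t.
have -> : phi t = phi (- t).
  by apply: eq_Rintegral => s _; rewrite mulNr cosN.
by rewrite E ?sqrrN// oppr_ge0 ltW.
Qed.

End gauss_fourier.

(** * Fubini's theorem for real integrals, and convolution *)

Lemma measurable_ge0_integral1 d1 d2 (T1 : measurableType d1) (T2 : measurableType d2)
    (R : realType) (m2 : {sigma_finite_measure set T2 -> \bar R}) (g : T1 * T2 -> \bar R) :
  measurable_fun setT g -> (forall p, 0 <= g p)%E ->
  measurable_fun setT (fun x => \int[m2]_y g (x, y))%E.
Proof. by move=> mg g0; exact: (@measurable_fun_fubini_tonelli_F _ _ T1 T2 R m2 g mg g0). Qed.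

Section Rfubini.
Context {R : realType} d1 d2 (T1 : measurableType d1) (T2 : measurableType d2).
Variables (m1 : {sigma_finite_measure set T1 -> \bar R})
  (m2 : {sigma_finite_measure set T2 -> \bar R}).
Variable f : T1 * T2 -> R.
Hypothesis mf : measurable_fun setT f.

Lemma measurable_integral1 : measurable_fun setT (fun x => \int[m2]_y (f (x, y))%:E)%E.
Proof.
pose g (p : T1 * T2) := (f p)%:E.
have mg : measurable_fun setT g by exact/measurable_EFinP.
rewrite (_ : (fun x => _) = (fun x => \int[m2]_y g^\+ (x, y) - \int[m2]_y g^\- (x, y))%E).
  apply: emeasurable_funB.
    by apply: (measurable_ge0_integral1 m2 (measurable_funepos mg)).
  by apply: (measurable_ge0_integral1 m2 (measurable_funeneg mg)).
by apply/funext => x; rewrite [LHS]integralE; congr (_ - _)%E;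
  apply: eq_integral => y _; rewrite ?funeposE ?funenegE.
Qed.

Lemma measurable_Rintegral1 : measurable_fun setT (fun x => \int[m2]_y f (x, y)).
Proof.
apply: (@measurableT_comp _ _ _ _ _ _ (@fine R) _ (fun x => \int[m2]_y (f (x, y))%:E)%E).
  exact: fine_measurable.
exact: measurable_integral1.
Qed.

Hypothesis foo : (\int[m1]_x \int[m2]_y `|f (x, y)|%:E < +oo)%E.

Let fprod : (m1 \x m2)%E.-integrable setT (EFin \o f).
Proof. by apply/integrable12ltyP => //; exact/measurable_EFinP. Qed.

Hypothesis f1 : forall x, m2.-integrable setT (fun y => (f (x, y))%:E).

Lemma integrable_Rintegral1 : m1.-integrable setT (fun x => (\int[m2]_y f (x, y))%:E).
Proof.
apply: eq_integrable (integrable_fubini_F fprod) => // x _ /=.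
by rewrite /fubini_F -(EFin_Rintegral (f1 x)).
Qed.

Hypothesis f2 : forall y, m1.-integrable setT (fun x => (f (x, y))%:E).

(** Since every section is integrable, and not only almost every one, the inner integrals are finite
    at each point and [fine] loses nothing. *)
Lemma RFubini : \int[m1]_x (\int[m2]_y f (x, y)) = \int[m2]_y (\int[m1]_x f (x, y)).
Proof.
congr fine.
transitivity (\int[m1]_x \int[m2]_y (f (x, y))%:E)%E.
  by apply: eq_integral => x _; rewrite -(EFin_Rintegral (f1 x)).
transitivity (\int[m2]_y \int[m1]_x (f (x, y))%:E)%E.
  exact: (Fubini fprod).
by apply: eq_integral => y _; rewrite -(EFin_Rintegral (f2 y)).
Qed.

End Rfubini.

Section convolution.
Context {R : realType} {n : nat}.
Notation V := 'rV[R]_n.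
Notation mu := (@lebesgue_rV R n).
Implicit Types k u T : V -> R.

Lemma Rintegral_shift (f : V -> R) v : measurable_fun setT f ->
  \int[mu]_x f (x + v) = \int[mu]_x f x.
Proof.
move=> mf; congr fine; apply: (integral_shift (f := fun x => (f x)%:E) v).
exact/measurable_EFinP.
Qed.

Lemma Rintegral_reflect (f : V -> R) v : measurable_fun setT f ->
  \int[mu]_x f (v - x) = \int[mu]_x f x.
Proof.
move=> mf; congr fine; apply: (integral_reflect (f := fun x => (f x)%:E) v).
exact/measurable_EFinP.
Qed.

Lemma integrable_shift (f : V -> R) v : mu.-integrable setT (EFin \o f) ->
  mu.-integrable setT (fun x => (f (x + v))%:E).
Proof.
move=> fi; have mf : measurable_fun setT f by exact/measurable_EFinP/measurable_int/fi.
apply/integrableP; split; first by mfun.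
rewrite (integral_shift (f := fun x => `|(f x)%:E|%E)); last by mfun.
by case/integrableP : fi.
Qed.

Lemma integrable_reflect (f : V -> R) v : mu.-integrable setT (EFin \o f) ->
  mu.-integrable setT (fun x => (f (v - x))%:E).
Proof.
move=> fi; have mf : measurable_fun setT f by exact/measurable_EFinP/measurable_int/fi.
apply/integrableP; split; first by mfun.
rewrite (integral_reflect (f := fun x => `|(f x)%:E|%E)); last by mfun.
by case/integrableP : fi.
Qed.

Lemma integrable_mul_bounded d (S : measurableType d) (m : {measure set S -> \bar R})
    (f g : S -> R) C : measurable_fun setT f ->
  (forall x, `|f x| <= C) -> m.-integrable setT (EFin \o g) ->
  m.-integrable setT (fun x => (f x * g x)%:E).
Proof.
move=> mf fC gi.
have mg : measurable_fun setT g by exact/measurable_EFinP/measurable_int/gi.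
apply: (@integrable_le _ _ _ _ _ (fun x => C * `|g x|)); first by mfun.
  by move=> x; rewrite normrM ler_wpM2r.
exact: (integrableZl measurableT C (integrable_norm gi)).
Qed.

Section conv.
Variables (k u : V -> R) (M : R).
Hypothesis ki : mu.-integrable setT (EFin \o k).
Hypothesis ui : mu.-integrable setT (EFin \o u).
Hypothesis uM : forall x, `|u x| <= M.

Let mk : measurable_fun setT k. Proof. exact/measurable_EFinP/measurable_int/ki. Qed.
Let mu' : measurable_fun setT u. Proof. exact/measurable_EFinP/measurable_int/ui. Qed.

(** The bound on [u] makes the convolution converge at every point, as [RFubini] requires. *)
Lemma integrable_conv_integrand x : mu.-integrable setT (fun y => (k (x - y) * u y)%:E).
Proof.
have := integrable_mul_bounded mu' uM (integrable_reflect x ki).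
by apply: eq_integrable => // y _; rewrite mulrC.
Qed.

Lemma integral_conv_abs :
  (\int[mu]_x \int[mu]_y `|k (x - y) * u y|%:E =
   \int[mu]_x `|k x|%:E * \int[mu]_y `|u y|%:E)%E.
Proof.
pose h (p : V * V) := `|k (p.1 - p.2) * u p.2|%:E.
have mh : measurable_fun setT h by rewrite /h; mfun.
have h0 p : (0 <= h p)%E by rewrite lee_fin.
have -> := @sfinite_Fubini _ _ V V R mu mu h h0 mh.
rewrite -ge0_integralZl//; last 2 first.
- by mfun.
- exact: integral_ge0.
apply: eq_integral => y _; rewrite /h /=.
under eq_integral do rewrite normrM EFinM.
rewrite ge0_integralZr//; last by mfun.
by rewrite (integral_shift (f := fun x => `|k x|%:E)) //; mfun.
Qed.

Let conv_lty : (\int[mu]_x \int[mu]_y `|k (x - y) * u y|%:E < +oo)%E.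
Proof.
rewrite integral_conv_abs; have /integrableP[_ /= a] := ki; have /integrableP[_ /= b] := ui.
by rewrite lte_mul_pinfty// ?integral_ge0// ge0_fin_numE// integral_ge0.
Qed.

Lemma measurable_conv : measurable_fun setT (convolution k u).
Proof.
pose h (p : V * V) := k (p.1 - p.2) * u p.2.
have mh : measurable_fun setT h by rewrite /h; mfun.
exact: (measurable_Rintegral1 mu mh).
Qed.

Lemma integrable_conv : mu.-integrable setT (EFin \o convolution k u).
Proof.
apply: (@integrable_Rintegral1 _ _ _ _ _ mu mu (fun p : V * V => k (p.1 - p.2) * u p.2)).
- by mfun.
- exact: conv_lty.
- exact: integrable_conv_integrand.
Qed.

(** Fubini moves the kernel onto the bounded function [T]. With [T] a cosine or sine this leads to
    the Fourier transform of a convolution, with [T] a component of a field to integration by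
    parts. *)
Lemma Rintegral_conv (T : V -> R) C : measurable_fun setT T ->
  (forall x, `|T x| <= C) ->
  \int[mu]_x (T x * convolution k u x) = \int[mu]_y (u y * \int[mu]_x (T x * k (x - y))).
Proof.
move=> mT TC.
pose h (p : V * V) := T p.1 * (k (p.1 - p.2) * u p.2).
have mh : measurable_fun setT h by rewrite /h; mfun.
have h1 x : mu.-integrable setT (fun y => (h (x, y))%:E).
  exact: (integrableZl measurableT (T x) (integrable_conv_integrand x)).
have Tk y : mu.-integrable setT (fun x => (T x * k (x - y))%:E).
  exact: integrable_mul_bounded mT TC (integrable_shift (- y) ki).
have h2 y : mu.-integrable setT (fun x => (h (x, y))%:E).
  have := integrableZl measurableT (u y) (Tk y).
  by apply: eq_integrable => // x _ /=; rewrite /h /= -EFinM mulrC -mulrA.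
have hoo : (\int[mu]_x \int[mu]_y `|h (x, y)|%:E < +oo)%E.
  have C0 : 0 <= C := le_trans (normr_ge0 _) (TC 0).
  apply: (@le_lt_trans _ _ (C%:E * \int[mu]_x \int[mu]_y `|k (x - y) * u y|%:E)%E).
    rewrite -ge0_integralZl//; last 2 first.
    - apply: (@measurable_ge0_integral1 _ _ _ _ _ mu (fun p : V * V => `|k (p.1 - p.2) * u p.2|%:E)).
        by mfun.
      by move=> p; rewrite lee_fin.
    - by move=> x _; exact: integral_ge0.
    apply: ge0_le_integralW => x _; first exact: integral_ge0.
    rewrite -ge0_integralZl//; last by mfun.
    apply: ge0_le_integralW => y _ //.
    by rewrite -EFinM lee_fin /h /= normrM ler_wpM2r.
  by rewrite lte_mul_pinfty// conv_lty.
transitivity (\int[mu]_x (\int[mu]_y h (x, y))).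
  apply: eq_Rintegral => x _.
  by rewrite /h /= (RintegralZl _ measurableT (integrable_conv_integrand x)).
rewrite (RFubini mh hoo h1 h2).
apply: eq_Rintegral => y _; rewrite -(RintegralZl _ measurableT (Tk y)).
by apply: eq_Rintegral => x _; rewrite /h /= [RHS]mulrC -mulrA.
Qed.

End conv.

End convolution.

Section gauss_fourier_rV.
Context {R : realType}.

Lemma integrable_gauss n : (@lebesgue_rV R n).-integrable setT (EFin \o @gauss R n).
Proof.
apply: ge0_integrable; [exact: measurable_gauss|exact: gauss_ge0|].
by rewrite integral_gauss ltry.
Qed.

Lemma integrable_cos_gauss n (w : 'rV[R]_n) :
  (@lebesgue_rV R n).-integrable setT (fun z => (cos (dotv z w) * gauss z)%:E).
Proof.
apply: (@integrable_mul_bounded _ _ _ _ (fun z => cos (dotv z w)) _ 1 _ _ (@integrable_gauss n)).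
  by mfun.
by move=> x; exact: cos_max.
Qed.

(** [ge0_integral_gauss_dotv], applied to the nonnegative [1 + cos], reduces to the line; hence one
    [sigma] serves all dimensions. *)
Lemma gauss_cos : exists2 sigma : R, 0 < sigma & forall n (w : 'rV[R]_n),
  \int[lebesgue_rV]_z (cos (dotv z w) * gauss z) = expR (- (sigma * dotv w w)).
Proof.
have mg1 := @measurable_gauss1 R.
have [sigma s0 Hs] := @gauss1_cos R; exists sigma => // n w.
rewrite -enorm_sqr -Hs.
have mg := @measurable_gauss R n.
have mcos : measurable_fun [set: measurableTypeR R] (fun s : R => (1 + cos s)%:E) by mfun.
have c0 (s : measurableTypeR R) : (0 <= (1 + cos s)%:E)%E.
  by rewrite lee_fin; have := cos_geN1 s; lra.
have := ge0_integral_gauss_dotv w mcos c0.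
have ig1 : lebesgue_measure.-integrable setT (EFin \o @gauss1 R).
  by apply: ge0_integrable; [|exact: gauss1_ge0|rewrite integral_gauss1 ltry].
have icg1 : lebesgue_measure.-integrable setT (fun s => (cos (enorm w * s) * gauss1 s)%:E).
  apply: (@integrable_mul_bounded R _ (measurableTypeR R) lebesgue_measure (fun s => cos (enorm w * s)) _ 1 _ _ ig1).
    by mfun.
  by move=> x; exact: cos_max.
rewrite (_ : \int[_]_z _ = (1 + \int[lebesgue_rV]_z (cos (dotv z w) * gauss z)%R)%:E)%E; last first.
  transitivity (\int[lebesgue_rV]_z ((gauss z)%:E + (cos (dotv z w) * gauss z)%:E))%E.
    by apply: eq_integral => z _; rewrite -EFinM -EFinD mulrDl mul1r.
  rewrite integralD//; [|exact: integrable_gauss|exact: integrable_cos_gauss].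
  by rewrite integral_gauss EFinD -EFin_Rintegral//; exact: integrable_cos_gauss.
rewrite (_ : \int[_]_z _ = (1 + \int[lebesgue_measure]_s (cos (enorm w * s) * gauss1 s)%R)%:E)%E; last first.
  transitivity (\int[lebesgue_measure]_s ((gauss1 s)%:E + (cos (enorm w * s) * gauss1 s)%:E))%E.
    by apply: eq_integral => z _; rewrite -EFinM -EFinD mulrDl mul1r.
  rewrite integralD//.
  by rewrite integral_gauss1 EFinD -EFin_Rintegral.
by move=> [] /addrI.
Qed.

Lemma gauss_sin n (w : 'rV[R]_n) : \int[lebesgue_rV]_z (sin (dotv z w) * gauss z) = 0.
Proof.
have mg := @measurable_gauss R n.
set I := LHS.
have : I = - I.
  rewrite {1}/I -(@Rintegral_reflect _ _ _ 0); last by mfun.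
  rewrite -mulN1r -RintegralZl//; last first.
    apply: (@integrable_mul_bounded _ _ _ _ (fun z => sin (dotv z w)) _ 1 _ _ (@integrable_gauss n)).
      by mfun.
    by move=> x; exact: sin_max.
  apply: eq_Rintegral => z _; rewrite sub0r dotvNl sinN gaussN.
  by rewrite mulN1r mulNr.
lra.
Qed.

End gauss_fourier_rV.

(** * Gaussian means of the Fourier transform of an indicator function *)

Section variation.
Context {R : realType} {n : nat}.
Notation V := 'rV[R]_n.
Notation mu := (@lebesgue_rV R n).
Local Open Scope ereal_scope.

Definition L1diff (u : V -> R) (h : V) : \bar R := \int[mu]_x `|u (x + h) - u x|%:E.

Definition gauss_L1diff (u : V -> R) (t : R) : \bar R :=
  \int[mu]_z (L1diff u (t *: z) * (gauss z)%:E).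

Lemma L1diff_ge0 u h : 0 <= L1diff u h.
Proof. by apply: integral_ge0 => x _; rewrite lee_fin. Qed.

Lemma measurable_L1diff u : measurable_fun setT u -> measurable_fun setT (L1diff u).
Proof.
move=> mu'; pose h (p : V * V) := `|u (p.2 + p.1)%R - u p.2|%:E.
have mh : measurable_fun setT h by rewrite /h; mfun.
by apply: (measurable_ge0_integral1 mu mh) => p; rewrite lee_fin.
Qed.

Lemma gauss_L1diff_ge0 u t : 0 <= gauss_L1diff u t.
Proof. by apply: integral_ge0 => x _; rewrite mule_ge0 ?L1diff_ge0// lee_fin gauss_ge0. Qed.

Variables (A : set V).
Hypotheses (mA : measurable A) (Aoo : mu A < +oo).
Let u : V -> R := \1_A.
Let m : R := fine (mu A).

Lemma measurable_indicR : measurable_fun [set: V] (\1_A : V -> R).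
Proof. exact: measurable_indic. Qed.

Let mu' : measurable_fun setT u. Proof. exact: measurable_indicR. Qed.

Lemma indic_ge0 (x : V) : (0 <= \1_A x :> R)%R.
Proof. by rewrite indicE. Qed.

Lemma normr_indic_le1 (x : V) : (`|\1_A x : R| <= 1)%R.
Proof. by rewrite indicE; case: (_ \in _); rewrite ?normr1 ?normr0. Qed.

Lemma integral_indicR : \int[mu]_x (\1_A x)%:E = m%:E.
Proof. by rewrite integral_indic// setIT fineK// ge0_fin_numE. Qed.

Lemma integrable_indicR : mu.-integrable setT (EFin \o (\1_A : V -> R)).
Proof. by apply: ge0_integrable => [||]; [exact: measurable_indicR|exact: indic_ge0|rewrite integral_indicR ltry]. Qed.

(** The covariogram of [A]: the measure of the intersection of [A] with its translate by [- h]. *)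
Definition L1corr (h : V) : \bar R := \int[mu]_x (\1_A x * \1_A (x + h)%R)%:E.

(** For p and q in {0, 1}, |p - q| + 2 p q = p + q. The additive form avoids subtracting extended
    reals. *)
Lemma L1diff_corr h : L1diff u h + 2%:E * L1corr h = (2 * m)%:E.
Proof.
have muA : measurable_fun setT (\1_A : V -> R) := mu'.
have c0 x : 0 <= (\1_A x * \1_A (x + h)%R : R)%:E by rewrite lee_fin mulr_ge0 ?indic_ge0.
rewrite /L1diff /L1corr -ge0_integralZl//; last by mfun.
rewrite -ge0_integralD//; first last.
- by mfun.
- by mfun.
transitivity (\int[mu]_x ((u (x + h)%R)%:E + (u x)%:E)).
  apply: eq_integral => x _; rewrite -EFinM -!EFinD; congr EFin.
  rewrite /u !indicE; case: (_ \in _); case: (_ \in _) => /=;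
  rewrite ?subrr ?subr0 ?sub0r ?normr0 ?normrN ?normr1; lra.
rewrite ge0_integralD//; last 4 first.
- by move=> x _; rewrite lee_fin indic_ge0.
- by mfun.
- by move=> x _; rewrite lee_fin indic_ge0.
- by mfun.
rewrite (integral_shift (f := fun x => (u x)%:E)); last by mfun.
by rewrite integral_indicR -EFinD mulr_natl.
Qed.

Lemma gauss_L1diff_corr t : gauss_L1diff u t +
  2%:E * \int[mu]_z (L1corr (t *: z)%R * (gauss z)%:E) = (2 * m)%:E.
Proof.
have mg := @measurable_gauss R n.
have mD := measurable_L1diff mu'.
have mS : measurable_fun setT L1corr.
  pose h (p : V * V) := (u p.2 * u (p.2 + p.1)%R)%:E.
  have mh : measurable_fun setT h by rewrite /h; mfun.
  by apply: (measurable_ge0_integral1 mu mh) => p; rewrite lee_fin mulr_ge0 ?indic_ge0.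
have S0 h : 0 <= L1corr h.
  by apply: integral_ge0 => x _; rewrite lee_fin mulr_ge0 ?indic_ge0.
rewrite -ge0_integralZl//; last 2 first.
- by mfun.
- by move=> x _; rewrite mule_ge0// lee_fin gauss_ge0.
rewrite -ge0_integralD//; last 4 first.
- by move=> x _; rewrite mule_ge0 ?L1diff_ge0// lee_fin gauss_ge0.
- by mfun.
- by move=> x _; rewrite ?mule_ge0// lee_fin gauss_ge0.
- by mfun.
transitivity (\int[mu]_z ((2 * m)%:E * (gauss z)%:E)).
  apply: eq_integral => z _; rewrite muleA -ge0_muleDl ?L1diff_corr//.
  - exact: L1diff_ge0.
  - by rewrite mule_ge0.
rewrite ge0_integralZl//; last 3 first.
- by mfun.
- by move=> x _; rewrite lee_fin gauss_ge0.
- by rewrite lee_fin mulr_ge0// fine_ge0.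
by rewrite integral_gauss mule1.
Qed.

Lemma gauss_L1diff_fin t : gauss_L1diff u t \is a fin_num.
Proof.
rewrite ge0_fin_numE ?gauss_L1diff_ge0//; apply: le_lt_trans (ltry (2 * m)).
rewrite -(gauss_L1diff_corr t) leeDl// mule_ge0//.
apply: integral_ge0 => z _; rewrite mule_ge0 ?lee_fin ?gauss_ge0//.
by apply: integral_ge0 => x _; rewrite lee_fin mulr_ge0 ?indic_ge0.
Qed.

Lemma gauss_L1diff_le t : gauss_L1diff u t <= (2 * m)%:E.
Proof.
rewrite -(gauss_L1diff_corr t) leeDl// mule_ge0//.
apply: integral_ge0 => z _; rewrite mule_ge0 ?lee_fin ?gauss_ge0//.
by apply: integral_ge0 => x _; rewrite lee_fin mulr_ge0 ?indic_ge0.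
Qed.

End variation.

Section fourier_energy.
Context {R : realType} {n : nat} (sigma b : R).
Notation V := 'rV[R]_n.
Notation mu := (@lebesgue_rV R n).
Hypotheses (sigma_gt0 : 0 < sigma) (b0 : b != 0).
Hypothesis gauss_cosE : forall w : V,
  \int[mu]_z (cos (dotv z w) * gauss z) = expR (- (sigma * dotv w w)).
Variables (A : set V).
Hypotheses (mA : measurable A) (Aoo : (mu A < +oo)%E).
Let u : V -> R := \1_A.
Let m : R := fine (mu A).
Let mu' : measurable_fun setT u. Proof. exact: measurable_indicR. Qed.
Let ui : mu.-integrable setT (EFin \o u). Proof. exact: integrable_indicR. Qed.
Let u0 x : 0 <= u x. Proof. exact: indic_ge0. Qed.
Let mg := @measurable_gauss R n.

Let Cu (xi : V) : R := \int[mu]_x (cos (b * dotv x xi) * u x).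
Let Su (xi : V) : R := \int[mu]_x (sin (b * dotv x xi) * u x).

Let integrable_cosu xi : mu.-integrable setT (fun x => (cos (b * dotv x xi) * u x)%:E).
Proof.
apply: (@integrable_mul_bounded _ _ _ _ (fun x => cos (b * dotv x xi)) _ 1 _ _ ui).
  by mfun.
by move=> x; exact: cos_max.
Qed.

Let integrable_sinu xi : mu.-integrable setT (fun x => (sin (b * dotv x xi) * u x)%:E).
Proof.
apply: (@integrable_mul_bounded _ _ _ _ (fun x => sin (b * dotv x xi)) _ 1 _ _ ui).
  by mfun.
by move=> x; exact: sin_max.
Qed.

(** The squared modulus of [fourier 1 b] of the indicator function; the factor [a ^+ 2] returns in
    [Hhalf_norm_sq_gauss]. *)
Definition fourier_sq (xi : V) : R := Cu xi ^+ 2 + Su xi ^+ 2.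

Lemma fourier_sq_ge0 xi : 0 <= fourier_sq xi.
Proof. by rewrite addr_ge0 ?sqr_ge0. Qed.

Lemma measurable_fourier_sq : measurable_fun setT fourier_sq.
Proof.
pose hc (p : V * V) := cos (b * dotv p.2 p.1) * u p.2.
pose hs (p : V * V) := sin (b * dotv p.2 p.1) * u p.2.
have mhc : measurable_fun setT hc by rewrite /hc; mfun.
have mhs : measurable_fun setT hs by rewrite /hs; mfun.
have mC : measurable_fun setT Cu := measurable_Rintegral1 mu mhc.
have mS : measurable_fun setT Su := measurable_Rintegral1 mu mhs.
by rewrite /fourier_sq; mfun.
Qed.

Let lin3 c0 c1 c2 xi : (\int[mu]_x (c0 * u x + c1 * (cos (b * dotv x xi) * u x) +
    c2 * (sin (b * dotv x xi) * u x))%:E = (c0 * m + c1 * Cu xi + c2 * Su xi)%:E)%E.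
Proof.
have i0 := integrableZl measurableT c0 ui.
have i1 := integrableZl measurableT c1 (integrable_cosu xi).
have i2 := integrableZl measurableT c2 (integrable_sinu xi).
under eq_integral do rewrite !EFinD !EFinM.
rewrite integralD//=; last first.
  by apply: (@integrableD _ _ _ _ _ measurableT (fun x => c0%:E * (u x)%:E)%E (fun x => c1%:E * ((cos (b * dotv x xi))%:E * (u x)%:E))%E).
rewrite integralD//=.
rewrite (integralZl measurableT ui) (integralZl measurableT (integrable_cosu xi)).
rewrite (integralZl measurableT (integrable_sinu xi)).
rewrite integral_indicR// (EFin_Rintegral (integrable_cosu xi)) (EFin_Rintegral (integrable_sinu xi)).
by rewrite !EFinD !EFinM.
Qed.

Let one_cos xi x y : u x * u y * (1 + cos (b * dotv (x - y) xi)) =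
  u x * u y + u x * cos (b * dotv x xi) * (cos (b * dotv y xi) * u y) +
    u x * sin (b * dotv x xi) * (sin (b * dotv y xi) * u y).
Proof. by rewrite dotvDl dotvNl (mulrDr b) (mulrN b) cosB; ring. Qed.

(** [fourier_sq xi] is the double integral of cos (b (x - y).xi) over [A], by the formula for the
    cosine of a difference. Adding 1 to the cosine costs [m ^+ 2] and makes the integrand fit for
    Tonelli. *)
Lemma fourier_sqE xi :
  (\int[mu]_x \int[mu]_y (u x * u y * (1 + cos (b * dotv (x - y) xi)))%:E =
   (m ^+ 2 + fourier_sq xi)%:E)%E.
Proof.
under eq_integral => x _.
  under eq_integral do rewrite one_cos.
  rewrite lin3.
  rewrite (_ : _ + _ = m * u x + Cu xi * (cos (b * dotv x xi) * u x) + Su xi * (sin (b * dotv x xi) * u x)); last by ring.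
  over.
by rewrite lin3; congr EFin; rewrite /fourier_sq; ring.
Qed.

Let cos_kernel (s : R) (h : V) : 0 < s ->
  (\int[mu]_xi (expR (- (s ^+ 2 * dotv xi xi / 2)) * (1 + cos (b * dotv h xi)))%:E =
   ((Num.sqrt (2 * pi) / s) ^+ n * (1 + expR (- (sigma * b ^+ 2 * dotv h h / s ^+ 2))))%:E)%E.
Proof.
move=> s0.
pose f (z : V) : \bar R := ((1 + cos (dotv z ((b / s) *: h))) * gauss z)%:E.
have mf : measurable_fun setT f by rewrite /f; mfun.
transitivity ((Num.sqrt (2 * pi) ^+ n)%:E * \int[mu]_xi f (s *: xi))%E.
  rewrite -ge0_integralZl//; last 2 first.
  - by mfun.
  - by move=> x _; rewrite lee_fin mulr_ge0 ?gauss_ge0//; have := cos_geN1 (dotv (s *: x) ((b / s) *: h)); lra.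
  apply: eq_integral => xi _; rewrite /f -EFinM; congr EFin.
  rewrite /gauss enorm_sqr !dotvZl !dotvZr (dotvC h).
  have -> : s * (b / s * dotv xi h) = b * dotv xi h by field; rewrite gt_eqF.
  rewrite mulrCA (mulrA _ (_ ^- n)) divff ?mul1r ?expf_neq0 ?gt_eqF ?sqrt2pi_gt0//.
  by rewrite mulrC; congr (_ * expR (- (_ / 2))); ring.
rewrite integral_scale// muleA -EFinM.
have -> : (\int[mu]_x f x = (1 + expR (- (sigma * b ^+ 2 * dotv h h / s ^+ 2)))%:E)%E.
  transitivity (\int[mu]_z ((gauss z)%:E + (cos (dotv z ((b / s) *: h)) * gauss z)%:E))%E.
    by apply: eq_integral => z _; rewrite -EFinD /f mulrDl mul1r.
  rewrite integralD//; [|exact: integrable_gauss|exact: integrable_cos_gauss].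
  rewrite integral_gauss (EFin_Rintegral (integrable_cos_gauss _)) gauss_cosE.
  rewrite EFinD; congr (_ + (expR (- _))%:E)%E.
  by rewrite dotvZl dotvZr; field; rewrite gt_eqF.
by rewrite -EFinM expr_div_n.
Qed.

(** Tonelli applied to [fourier_sqE] under the Gaussian weight, where [cos_kernel] evaluates the
    integral over the frequency. The term from [m ^+ 2] occurs on both sides and is finite, so it
    cancels. *)
Let fourier_sq_gauss0 (s : R) : 0 < s ->
  (\int[mu]_xi (expR (- (s ^+ 2 * dotv xi xi / 2)) * fourier_sq xi)%:E =
   ((Num.sqrt (2 * pi) / s) ^+ n)%:E *
   \int[mu]_x \int[mu]_y (u x * u y * expR (- (sigma * b ^+ 2 * dotv (x - y) (x - y) / s ^+ 2)))%:E)%E.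
Proof.
move=> s0.
set kap := (_ ^+ n).
have kap0 : 0 <= kap by rewrite exprn_ge0// divr_ge0 ?sqrtr_ge0 ?ltW.
have mfs := measurable_fourier_sq.
pose e (xi : V) := expR (- (s ^+ 2 * dotv xi xi / 2)).
have me : measurable_fun setT e by rewrite /e; mfun.
pose g (h : V) := expR (- (sigma * b ^+ 2 * dotv h h / s ^+ 2)).
have mgg : measurable_fun setT g by rewrite /g; mfun.
have Iuu : (\int[mu]_x \int[mu]_y (u x * u y)%:E = (m ^+ 2)%:E)%E.
  under eq_integral => x _.
    under eq_integral do rewrite EFinM.
    rewrite (integralZl measurableT ui) integral_indicR//.
    over.
  by rewrite /= (integralZr measurableT ui) integral_indicR// -EFinM expr2.
pose W := (\int[mu]_x \int[mu]_y (u x * u y * g (x - y)%R)%:E)%E.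
have E1 : (\int[mu]_xi (e xi * (m ^+ 2 + fourier_sq xi))%:E = (kap * m ^+ 2)%:E + kap%:E * W)%E.
  pose h3 (p : V * (V * V)) : \bar R := (e p.1 * (u p.2.1 * u p.2.2 * (1 + cos (b * dotv (p.2.1 - p.2.2) p.1))))%:E.
  have h30 p : (0 <= h3 p)%E.
    by rewrite lee_fin !mulr_ge0 ?expR_ge0//; have := cos_geN1 (b * dotv (p.2.1 - p.2.2) p.1); lra.
  have m1 : measurable_fun setT (fun p : V * (V * V) => p.2.1).
    exact: measurableT_comp measurable_fst measurable_snd.
  have m2 : measurable_fun setT (fun p : V * (V * V) => p.2.2).
    exact: measurableT_comp measurable_snd measurable_snd.
  have mh3 : measurable_fun setT h3.
    by rewrite /h3; mfun.
  transitivity (\int[mu]_xi \int[mu]_x \int[mu]_y h3 (xi, (x, y)))%E.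
    apply: eq_integral => xi _; rewrite EFinM -fourier_sqE -ge0_integralZl//; first last.
    - by rewrite lee_fin expR_ge0.
    - by move=> x _; apply: integral_ge0 => y _; rewrite lee_fin !mulr_ge0//; have := cos_geN1 (b * dotv (x - y) xi); lra.
    - pose h (p : V * V) := (u p.1 * u p.2 * (1 + cos (b * dotv (p.1 - p.2) xi)))%:E.
      have mh : measurable_fun setT h by rewrite /h; mfun.
      apply: (measurable_ge0_integral1 mu mh) => p.
      by rewrite lee_fin !mulr_ge0//; have := cos_geN1 (b * dotv (p.1 - p.2) xi); lra.
    apply: eq_integral => x _; rewrite -ge0_integralZl//; first last.
    - by rewrite lee_fin expR_ge0.
    - by move=> y _; rewrite lee_fin !mulr_ge0//; have := cos_geN1 (b * dotv (x - y) xi); lra.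
    - by mfun.
  pose h2 (p : V * V) := (\int[mu]_y h3 (p.1, (p.2, y)))%E.
  have mh2 : measurable_fun setT h2.
    pose h (q : (V * V) * V) := h3 (q.1.1, (q.1.2, q.2)).
    have q11 : measurable_fun setT (fun q : (V * V) * V => q.1.1).
      exact: measurableT_comp measurable_fst measurable_fst.
    have q12 : measurable_fun setT (fun q : (V * V) * V => q.1.2).
      exact: measurableT_comp measurable_snd measurable_fst.
    have mh : measurable_fun setT h by rewrite /h; mfun.
    by apply: (measurable_ge0_integral1 mu mh) => p; exact: h30.
  have h20 p : (0 <= h2 p)%E by apply: integral_ge0 => y _; exact: h30.
  rewrite -[LHS]/(\int[mu]_xi \int[mu]_x h2 (xi, x))%E.
  have -> := @sfinite_Fubini _ _ V V R mu mu h2 h20 mh2.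
  transitivity (\int[mu]_x \int[mu]_y ((kap * (u x * u y))%:E + (kap * (u x * u y * g (x - y)))%:E))%E.
    apply: eq_integral => x _.
    pose h (p : V * V) := h3 (p.1, (x, p.2)).
    have mh : measurable_fun setT h by rewrite /h; mfun.
    have h0 p : (0 <= h p)%E by exact: h30.
    have -> := @sfinite_Fubini _ _ V V R mu mu h h0 mh.
    apply: eq_integral => y _; rewrite /h /h3 /=.
    transitivity ((u x * u y)%:E * \int[mu]_xi (e xi * (1 + cos (b * dotv (x - y) xi)))%:E)%E.
      rewrite -ge0_integralZl//; first last.
      - by rewrite lee_fin mulr_ge0.
      - by move=> xi _; rewrite lee_fin mulr_ge0 ?expR_ge0//; have := cos_geN1 (b * dotv (x - y) xi); lra.
      - by mfun.
      by apply: eq_integral => xi _; rewrite -EFinM; congr EFin; ring.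
    rewrite cos_kernel// -/kap -EFinM -EFinD; congr EFin.
    by rewrite -/(g (x - y)); ring.
  under eq_integral => x _.
    rewrite ge0_integralD//; first last.
    - by mfun.
    - by move=> y _; rewrite lee_fin !mulr_ge0 ?expR_ge0.
    - by mfun.
    - by move=> y _; rewrite lee_fin !mulr_ge0.
    over.
  pose ha (p : V * V) := (kap * (u p.1 * u p.2))%:E.
  pose hb (p : V * V) := (kap * (u p.1 * u p.2 * g (p.1 - p.2)))%:E.
  have mha : measurable_fun setT ha by rewrite /ha; mfun.
  have mhb : measurable_fun setT hb by rewrite /hb; mfun.
  have ha0 p : (0 <= ha p)%E by rewrite lee_fin !mulr_ge0.
  have hb0 p : (0 <= hb p)%E by rewrite lee_fin !mulr_ge0 ?expR_ge0.
  rewrite ge0_integralD//; first last.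
  - exact: (measurable_ge0_integral1 mu mhb).
  - by move=> x _; apply: integral_ge0 => y _; exact: (hb0 (x, y)).
  - exact: (measurable_ge0_integral1 mu mha).
  - by move=> x _; apply: integral_ge0 => y _; exact: (ha0 (x, y)).
  have mhc : measurable_fun setT (fun p : V * V => (u p.1 * u p.2)%:E) by mfun.
  have mhd : measurable_fun setT (fun p : V * V => (u p.1 * u p.2 * g (p.1 - p.2))%:E) by mfun.
  congr (_ + _)%E.
    rewrite EFinM -Iuu -ge0_integralZl//; first last.
    - by move=> x _; apply: integral_ge0 => y _; rewrite lee_fin mulr_ge0.
    - by apply: (measurable_ge0_integral1 mu mhc) => p; rewrite lee_fin mulr_ge0.
    apply: eq_integral => x _; rewrite -ge0_integralZl//; first last.
    - by move=> y _; rewrite lee_fin mulr_ge0.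
    - by mfun.
  rewrite -ge0_integralZl//; first last.
  - by move=> x _; apply: integral_ge0 => y _; rewrite lee_fin !mulr_ge0 ?expR_ge0.
  - by apply: (measurable_ge0_integral1 mu mhd) => p; rewrite lee_fin !mulr_ge0 ?expR_ge0.
  apply: eq_integral => x _; rewrite -ge0_integralZl//; first last.
  - by move=> y _; rewrite lee_fin !mulr_ge0 ?expR_ge0.
  - by mfun.
(* The total mass of the weight is [cos_kernel] at [h = 0], where [1 + cos] equals 2. *)
have E2 : (\int[mu]_xi (e xi * m ^+ 2)%:E = (kap * m ^+ 2)%:E)%E.
  transitivity ((m ^+ 2 / 2)%:E * \int[mu]_xi (e xi * (1 + cos (b * dotv 0 xi)))%:E)%E.
    rewrite -ge0_integralZl//; first last.
    - by rewrite lee_fin divr_ge0 ?sqr_ge0.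
    - by move=> xi _; rewrite dotv0l mulr0 cos0 lee_fin mulr_ge0 ?expR_ge0.
    - by mfun.
    by apply: eq_integral => xi _; rewrite dotv0l mulr0 cos0 -EFinM; congr EFin; field.
  rewrite cos_kernel// -/kap dotv0l mulr0 mul0r oppr0 expR0 -EFinM; congr EFin.
  by field.
have : (\int[mu]_xi (e xi * m ^+ 2)%:E + \int[mu]_xi (e xi * fourier_sq xi)%:E =
   (kap * m ^+ 2)%:E + kap%:E * W)%E.
  rewrite -E1 -ge0_integralD//; first last.
  - by mfun.
  - by move=> xi _; rewrite lee_fin mulr_ge0 ?expR_ge0 ?fourier_sq_ge0.
  - by mfun.
  - by move=> xi _; rewrite lee_fin mulr_ge0 ?expR_ge0 ?sqr_ge0.
  by apply: eq_integral => xi _; rewrite -EFinD -mulrDr.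
rewrite E2 -/W.
move: (\int[mu]_xi _)%E (kap%:E * W)%E => [r||] [r'||] //=.
by move=> [] /addrI ->.
Qed.

(** The substitution y = x + r z turns the double integral into a Gaussian mean of [L1corr]. Its
    Jacobian r^n compensates the s^-n of the frequency integral, so the coefficient of the variation
    does not depend on [tau]. *)
Lemma fourier_sq_gauss (tau : R) : 0 < tau ->
  (\int[mu]_xi (expR (- (tau ^+ 2 * (2 * sigma * b ^+ 2 * dotv xi xi))) * fourier_sq xi)%:E =
   ((2 * pi * (Num.sqrt 2 / (2 * Num.sqrt sigma * `|b|))) ^+ n *
    (m - fine (gauss_L1diff u (Num.sqrt 2 * tau)) / 2))%:E)%E.
Proof.
move=> tau0.
have sg0 : 0 < Num.sqrt sigma by rewrite sqrtr_gt0.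
have sg2 : Num.sqrt sigma ^+ 2 = sigma by rewrite sqr_sqrtr// ltW.
have nb0 : 0 < `|b| by rewrite normr_gt0.
have nb2 : `|b| ^+ 2 = b ^+ 2 by rewrite real_normK// num_real.
have s20 : 0 < Num.sqrt 2 :> R by rewrite sqrtr_gt0.
have s22 : Num.sqrt 2 ^+ 2 = 2 :> R by rewrite sqr_sqrtr.
(* Here s^2 / 2 = 2 sigma b^2 tau^2 matches the weight, and sigma b^2 r^2 / s^2 = 1/2, with [r] as
   below, matches the exponent of [gauss]. *)
pose s := 2 * tau * Num.sqrt sigma * `|b|.
have s0 : 0 < s by rewrite !mulr_gt0.
pose r := Num.sqrt 2 * tau.
have r0 : 0 < r by rewrite mulr_gt0.
pose q := Num.sqrt (2 * pi) : R.
have q0 : 0 < q := sqrt2pi_gt0.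
transitivity (\int[mu]_xi (expR (- (s ^+ 2 * dotv xi xi / 2)) * fourier_sq xi)%:E)%E.
  apply: eq_integral => xi _; congr (_ * _)%:E; congr (expR (- _)).
  by rewrite /s !exprMn sg2 nb2; field.
rewrite fourier_sq_gauss0//.
pose h (p : V * V) : \bar R := (u p.1 * u (p.1 + r *: p.2) * gauss p.2)%:E.
have mh : measurable_fun setT h by rewrite /h; mfun.
have h0 p : (0 <= h p)%E by rewrite lee_fin !mulr_ge0 ?gauss_ge0.
transitivity (((q / s) ^+ n)%:E * ((r * q) ^+ n)%:E * \int[mu]_x \int[mu]_z h (x, z))%E.
  rewrite -muleA; congr (_ * _)%E.
  rewrite -ge0_integralZl//; first last.
  - by rewrite lee_fin exprn_ge0// mulr_ge0// ltW.
  - by move=> x _; apply: integral_ge0 => z _; exact: (h0 (x, z)).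
  - exact: (measurable_ge0_integral1 mu mh).
  apply: eq_integral => x _.
  pose f (y : V) : \bar R := (u x * u y * expR (- (sigma * b ^+ 2 * dotv (x - y) (x - y) / s ^+ 2)))%:E.
  have mf : measurable_fun setT f by rewrite /f; mfun.
  have f0 y : (0 <= f y)%E by rewrite lee_fin !mulr_ge0 ?expR_ge0.
  rewrite -[LHS]/(\int[mu]_y f y)%E -(ge0_integral_affine x (lt0r_neq0 r0) mf f0).
  rewrite exprMn gtr0_norm// EFinM -muleA; congr (_ * _)%E.
  rewrite -ge0_integralZl//; first last.
  - by rewrite lee_fin exprn_ge0// ltW.
  - by mfun.
  apply: eq_integral => z _; rewrite /f /h /= -EFinM; congr EFin.
  rewrite (addrC (r *: z)) [RHS]mulrCA; congr (_ * _).
  rewrite /gauss -/q [RHS]mulrA divff ?expf_neq0 ?gt_eqF// mul1r enorm_sqr.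
  congr (expR (- _)); rewrite opprD addNKr dotvNl dotvNr opprK dotvZl dotvZr.
  rewrite /s /r !exprMn sg2 nb2.
  rewrite (_ : Num.sqrt 2 * tau * (Num.sqrt 2 * tau * dotv z z) = Num.sqrt 2 ^+ 2 * tau ^+ 2 * dotv z z); last by ring.
  by rewrite s22; field; rewrite b0 !gt_eqF.
have -> := @sfinite_Fubini _ _ V V R mu mu h h0 mh.
have -> : (\int[mu]_y \int[mu]_x h (x, y) =
    (m - fine (gauss_L1diff u (Num.sqrt 2 * tau)) / 2)%:E)%E.
  have mS : measurable_fun setT (L1corr A).
    pose h' (p : V * V) := (u p.2 * u (p.2 + p.1)%R)%:E.
    have mh' : measurable_fun setT h' by rewrite /h'; mfun.
    by apply: (measurable_ge0_integral1 mu mh') => p; rewrite lee_fin mulr_ge0.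
  transitivity (\int[mu]_z (L1corr A (r *: z)%R * (gauss z)%:E))%E.
    apply: eq_integral => z _; rewrite /h /L1corr /=.
    rewrite -ge0_integralZr//.
    - by rewrite -/u; mfun.
    - by rewrite lee_fin gauss_ge0.
  have := gauss_L1diff_corr mA Aoo r.
  rewrite -[X in (X + _)%E = _ -> _](fineK (gauss_L1diff_fin mA Aoo r)) -/u.
  move: (integral _ _ _) (fine (gauss_L1diff u r)) => [c||] d //.
  - by move=> [] ?; congr EFin; rewrite /m; lra.
  - by rewrite mulry gtr0_sg// mul1e.
  - by rewrite mulrNy gtr0_sg// mul1e.
rewrite -!EFinM; congr (_ * _)%:E; rewrite -exprMn; congr (_ ^+ _).
have -> : q / s * (r * q) = q ^+ 2 * (Num.sqrt 2 / (2 * Num.sqrt sigma * `|b|)).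
  by rewrite /s /r; field; rewrite !gt_eqF.
by rewrite sqr_sqrtr// mulr_ge0// pi_ge0.
Qed.

Let gauss_scaledE eps : 0 < eps -> mu.-integrable setT (EFin \o @gauss_scaled R n eps).
Proof.
move=> e0; have me : measurable_fun setT (@gauss_scaled R n eps) by rewrite /gauss_scaled; mfun.
apply: ge0_integrable => //.
  by move=> x; rewrite mulr_ge0 ?gauss_ge0// invr_ge0 exprn_ge0// ltW.
under eq_integral do rewrite EFinM.
rewrite ge0_integralZl//; first last.
- by rewrite lee_fin invr_ge0 exprn_ge0// ltW.
- by move=> x _; rewrite lee_fin gauss_ge0.
- by mfun.
rewrite (integral_scale (f := fun x => (gauss x)%:E)) ?invr_gt0//; last by mfun.
by rewrite integral_gauss mule1 -EFinM ltry.
Qed.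

Let trig_gauss_scaled (T : R -> R) eps xi : 0 < eps -> measurable_fun setT T ->
  (forall y, `|T y| <= 1) ->
  \int[mu]_x (T (b * dotv x xi) * gauss_scaled eps x) =
  \int[mu]_z (T (dotv z ((b * eps) *: xi)) * gauss z).
Proof.
move=> e0 mT T1.
pose f (x : V) := T (dotv x ((b * eps) *: xi)) * gauss x.
have mf : measurable_fun setT f by rewrite /f; mfun.
have fi : mu.-integrable setT (EFin \o f).
  apply: (@integrable_mul_bounded _ _ _ _ (fun x => T (dotv x ((b * eps) *: xi))) _ 1 _ _ (@integrable_gauss R n)) => //.
  by mfun.
pose g (x : V) := (eps ^- n * f x)%:E.
have mg' : measurable_fun setT g by rewrite /g; mfun.
rewrite /Rintegral; congr fine.
transitivity (\int[mu]_x g (eps^-1 *: x))%E.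
  apply: eq_integral => x _; rewrite /g /f /gauss_scaled dotvZl dotvZr.
  congr EFin; rewrite mulrCA; congr (_ * (T _ * _)).
  by field; rewrite gt_eqF.
rewrite integral_scale ?invr_gt0//.
under eq_integral do rewrite /g EFinM.
rewrite (integralZl measurableT fi) muleA -EFinM exprVn invrK divff ?mul1e//.
by rewrite expf_neq0// gt_eqF.
Qed.

Let integrable_trig_shift (T : R -> R) eps xi : 0 < eps -> measurable_fun setT T ->
  (forall y, `|T y| <= 1) ->
  mu.-integrable setT (fun x => (T (b * dotv x xi) * gauss_scaled eps x)%:E).
Proof.
move=> e0 mT T1.
apply: (@integrable_mul_bounded _ _ _ _ (fun x => T (b * dotv x xi)) _ 1 _ _ (gauss_scaledE e0)) => //.
by mfun.
Qed.

(** The convolution theorem in real form: [Rintegral_conv] moves the kernel onto the trigonometric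
    function and the addition formula splits it. The sine integral of the even kernel vanishes, so
    cosine and sine parts do not mix. *)
Let trig_conv eps xi : 0 < eps ->
  \int[mu]_x (cos (b * dotv x xi) * convolution (gauss_scaled eps) u x) =
    expR (- (eps ^+ 2 * (sigma * b ^+ 2 * dotv xi xi))) * Cu xi /\
  \int[mu]_x (sin (b * dotv x xi) * convolution (gauss_scaled eps) u x) =
    expR (- (eps ^+ 2 * (sigma * b ^+ 2 * dotv xi xi))) * Su xi.
Proof.
move=> e0; set E := expR _.
have mgs : measurable_fun setT (@gauss_scaled R n eps) by rewrite /gauss_scaled; mfun.
have mcos := @measurable_cosR R; have msin := @measurable_sinR R.
have ic := integrable_trig_shift xi e0 mcos (@cos_max R).
have isn := integrable_trig_shift xi e0 msin (@sin_max R).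
have IC : \int[mu]_x (cos (b * dotv x xi) * gauss_scaled eps x) = E.
  rewrite (trig_gauss_scaled _ e0 mcos (@cos_max R)) gauss_cosE; congr (expR (- _)).
  by rewrite dotvZl dotvZr; ring.
have IS : \int[mu]_x (sin (b * dotv x xi) * gauss_scaled eps x) = 0.
  by rewrite (trig_gauss_scaled _ e0 msin (@sin_max R)) gauss_sin.
have lin c d : \int[mu]_x (c * (cos (b * dotv x xi) * gauss_scaled eps x) +
    d * (sin (b * dotv x xi) * gauss_scaled eps x)) = c * E.
  rewrite RintegralD//; last 2 first.
  - exact: (integrableZl measurableT c ic).
  - exact: (integrableZl measurableT d isn).
  rewrite (RintegralZl _ measurableT ic) (RintegralZl _ measurableT isn) IC IS.
  by rewrite mulr0 addr0.
split.
- rewrite (Rintegral_conv (gauss_scaledE e0) ui (normr_indic_le1 A) (C := 1)); last 2 first.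
  + by mfun.
  + by move=> x; exact: cos_max.
  rewrite /Cu -(RintegralZl _ measurableT (integrable_cosu xi)).
  apply: eq_Rintegral => y _.
  rewrite [RHS]mulrA mulrC; congr (_ * _); rewrite mulrC -(lin _ (- sin (b * dotv y xi))).
  rewrite -(@Rintegral_shift _ _ _ y); last by mfun.
  apply: eq_Rintegral => x _; rewrite addrK dotvDl (mulrDr b) cosD; ring.
- rewrite (Rintegral_conv (gauss_scaledE e0) ui (normr_indic_le1 A) (C := 1)); last 2 first.
  + by mfun.
  + by move=> x; exact: sin_max.
  rewrite /Su -(RintegralZl _ measurableT (integrable_sinu xi)).
  apply: eq_Rintegral => y _.
  rewrite [RHS]mulrA mulrC; congr (_ * _); rewrite mulrC -(lin _ (cos (b * dotv y xi))).
  rewrite -(@Rintegral_shift _ _ _ y); last by mfun.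
  apply: eq_Rintegral => x _; rewrite addrK dotvDl (mulrDr b) sinD; ring.
Qed.

Lemma Hhalf_norm_sq_gauss a eps : 0 < eps ->
  Hhalf_norm_sq a b (convolution (gauss_scaled eps) u) =
  (\int[mu]_xi (a ^+ 2 * (enorm xi *
     (expR (- (eps ^+ 2 * (2 * sigma * b ^+ 2 * dotv xi xi))) * fourier_sq xi)))%:E)%E.
Proof.
move=> e0; apply: eq_integral => xi _; congr EFin.
rewrite [RHS]mulrCA; congr (_ * _).
have [Ec Es] := trig_conv xi e0.
rewrite /fourier /ComplexField.Normc.normc Ec Es.
rewrite sqr_sqrtr ?addr_ge0 ?sqr_ge0// sqrrN /fourier_sq.
have -> : expR (- (eps ^+ 2 * (2 * sigma * b ^+ 2 * dotv xi xi))) =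
   expR (- (eps ^+ 2 * (sigma * b ^+ 2 * dotv xi xi))) ^+ 2.
  by rewrite -expRM_natl; congr expR; ring.
by ring.
Qed.

End fourier_energy.

Lemma measurable_invR (R : realType) : measurable_fun [set: R] (fun x : R => x^-1).
Proof.
(* The power is taken of a nonnegative number; at 0 both sides vanish, by the convention on the
   inverse. *)
rewrite (_ : (fun x : R => x^-1) = (fun x => x * (x ^+ 2) `^ (-1))).
  apply: measurable_funM => //; apply: (@measurableT_comp _ _ _ _ _ _ (fun y : R => y `^ (-1))).
    exact: measurable_powR.
  by mfun.
apply/funext => x; rewrite powR_inv1 ?sqr_ge0//.
have [->|x0] := eqVneq x 0; first by rewrite invr0 mul0r.
by field.
Qed.

Lemma convexity_factor (R : realType) (r e p : R) : 0 < r -> 0 < e ->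
  2 * r ^+ 2 / e ^+ 2 * p * r^-1 ^+ 2 = p * (2 / e ^+ 2).
Proof. by move=> r0 e0; field; rewrite !gt_eqF. Qed.

(** * Subordination and logarithmic asymptotics *)

Section elementary_integrals.
Context {R : realType}.
Notation gR := (measurableTypeR R).
Notation mu := (@lebesgue_measure R).

Lemma continuous_within_inv (a : R) (A : set R) : 0 < a ->
  (forall x, A x -> a <= x) -> {within A, continuous (fun x : R => x^-1)}.
Proof.
move=> a0 Aa; apply: continuous_in_subspaceT => x; rewrite inE => /Aa ax.
by apply: inv_continuous; rewrite gt_eqF// (lt_le_trans a0).
Qed.

Lemma integral_inv (a b : R) : 0 < a -> a < b ->
  (\int[mu]_(r in `[a, b]) (r^-1)%:E = (ln b - ln a)%:E)%E.
Proof.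
move=> a0 ab; rewrite EFinB; apply: continuous_FTC2 => //.
- apply: (continuous_within_inv a0) => x /=; by rewrite in_itv/= => /andP[].
- split.
  + move=> x; rewrite in_itv/= => /andP[ax _].
    by have [] := is_derive1_ln (lt_trans a0 ax).
  + by apply: cvg_at_right_filter; exact: continuous_ln.
  + by apply: cvg_at_left_filter; apply: continuous_ln; exact: lt_trans ab.
- move=> x; rewrite in_itv/= => /andP[ax _].
  by rewrite derive1E; have [_ ->] := is_derive1_ln (lt_trans a0 ax).
Qed.

Lemma integral_invsqr (a : R) : 0 < a ->
  (\int[mu]_(r in `[a, +oo[) ((r^-1) ^+ 2)%:E = (a^-1)%:E)%E.
Proof.
move=> a0.
have dinv (x : R) : a <= x -> is_derive x 1 (fun y : R => - y^-1) ((x^-1) ^+ 2).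
  move=> ax; have x0 : x != 0 by rewrite gt_eqF// (lt_le_trans a0).
  have -> : (x^-1) ^+ 2 = - (- x ^- 2 *: 1) by rewrite scaleNr opprK [_ *: _]mulr1 exprVn.
  by apply: is_deriveN; apply: (@is_deriveV R id).
rewrite (@ge0_continuous_FTC2y _ _ (fun y => - y^-1) a 0).
- by rewrite -EFinB sub0r opprK.
- by move=> x _; rewrite sqr_ge0.
- apply: continuous_in_subspaceT => x; rewrite inE/= in_itv/= andbT => ax.
  have x0 : x != 0 by rewrite gt_eqF// (lt_le_trans a0).
  by apply: (@continuous_comp _ _ _ (fun y : R => y^-1) (fun y => y ^+ 2)); [exact: inv_continuous|exact: exprn_continuous].
- rewrite -oppr0; apply: cvgN; apply/cvgrPdist_le => e e0.
  near=> x; rewrite sub0r normrN ger0_norm; last first.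
    by rewrite invr_ge0; near: x; exact: nbhs_pinfty_ge.
  have x0 : 0 < x by near: x; exact: nbhs_pinfty_gt.
  rewrite -[e]invrK lef_pV2 ?posrE ?invr_gt0//.
- by move=> x ax; have [] := dinv x (ltW ax).
- apply: cvg_at_right_filter; apply: cvgN; apply: inv_continuous.
  by rewrite gt_eqF.
- move=> x; rewrite in_itv/= andbT => ax.
  by rewrite derive1E; have [_ ->] := dinv x (ltW ax).
Unshelve. all: by end_near. Qed.

(** The weight dr / r^2 of the positive half-line, extended by 0 so that integrals and affine
    substitutions concern the whole line. *)
Definition invsqr_weight (r : R) : R := \1_`]0, +oo[%classic r * (r^-1) ^+ 2.

Lemma invsqr_weight_ge0 r : 0 <= invsqr_weight r.
Proof. by rewrite mulr_ge0 ?sqr_ge0// indicE. Qed.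

Lemma measurable_invsqr_weight : measurable_fun [set: gR] invsqr_weight.
Proof.
have mi : measurable_fun [set: gR] (\1_`]0%R, +oo[%classic : gR -> R) by exact: measurable_indic.
have mv : measurable_fun [set: gR] (fun x : gR => (x : R)^-1) by exact: measurable_invR.
by rewrite /invsqr_weight; mfun.
Qed.

Lemma invsqr_weight_gt0E r : 0 < r -> invsqr_weight r = (r^-1) ^+ 2.
Proof. by move=> r0; rewrite /invsqr_weight indicE mem_set ?mul1r//= in_itv/= r0. Qed.

Lemma invsqr_weight_le0E r : r <= 0 -> invsqr_weight r = 0.
Proof.
by move=> r0; rewrite /invsqr_weight indicE memNset ?mul0r//= in_itv/= ltNge r0.
Qed.

Lemma subr1_expR_le (x : R) : 1 - expR (- x) <= x.
Proof. by have := expR_ge1Dx (- x); lra. Qed.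

(** The constant k of the overview. Its value is the square root of pi, but only [0 < k < +oo] is
    established and used. *)
Definition subordination_const : \bar R :=
  (\int[mu]_r ((1 - expR (- r ^+ 2)) * invsqr_weight r)%:E)%E.

Let integrand_ge0 r : 0 <= (1 - expR (- r ^+ 2)) * invsqr_weight r.
Proof. by rewrite mulr_ge0 ?invsqr_weight_ge0// subr_ge0 -expR0 ler_expR oppr_le0 sqr_ge0. Qed.

Lemma integral_indic_mul d (T : measurableType d) (nu : {measure set T -> \bar R})
    (B : set T) (f : T -> R) :
  (\int[nu]_(x in B) (f x)%:E = \int[nu]_x (f x * \1_B x)%:E)%E.
Proof.
rewrite integral_mkcond; apply: eq_integral => x _; rewrite patchE indicE.
by case: ifPn => _; rewrite ?mulr1 ?mulr0.
Qed.

(** The closed pieces share the point [d], which is harmless for an upper bound and allows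
    [e = d]. *)
Lemma integral_le_split (f : gR -> R) (e d : R) (a c : \bar R) (b : \bar R) :
  0 < e -> e <= d -> measurable_fun [set: gR] f -> (forall r, 0 <= f r) ->
  (forall r, r <= 0 -> f r = 0) ->
  (\int[mu]_(r in `]0%R, e[) (f r)%:E <= a)%E ->
  (\int[mu]_(r in `[e, d]) (f r)%:E <= b)%E ->
  (\int[mu]_(r in `[d, +oo[) (f r)%:E <= c)%E ->
  (\int[mu]_r (f r)%:E <= a + b + c)%E.
Proof.
move=> e0 ed mf f0 fle0 fa fb fc.
have mfE : measurable_fun [set: gR] (fun r : gR => (f r)%:E) by mfun.
apply: (@le_trans _ _ (\int[mu]_(r in `]0%R, e[) (f r)%:E +
    \int[mu]_(r in `[e, d]) (f r)%:E + \int[mu]_(r in `[d, +oo[) (f r)%:E)%E); last first.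
  by apply: leeD => //; exact: leeD.
have EI (B : set gR) : (\int[mu]_(r in B) (f r)%:E = \int[mu]_r (f r * \1_B r)%:E)%E.
  exact: integral_indic_mul.
rewrite (EI `]0%R, e[%classic) (EI `[e, d]%classic) (EI `[d, +oo[%classic).
have mi (B : set gR) : measurable B -> measurable_fun [set: gR] (\1_B : gR -> R).
  by move=> mB; exact: measurable_indic.
have m1 := mi `]0%R, e[%classic (measurable_itv _).
have m2 := mi `[e, d]%classic (measurable_itv _).
have m3 := mi `[d, +oo[%classic (measurable_itv _).
have g0 (B : set gR) r : 0 <= f r * \1_B r by rewrite mulr_ge0// indicE.
have g0E (B : set gR) r : setT r -> (0 <= (f r * \1_B r)%:E)%E by rewrite lee_fin g0.
have mg (B : set gR) : measurable B -> measurable_fun [set: gR] (fun r : gR => (f r * \1_B r)%:E).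
  by move=> mB; have mBi := mi B mB; mfun.
rewrite -ge0_integralD; first last.
- by apply: mg; exact: measurable_itv.
- exact: g0E.
- by apply: mg; exact: measurable_itv.
- exact: g0E.
- exact: measurableT.
rewrite -ge0_integralD; first last.
- by apply: mg; exact: measurable_itv.
- exact: g0E.
- by apply: emeasurable_funD; by apply: mg; exact: measurable_itv.
- by move=> r _; rewrite -EFinD lee_fin addr_ge0.
- exact: measurableT.
apply: ge0_le_integralW => r _; first by rewrite lee_fin.
rewrite -!EFinD lee_fin !indicE.
have [r0|r0] := leP r 0; first by rewrite fle0// !mul0r !addr0.
have [re|re] := ltP r e.
  rewrite (@mem_set _ `]0%R, e[%classic r) ?mulr1 -?addrA ?lerDl ?addr_ge0 ?mulr_ge0//.
  by rewrite /= in_itv/= r0 re.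
have [rd|rd] := leP r d.
  rewrite (@mem_set _ `[e, d]%classic r) ?mulr1 1?addrAC ?lerDr ?addr_ge0 ?mulr_ge0//.
  by rewrite /= in_itv/= re rd.
rewrite (@mem_set _ `[d, +oo[%classic r) ?mulr1 ?lerDr ?addr_ge0 ?mulr_ge0//.
by rewrite /= in_itv/= ltW.
Qed.

Lemma integral_invsqr_weight_itv (a b : R) : 0 < a ->
  (\int[mu]_(r in `[a, b]) (invsqr_weight r)%:E <= (a^-1)%:E)%E.
Proof.
move=> a0; rewrite -integral_invsqr//.
apply: (@le_trans _ _ (\int[mu]_(r in `[a, +oo[) (invsqr_weight r)%:E)%E).
  apply: ge0_subset_integral => //.
  - by have mw := measurable_invsqr_weight; apply: measurable_funTS; mfun.
  - by move=> r _; rewrite lee_fin invsqr_weight_ge0.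
  - by move=> r /=; rewrite !in_itv/= => /andP[->].
apply: ge0_le_integralW => r /=; rewrite in_itv/= andbT => ar; rewrite lee_fin.
  exact: invsqr_weight_ge0.
by rewrite invsqr_weight_gt0E// (lt_le_trans a0).
Qed.

Lemma integral_invsqr_weighty (a : R) : 0 < a ->
  (\int[mu]_(r in `[a, +oo[) (invsqr_weight r)%:E = (a^-1)%:E)%E.
Proof.
move=> a0; rewrite -integral_invsqr//; apply: eq_integral => r.
rewrite inE/= in_itv/= andbT => ar.
by rewrite invsqr_weight_gt0E// (lt_le_trans a0).
Qed.

Lemma subordination_const_lty : (subordination_const < +oo)%E.
Proof.
have mw := measurable_invsqr_weight.
apply: (@le_lt_trans _ _ (1%:E + 1%:E + 1%:E)%E); last by rewrite -!EFinD ltry.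
(* Below 1 the integrand is at most 1, since 1 - exp (- x) <= x; the middle piece is a single point;
   beyond 1 the integrand is at most r^-2. *)
apply: (integral_le_split ltr01 (lexx 1)).
- by mfun.
- exact: integrand_ge0.
- by move=> r r0; rewrite invsqr_weight_le0E// mulr0.
- apply: (@le_trans _ _ (\int[mu]_(r in `]0%R, 1%R[) (1%R)%:E)%E).
    apply: ge0_le_integralW => r /=; rewrite in_itv/= => /andP[r0 r1]; rewrite lee_fin.
      exact: integrand_ge0.
    rewrite invsqr_weight_gt0E// (le_trans (ler_wpM2r _ (subr1_expR_le _))) ?sqr_ge0//.
    by rewrite exprVn divff// expf_neq0// gt_eqF.
  by rewrite integral_cst//= lebesgue_measure_itv/= lte_fin ltr01 oppr0 adde0 mule1.
- rewrite set_itv1 integral_set1 ?lee_fin//.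
- have E1 := integral_invsqr_weighty (@ltr01 R).
  rewrite invr1 in E1; rewrite -[leRHS]E1.
  apply: ge0_le_integralW => r _; rewrite lee_fin; first exact: integrand_ge0.
  by rewrite ler_piMl ?invsqr_weight_ge0// lerBlDr lerDl expR_ge0.
Qed.

Lemma subordination_const_gt0 : (0 < subordination_const)%E.
Proof.
have mw := measurable_invsqr_weight.
have c0 : 0 < (1 - expR (- 1)) * (2^-1) ^+ 2 :> R.
  by rewrite mulr_gt0 ?exprn_gt0 ?invr_gt0// subr_gt0 expR_lt1 oppr_lt0.
apply: (@lt_le_trans _ _ (\int[mu]_(r in `[1%R, 2%R]) ((1 - expR (- 1)) * (2^-1) ^+ 2)%:E)%E).
  rewrite integral_cst//= lebesgue_measure_itv/= lte_fin ltr1n -EFinB -EFinM lte_fin.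
  by apply: mulr_gt0 => //; lra.
apply: (@le_trans _ _ (\int[mu]_(r in `[1%R, 2%R]) ((1 - expR (- r ^+ 2)) * invsqr_weight r)%:E)%E).
  apply: ge0_le_integralW => r /=; rewrite in_itv/= => /andP[r1 r2]; rewrite lee_fin.
    exact: ltW.
  have r0 : 0 < r := lt_le_trans ltr01 r1.
  rewrite invsqr_weight_gt0E// ler_pM ?sqr_ge0//.
  - by rewrite lerB// ler_expR lerN2; nra.
  - by rewrite ler_sqr ?nnegrE ?invr_ge0 ?(ltW r0)// lef_pV2 ?posrE.
apply: ge0_subset_integral => //.
- by mfun.
- by move=> r _; rewrite lee_fin integrand_ge0.
Qed.

(** Substituting [sqrt lam * r] for r in the constant: dr / r^2 is homogeneous of degree -1, which
    leaves one factor [sqrt lam]. *)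
Lemma subordination_sqrt (lam : R) : 0 <= lam ->
  (\int[mu]_r ((1 - expR (- (r ^+ 2 * lam))) * invsqr_weight r)%:E =
   (Num.sqrt lam)%:E * subordination_const)%E.
Proof.
rewrite le_eqVlt => /predU1P[<-|l0].
  rewrite sqrtr0 mul0e integral0_eq// => r _.
  by rewrite mulr0 oppr0 expR0 subrr mul0r.
have s0 : 0 < Num.sqrt lam by rewrite sqrtr_gt0.
have s2 : Num.sqrt lam ^+ 2 = lam by rewrite sqr_sqrtr// ltW.
have mw := measurable_invsqr_weight.
pose f (r : gR) : \bar R := ((1 - expR (- r ^+ 2)) * invsqr_weight r)%:E.
have mf : measurable_fun setT f by rewrite /f; mfun.
have f0 r : (0 <= f r)%E by rewrite lee_fin integrand_ge0.
rewrite /subordination_const -[X in (_ * X)%E]/(\int[mu]_r f r)%E.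
rewrite -(ge0_integral_affine1 0 (lt0r_neq0 s0) mf f0) muleA -EFinM gtr0_norm// -expr2 s2.
rewrite -ge0_integralZl//; first last.
- by rewrite lee_fin ltW.
- by apply: measurableT_comp mf _; mfun.
apply: eq_integral => r _; rewrite /f -EFinM; congr EFin.
rewrite addr0 exprMn s2 (mulrC lam (r ^+ 2)) [RHS]mulrCA; congr (_ * _).
have [r0|r0] := leP r 0.
  rewrite !invsqr_weight_le0E ?mulr0// pmulr_rle0//.
rewrite (invsqr_weight_gt0E r0) invsqr_weight_gt0E ?mulr_gt0// invfM exprMn [in RHS]exprVn s2 mulrA divff ?mul1r//.
by rewrite gt_eqF.
Qed.

End elementary_integrals.

Section log_asymptotics.
Context {R : realType}.
Notation gR := (measurableTypeR R).
Notation mu := (@lebesgue_measure R).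
Variables (Phi : R -> R) (L M : R).
Hypothesis mPhi : measurable_fun [set: gR] Phi.
Hypothesis Phi_mono : forall s t, 0 < s -> s <= t -> Phi s <= Phi t.
Hypothesis Phi_ge0 : forall t, 0 < t -> 0 <= Phi t.
Hypothesis Phi_leM : forall t, 0 < t -> Phi t <= M.
Hypothesis Phi_leL : forall t, 0 < t -> Phi t <= L * t.
Hypothesis Phi_geL : forall eta, 0 < eta -> exists2 t0, 0 < t0 &
  forall t, 0 < t -> t < t0 -> (L - eta) * t <= Phi t.
Hypothesis Phi_cvx : forall eps r, 0 < eps -> 0 < r ->
  Phi (Num.sqrt (eps ^+ 2 + r ^+ 2)) - Phi eps <= 2 * r ^+ 2 / eps ^+ 2 * Phi eps.

Let f eps r := (Phi (Num.sqrt (eps ^+ 2 + r ^+ 2)) - Phi eps) * invsqr_weight r.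

Definition log_energy (eps : R) : \bar R := (\int[mu]_r (f eps r)%:E)%E.

Let mf eps : measurable_fun [set: gR] (f eps).
Proof. by have mw := @measurable_invsqr_weight R; rewrite /f; mfun. Qed.

Let le_sqrt (eps r : R) : 0 < eps -> eps <= Num.sqrt (eps ^+ 2 + r ^+ 2).
Proof.
move=> e0; rewrite -{1}(ger0_norm (ltW e0)) -sqrtr_sqr ler_wsqrtr//.
by rewrite lerDl sqr_ge0.
Qed.

Let ge_sqrt (eps r : R) : 0 < r -> r <= Num.sqrt (eps ^+ 2 + r ^+ 2).
Proof. by move=> r0; rewrite addrC le_sqrt. Qed.

Let f_ge0 eps r : 0 < eps -> 0 <= f eps r.
Proof.
move=> e0; rewrite mulr_ge0 ?invsqr_weight_ge0// subr_ge0 Phi_mono//.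
exact: le_sqrt.
Qed.

Let L_ge0 : 0 <= L.
Proof. by have := le_trans (Phi_ge0 ltr01) (Phi_leL ltr01); rewrite mulr1. Qed.

Let M_ge0 : 0 <= M.
Proof. exact: le_trans (Phi_ge0 ltr01) (Phi_leM ltr01). Qed.

Lemma log_energy_le eps : 0 < eps -> eps < 1 ->
  (log_energy eps <= (2 * L + (L * - ln eps + L) + M)%:E)%E.
Proof.
move=> e0 e1; rewrite !EFinD.
have mw := @measurable_invsqr_weight R.
apply: (integral_le_split e0 (ltW e1)) => //.
- by move=> r; exact: f_ge0.
- by move=> r r0; rewrite /f invsqr_weight_le0E// mulr0.
(* The r^2 in [Phi_cvx] cancels the weight, and [Phi eps <= L * eps] leaves a constant of order 1 /
   eps on an interval of length eps. *)
- apply: (@le_trans _ _ (\int[mu]_(r in `]0%R, eps[) (2 * L / eps)%:E)%E).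
    apply: ge0_le_integralW => r /=; rewrite in_itv/= => /andP[r0 r1]; rewrite lee_fin.
      exact: f_ge0.
    rewrite /f invsqr_weight_gt0E// (le_trans (ler_wpM2r _ (Phi_cvx e0 r0))) ?sqr_ge0//.
    rewrite convexity_factor//.
    rewrite (le_trans (ler_wpM2r _ (Phi_leL e0)))//.
      by rewrite divr_ge0// sqr_ge0.
    by rewrite le_eqVlt; apply/orP; left; apply/eqP; field; rewrite gt_eqF.
  rewrite integral_cst//= lebesgue_measure_itv/= lte_fin e0 oppr0 adde0 -EFinM lee_fin.
  by rewrite divfK// gt_eqF.
(* By sqrt (eps^2 + r^2) <= r + eps, the increment is at most L (r + eps): the term L r yields the
   logarithm, and L eps against dr / r^2 on r >= eps yields at most L. *)
- rewrite -EFinD.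
  apply: (@le_trans _ _ (\int[mu]_(r in `[eps, 1%R]) ((L * r^-1)%:E + (L * eps)%:E * (invsqr_weight r)%:E))%E).
    apply: ge0_le_integralW => r /=; rewrite in_itv/= => /andP[r0 r1].
      by rewrite lee_fin f_ge0.
    have rr : 0 < r := lt_le_trans e0 r0.
    rewrite -EFinM -EFinD lee_fin /f invsqr_weight_gt0E//.
    apply: (@le_trans _ _ (L * (r + eps) * r^-1 ^+ 2)); last first.
      by rewrite le_eqVlt; apply/orP; left; apply/eqP; field; rewrite gt_eqF.
    rewrite ler_wpM2r ?sqr_ge0// lerBlDr (le_trans (Phi_leL _))//.
      exact: lt_le_trans (le_sqrt _ e0).
    rewrite ler_wpDr ?Phi_ge0// ler_wpM2l//.
    rewrite -[leRHS](ger0_norm (addr_ge0 (ltW rr) (ltW e0))) -sqrtr_sqr ler_wsqrtr//.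
    by have := mulr_gt0 rr e0; rewrite sqrrD; lra.
  have mv : measurable_fun [set: gR] (fun x : gR => (x : R)^-1) by exact: measurable_invR.
  have i0 r : r \in `[eps, 1]%R -> (0 <= (r^-1)%:E)%E.
    by rewrite in_itv/= lee_fin invr_ge0 => /andP[+ _]; exact: le_trans (ltW e0).
  rewrite ge0_integralD//; first last.
  - by apply: measurable_funTS; mfun.
  - by move=> r _; rewrite mule_ge0 ?lee_fin ?invsqr_weight_ge0// mulr_ge0// ltW.
  - by apply: measurable_funTS; mfun.
  - by move=> r ri; rewrite EFinM mule_ge0// i0.
  rewrite EFinD; apply: leeD.
    under eq_integral do rewrite EFinM.
    rewrite ge0_integralZl//; first last.
    - by apply: measurable_funTS; mfun.
    by rewrite integral_inv// ln1 sub0r -EFinM.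
  rewrite ge0_integralZl//; first last.
  - by rewrite lee_fin mulr_ge0// ltW.
  - by move=> r _; rewrite lee_fin invsqr_weight_ge0.
  - by apply: measurable_funTS; mfun.
  apply: le_trans (lee_wpmul2l _ (integral_invsqr_weight_itv 1 e0)) _.
    by rewrite lee_fin mulr_ge0// ltW.
  by rewrite -EFinM lee_fin mulfK// gt_eqF.
- have E1 := integral_invsqr_weighty (@ltr01 R).
  rewrite invr1 in E1; rewrite -[M]mulr1 EFinM -[X in (_ <= _ * X)%E]E1.
  rewrite -ge0_integralZl//; first last.
  - by move=> r _; rewrite lee_fin invsqr_weight_ge0.
  - by apply: measurable_funTS; mfun.
  apply: ge0_le_integralW => r _; rewrite -?EFinM lee_fin.
    exact: f_ge0.
  rewrite /f ler_wpM2r ?invsqr_weight_ge0// lerBlDr ler_wpDr ?Phi_ge0//.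
  by rewrite Phi_leM// (lt_le_trans e0)// le_sqrt.
Qed.

(** Only the range from [eps] to [t0] is kept. By monotonicity the first term is at least [Phi r],
    hence at least (L - eta) r, and the subtracted [Phi eps <= L * eps] costs at most [L] in
    total. *)
Lemma log_energy_ge eta : 0 < eta -> exists2 t0, 0 < t0 & forall eps, 0 < eps -> eps < t0 ->
  (((L - eta) * (ln t0 - ln eps) - L)%:E <= log_energy eps)%E.
Proof.
move=> eta0; have [t1 t10 Ht] := Phi_geL eta0.
(* Halving keeps the closed interval ending at [t0] strictly below [t1]. *)
pose t0 := t1 / 2; have t00 : 0 < t0 by rewrite divr_gt0.
exists t0 => // eps e0 et.
have lnt : 0 <= ln t0 - ln eps by rewrite subr_ge0 ler_ln ?posrE// ltW.
have [le|le] := leP (L - eta) 0.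
  apply: (@le_trans _ _ 0%E); last by apply: integral_ge0 => r _; rewrite lee_fin f_ge0.
  rewrite lee_fin; have := mulr_ge0_le0 lnt le; rewrite mulrC; have := L_ge0; lra.
have mw := @measurable_invsqr_weight R.
have mv : measurable_fun [set: gR] (fun x : gR => (x : R)^-1) by exact: measurable_invR.
rewrite EFinB leeBlDr//.
apply: (@le_trans _ _ (\int[mu]_(r in `[eps, t0]) (f eps r)%:E +
    \int[mu]_(r in `[eps, t0]) ((L * eps)%:E * (invsqr_weight r)%:E))%E); last first.
  apply: leeD.
    apply: ge0_subset_integral => //; first by have mfe := mf eps; mfun.
    by move=> r _; rewrite lee_fin f_ge0.
  rewrite ge0_integralZl//; first last.
  - by rewrite lee_fin mulr_ge0// ltW.
  - by move=> r _; rewrite lee_fin invsqr_weight_ge0.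
  - by apply: measurable_funTS; mfun.
  apply: le_trans (lee_wpmul2l _ (integral_invsqr_weight_itv t0 e0)) _.
    by rewrite lee_fin mulr_ge0// ltW.
  by rewrite -EFinM lee_fin mulfK// gt_eqF.
rewrite -ge0_integralD//; first last.
- by apply: measurable_funTS; mfun.
- by move=> r _; rewrite mule_ge0 ?lee_fin ?invsqr_weight_ge0// mulr_ge0// ltW.
- by apply: measurable_funTS; have mfe := mf eps; mfun.
- by move=> r _; rewrite lee_fin f_ge0.
rewrite EFinM -integral_inv// -ge0_integralZl//; first last.
- by rewrite lee_fin ltW.
- move=> r /=; rewrite in_itv/= lee_fin invr_ge0 => /andP[+ _]; exact: le_trans (ltW e0).
- by apply: measurable_funTS; mfun.
apply: ge0_le_integralW => r /=; rewrite in_itv/= => /andP[r0 r1].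
  rewrite -EFinM lee_fin mulr_ge0 ?invr_ge0 ?(ltW le)//; exact: le_trans (ltW e0) r0.
have rr : 0 < r := lt_le_trans e0 r0.
rewrite -!EFinM -EFinD lee_fin /f invsqr_weight_gt0E// -mulrDl.
apply: (@le_trans _ _ ((L - eta) * r * r^-1 ^+ 2)).
  by rewrite le_eqVlt; apply/orP; left; apply/eqP; field; rewrite gt_eqF.
rewrite ler_wpM2r ?sqr_ge0//.
apply: (@le_trans _ _ (Phi r)).
  by apply: Ht => //; apply: (le_lt_trans r1); rewrite /t0; lra.
have := Phi_mono rr (ge_sqrt eps rr); have := Phi_leL e0; lra.
Qed.

Lemma cvg_log_energy :
  (`|ln eps|^-1%:E * log_energy eps)%E @[eps --> 0^'+] --> L%:E.
Proof.
have e_fin eps : 0 < eps -> eps < 1 -> log_energy eps \is a fin_num.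
  move=> e0 e1; rewrite ge0_fin_numE.
    exact: le_lt_trans (log_energy_le e0 e1) (ltry _).
  by apply: integral_ge0 => r _; rewrite lee_fin f_ge0.
apply/fine_cvgP; split.
  near=> eps; rewrite fin_numM// e_fin//.
apply/cvgrPdist_le => d d0 /=.
pose eta := d / 2; have eta0 : 0 < eta by rewrite divr_gt0.
have [t0 t00 Ht] := log_energy_ge eta0.
have lnoo B : \forall eps \near (0:R)^'+, B <= - ln eps.
  near=> eps.
  have e0 : 0 < eps by near: eps; exact: nbhs_right_gt.
  rewrite lerNr -[leRHS]expRK ler_ln ?posrE ?expR_gt0//.
  by near: eps; apply: nbhs_right_le; exact: expR_gt0.
near=> eps.
have e0 : 0 < eps by near: eps; exact: nbhs_right_gt.
have e1 : eps < 1 by near: eps; apply: nbhs_right_lt.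
have et : eps < t0 by near: eps; apply: nbhs_right_lt.
pose l := - ln eps.
have l0 : 0 < l by rewrite oppr_gt0 ln_lt0// e0 e1.
(* Beyond the thresholds [l1] and [l2] the bounded terms are at most [d * l] in the upper estimate
   and [(d - eta) * l] in the lower one, where [eta * l] is already spent. *)
have l1 : (3 * L + M) / d <= - ln eps by near: eps; exact: lnoo.
have l2 : ((L - eta) * - ln t0 + L) / (d - eta) <= - ln eps by near: eps; exact: lnoo.
have ln0 : ln eps < 0 by rewrite -oppr_gt0.
rewrite (ltr0_norm ln0).
rewrite -/l fineM ?e_fin//=.
have up := log_energy_le e0 e1; have lo := Ht eps e0 et.
rewrite -(fineK (e_fin eps e0 e1)) !lee_fin -/l in up lo.
set N := fine _ in up lo *.
rewrite -/l in l1 l2.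
rewrite ler_pdivrMr// in l1.
rewrite ler_pdivrMr in l2; last by rewrite /eta; lra.
rewrite (_ : L - _ = l^-1 * (L * l - N)); last by field; rewrite gt_eqF.
rewrite normrM gtr0_norm ?invr_gt0// ler_pdivrMl// ler_norml; apply/andP; split; nra.
Unshelve. all: by end_near. Qed.

End log_asymptotics.

Lemma adde_EFin_eq (R : numDomainType) (X : \bar R) (p q : R) :
  (X + q%:E = p%:E)%E -> X = (p - q)%:E.
Proof. by case: X => // x [<-]; rewrite addrK. Qed.

(** * The energy as an integral of increments of the Gaussian variation *)

Section energy_representation.
Context {R : realType} {n : nat} (sigma b : R).
Notation V := 'rV[R]_n.
Notation gR := (measurableTypeR R).
Notation mu := (@lebesgue_rV R n).
Notation mu1 := (@lebesgue_measure R).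
Hypothesis sigma0 : 0 < sigma.
Hypothesis b0 : b != 0.
Hypothesis gauss_cosE : forall w : V,
  \int[mu]_z (cos (dotv z w) * gauss z) = expR (- (sigma * dotv w w)).
Variables (A : set V).
Hypotheses (mA : measurable A) (Afin : (mu A < +oo)%E).

Let I : V -> R := fourier_sq b A.
Let I0 xi : 0 <= I xi. Proof. exact: fourier_sq_ge0. Qed.
Let mI : measurable_fun setT I. Proof. exact: measurable_fourier_sq. Qed.
Let lam (xi : V) : R := 2 * sigma * b ^+ 2 * dotv xi xi.
Let lam0 xi : 0 <= lam xi.
Proof. by rewrite mulr_ge0 ?dotv_ge0// mulr_ge0 ?sqr_ge0// mulr_ge0// ltW. Qed.
Let mlam : measurable_fun setT lam. Proof. by rewrite /lam; mfun. Qed.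

(** The function Phi of the overview. Squaring the Fourier transform of [gauss_scaled t] doubles its
    variance, whence the factor [sqrt 2]. *)
Definition indic_variation (t : R) : R :=
  fine (gauss_L1diff (\1_A : V -> R) (Num.sqrt 2 * t)).

Definition variation_const : R :=
  (2 * pi * (Num.sqrt 2 / (2 * Num.sqrt sigma * `|b|))) ^+ n.

Let K := variation_const.
Let Phi := indic_variation.

Lemma variation_const_gt0 : 0 < K.
Proof.
rewrite /K /variation_const exprn_gt0// mulr_gt0//; first by rewrite mulr_gt0// pi_gt0.
apply: divr_gt0; first by rewrite sqrtr_gt0.
by rewrite mulr_gt0 ?normr_gt0// mulr_gt0// sqrtr_gt0.
Qed.

Lemma indic_variation_ge0 t : 0 <= Phi t.
Proof. by rewrite fine_ge0// gauss_L1diff_ge0. Qed.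

Lemma indic_variation_le t : Phi t <= 2 * fine (mu A).
Proof.
rewrite -lee_fin fineK; first exact: gauss_L1diff_le.
exact: gauss_L1diff_fin.
Qed.

Lemma measurable_indic_variation : measurable_fun [set: gR] Phi.
Proof.
have mu' : measurable_fun setT (\1_A : V -> R) by exact: measurable_indicR.
have mD := measurable_L1diff mu'.
have mg := @measurable_gauss R n.
pose g (p : gR * V) := (L1diff (\1_A : V -> R) ((Num.sqrt 2 * p.1) *: p.2) * (gauss p.2)%:E)%E.
have mgg : measurable_fun setT g by rewrite /g; mfun.
have g0 p : (0 <= g p)%E by rewrite mule_ge0 ?L1diff_ge0// lee_fin gauss_ge0.
have mG := @measurable_ge0_integral1 _ _ gR V R mu g mgg g0.
apply: (@measurableT_comp _ _ _ _ _ _ (@fine R)) => //.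
Qed.

Let e (s : R) xi := expR (- (s ^+ 2 * lam xi)).
Let e0 s xi : 0 <= e s xi. Proof. exact: expR_ge0. Qed.
Let me s : measurable_fun setT (e s). Proof. by rewrite /e; mfun. Qed.

Let G (s : R) : 0 < s -> (\int[mu]_xi (e s xi * I xi)%:E = (K * (fine (mu A) - Phi s / 2))%:E)%E.
Proof. by move=> s0; rewrite /e /lam /I (fourier_sq_gauss sigma0 b0 gauss_cosE mA Afin s0). Qed.

Let e_decr s t xi : 0 < s -> s <= t -> e t xi <= e s xi.
Proof.
move=> s0 st; rewrite ler_expR lerN2 ler_wpM2r//.
by rewrite ler_sqr ?nnegrE ?(ltW s0)// (le_trans (ltW s0)).
Qed.

(** Through this identity, pointwise inequalities between exponentials become inequalities for
    [Phi]: monotonicity, the quadratic bound, and the representation of the energy. *)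
Let diffE s t : 0 < s -> s <= t ->
  (\int[mu]_xi ((e s xi - e t xi) * I xi)%:E = (K / 2 * (Phi t - Phi s))%:E)%E.
Proof.
move=> s0 st; have t0 := lt_le_trans s0 st.
have mes := me s; have met := me t; have mI' := mI.
have : (\int[mu]_xi ((e s xi - e t xi) * I xi)%:E + \int[mu]_xi (e t xi * I xi)%:E =
        \int[mu]_xi (e s xi * I xi)%:E)%E.
  rewrite -ge0_integralD//; first last.
  - by mfun.
  - by move=> x _; rewrite lee_fin mulr_ge0.
  - by mfun.
  - by move=> x _; rewrite lee_fin mulr_ge0// subr_ge0 e_decr.
  by apply: eq_integral => x _; rewrite -EFinD -mulrDl subrK.
rewrite !G// => /adde_EFin_eq ->; congr EFin.
have aux (k m x y : R) : k * (m - x / 2) - k * (m - y / 2) = k / 2 * (y - x) by field.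
exact: aux.
Qed.

Lemma indic_variation_mono s t : 0 < s -> s <= t -> Phi s <= Phi t.
Proof.
move=> s0 st.
have : (0 <= \int[mu]_xi ((e s xi - e t xi) * I xi)%:E)%E.
  by apply: integral_ge0 => x _; rewrite lee_fin mulr_ge0// subr_ge0 e_decr.
have K2 : 0 < K / 2 by rewrite divr_gt0// variation_const_gt0.
by rewrite (diffE s0 st) lee_fin (pmulr_rge0 _ K2) subr_ge0.
Qed.

(** As a function of s, exp (- s lam) is convex and decreasing, so its drop over
    [eps^2, eps^2 + r^2] is at most 2 r^2 / eps^2 times its drop over [eps^2 / 2, eps^2]. The latter
    gives [Phi eps - Phi d], of which [Phi d >= 0] is discarded. The comparison starts at eps^2 / 2
    and not at 0, since [diffE] asks for positive parameters. *)
Lemma indic_variation_cvx eps r : 0 < eps -> 0 < r ->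
  Phi (Num.sqrt (eps ^+ 2 + r ^+ 2)) - Phi eps <= 2 * r ^+ 2 / eps ^+ 2 * Phi eps.
Proof.
move=> ep0 r0; set t := Num.sqrt _.
have et : eps <= t.
  by rewrite -{1}(ger0_norm (ltW ep0)) -sqrtr_sqr ler_wsqrtr// lerDl sqr_ge0.
pose d := eps / Num.sqrt 2.
have s20 : 0 < Num.sqrt 2 :> R by rewrite sqrtr_gt0.
have s22 : Num.sqrt 2 ^+ 2 = 2 :> R by rewrite sqr_sqrtr.
have d0 : 0 < d by rewrite divr_gt0.
have d2 : d ^+ 2 = eps ^+ 2 / 2 by rewrite /d exprMn exprVn s22.
have de : d <= eps.
  rewrite -(ler_pXn2r (n := 2)) ?nnegrE ?(ltW d0) ?(ltW ep0)// d2.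
  by have := sqr_ge0 eps; lra.
have t2 : t ^+ 2 = eps ^+ 2 + r ^+ 2 by rewrite sqr_sqrtr// addr_ge0 ?sqr_ge0.
have C0 : 0 <= 2 * r ^+ 2 / eps ^+ 2 by rewrite divr_ge0 ?sqr_ge0// mulr_ge0// sqr_ge0.
have med := me d; have mee := me eps; have mI' := mI.
have : (\int[mu]_xi ((e eps xi - e t xi) * I xi)%:E <=
        (2 * r ^+ 2 / eps ^+ 2)%:E * \int[mu]_xi ((e d xi - e eps xi) * I xi)%:E)%E.
  rewrite -ge0_integralZl//; first last.
  - by move=> x _; rewrite lee_fin mulr_ge0// subr_ge0 e_decr.
  - by mfun.
  apply: ge0_le_integralW => x _; rewrite -?EFinM lee_fin.
    by rewrite mulr_ge0// subr_ge0 e_decr.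
  rewrite mulrA ler_wpM2r// /e t2 d2.
  (* With [y = eps^2 lam / 2], both sides are compared to [c y e^{-2y}]. *)
  set l := lam x; have l0 : 0 <= l := lam0 x.
  pose y := eps ^+ 2 / 2 * l.
  have y0 : 0 <= y by rewrite mulr_ge0// divr_ge0// sqr_ge0.
  rewrite (_ : - ((eps ^+ 2 + r ^+ 2) * l) = - (eps ^+ 2 * l) - r ^+ 2 * l); last by ring.
  rewrite (_ : eps ^+ 2 * l = y + y); last by rewrite /y; field.
  rewrite opprD !expRD -/y.
  set E := expR (- y).
  have E0 : 0 < E by exact: expR_gt0.
  set X := expR (- (r ^+ 2 * l)).
  have h1 : 1 - X <= r ^+ 2 * l by exact: subr1_expR_le.
  have h2 : E * (1 + y) <= 1.
    rewrite /E expRN mulrC ler_pdivrMr ?expR_gt0// mul1r; exact: expR_ge1Dx.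
  have rly : r ^+ 2 * l = 2 * r ^+ 2 / eps ^+ 2 * y by rewrite /y; field; rewrite gt_eqF.
  rewrite {}rly in h1; move: C0 h1; set c := _ / _; clearbody X c => C0 h1.
  have h3 : E * E * (1 - X) <= E * E * (c * y) by rewrite ler_wpM2l// mulr_ge0// ltW.
  have h4 : c * E * (E * (1 + y)) <= c * E * 1 by rewrite ler_wpM2l// mulr_ge0// ltW.
  lra.
rewrite !diffE// -EFinM lee_fin.
have K0 := variation_const_gt0; have P0 := indic_variation_ge0 d.
rewrite mulrCA ler_pM2l ?divr_gt0// => /le_trans; apply.
move: P0; move: (Phi d) (Phi eps) => p q p0.
by rewrite ler_wpM2l// gerBl.
Qed.

(** [subordination_sqrt] replaces the factor |xi|; its integrand times exp (- eps^2 lam) is the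
    difference of the exponentials at eps and at sqrt (eps^2 + r^2). After Tonelli, [diffE]
    evaluates the integral over the frequency. *)
Lemma Hhalf_norm_sq_log_energy a eps : 0 < eps ->
  Hhalf_norm_sq a b (convolution (gauss_scaled eps) (\1_A : V -> R)) =
  ((a ^+ 2 / (Num.sqrt (2 * sigma) * `|b|) / fine (@subordination_const R) *
    (variation_const / 2))%:E * log_energy indic_variation eps)%E.
Proof.
move=> ep0.
rewrite (Hhalf_norm_sq_gauss b gauss_cosE mA Afin a ep0).
set k := fine _.
have kE : @subordination_const R = k%:E.
  by rewrite fineK// ge0_fin_numE ?subordination_const_lty// ltW// subordination_const_gt0.
have k0 : 0 < k by rewrite -lte_fin -kE subordination_const_gt0.
set c0 := Num.sqrt (2 * sigma) * `|b|.
have c00 : 0 < c0 by rewrite mulr_gt0 ?normr_gt0// sqrtr_gt0 mulr_gt0.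
have sl xi : Num.sqrt (lam xi) = c0 * enorm xi.
  have s2 : 0 <= 2 * sigma by rewrite mulr_ge0// ltW.
  rewrite /lam -mulrA (sqrtrM (b ^+ 2 * _) s2) (sqrtrM (dotv xi xi) (sqr_ge0 b)).
  by rewrite sqrtr_sqr mulrA.
(* Chosen so that [C * k * sqrt (lam xi)] equals [a ^+ 2 * enorm xi]. *)
pose C := a ^+ 2 / c0 / k.
have C0 : 0 <= C by rewrite !divr_ge0 ?sqr_ge0// ltW.
have mw := @measurable_invsqr_weight R.
have mI' := mI; have ml := mlam.
pose g (p : V * gR) : \bar R :=
  (C * ((e eps p.1 - e (Num.sqrt (eps ^+ 2 + p.2 ^+ 2)) p.1) * I p.1) * invsqr_weight p.2)%:E.
have mgg : measurable_fun setT g by rewrite /g /e; mfun.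
have et r : eps <= Num.sqrt (eps ^+ 2 + r ^+ 2).
  by rewrite -{1}(ger0_norm (ltW ep0)) -sqrtr_sqr ler_wsqrtr// lerDl sqr_ge0.
have g0 p : (0 <= g p)%E.
  rewrite lee_fin mulr_ge0 ?invsqr_weight_ge0// mulr_ge0// mulr_ge0// subr_ge0 e_decr//.
transitivity (\int[mu]_xi \int[mu1]_r g (xi, r))%E.
  apply: eq_integral => xi _.
  transitivity ((C * (e eps xi * I xi))%:E *
    \int[mu1]_r ((1 - expR (- (r ^+ 2 * lam xi))) * invsqr_weight r)%:E)%E.
    rewrite subordination_sqrt// sl kE -!EFinM; congr EFin.
    by rewrite /C /e /I; field; rewrite !gt_eqF.
  rewrite -ge0_integralZl//; first last.
  - by rewrite lee_fin mulr_ge0// mulr_ge0.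
  - move=> r _; rewrite lee_fin mulr_ge0 ?invsqr_weight_ge0// subr_ge0 -expR0 ler_expR.
    by rewrite oppr_le0 mulr_ge0// sqr_ge0.
  - by mfun.
  apply: eq_integral => r _; rewrite /g -EFinM; congr EFin => /=.
  rewrite /e sqr_sqrtr; last by rewrite addr_ge0 ?sqr_ge0.
  rewrite [in RHS](mulrDl (eps ^+ 2)) opprD expRD.
  have aux (x i p w : R) : C * (x * i) * ((1 - p) * w) = C * ((x - x * p) * i) * w by ring.
  exact: aux.
rewrite (@fubini_tonelli _ _ V gR R mu mu1 g mgg g0).
have mf (F : gR -> R) : measurable_fun setT F -> measurable_fun [set: gR] (fun r : gR =>
    ((F (Num.sqrt (eps ^+ 2 + r ^+ 2)) - F eps) * invsqr_weight r)%:E) by move=> mF; mfun.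
have mf1 := mf _ measurable_indic_variation.
rewrite -ge0_integralZl; first last.
- by rewrite lee_fin mulr_ge0// divr_ge0// ltW// variation_const_gt0.
- move=> r _; rewrite lee_fin mulr_ge0 ?invsqr_weight_ge0// subr_ge0.
  by apply: indic_variation_mono => //; exact: et.
- exact: mf1.
- exact: measurableT.
apply: eq_integral => r _.
transitivity ((C * invsqr_weight r)%:E * \int[mu]_xi ((e eps xi - e (Num.sqrt (eps ^+ 2 + r ^+ 2)) xi) * I xi)%:E)%E.
  rewrite -ge0_integralZl//; first last.
  - by rewrite lee_fin mulr_ge0// invsqr_weight_ge0.
  - by move=> xi _; rewrite lee_fin mulr_ge0// subr_ge0 e_decr//.
  - by rewrite /e; mfun.
  apply: eq_integral => xi _; rewrite -EFinM /g/=; congr EFin.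
  exact: mulrAC.
rewrite diffE// -!EFinM; congr EFin.
have aux (x w c p q : R) : x * w * (c * (q - p)) = x * c * ((q - p) * w) by ring.
exact: aux.
Qed.

End energy_representation.

(** * Continuity of translations *)

Section dominated.
Context {R : realType} d (T : measurableType d) (mu : {measure set T -> \bar R}).

Lemma dominated_Rintegral_dist (f_ : nat -> T -> R) (f g : T -> R) (eta : R) :
  (forall m, measurable_fun setT (f_ m)) ->
  (forall x, f_ ^~ x @ \oo --> f x) ->
  mu.-integrable setT (EFin \o g) -> (forall m x, `|f_ m x| <= g x) -> 0 < eta ->
  exists m, `|\int[mu]_x f_ m x - \int[mu]_x f x| <= eta.
Proof.
move=> mf ff gi fg eta0.
have fi m : mu.-integrable setT (EFin \o f_ m) := integrable_le (mf m) (fg m) gi.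
have mf' : measurable_fun setT f by apply: (measurable_fun_cvg mf) => x _; exact: ff.
have fg' x : `|f x| <= g x.
  have : (fun m => `|f_ m x|) @ \oo --> `|f x| by apply: cvg_norm; exact: ff.
  move/(@cvg_lim _ _); move=> <- //.
  apply: limr_le; last by apply: nearW => m; exact: fg.
  by apply: is_cvg_norm; apply/cvg_ex; exists (f x); exact: ff.
have fi' := integrable_le mf' fg' gi.
have : (\int[mu]_x (f_ m x)%:E)%E @[m --> \oo] --> (\int[mu]_x (f x)%:E)%E.
  apply: (@dominated_cvg _ T R mu setT measurableT (fun m x => (f_ m x)%:E)
    (fun x => (f x)%:E) (EFin \o g)) => //.
  - by move=> m; apply/measurable_EFinP; exact: mf.
  - by move=> x _; apply: cvg_EFin; [exact: nearW|exact: ff].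
  - by move=> m x _; rewrite lee_fin.
rewrite (EFin_Rintegral fi').
move=> /fine_cvgP[_] /cvgrPdist_le /(_ _ eta0)[N _ /(_ N (leqnn _))] /= h.
by exists N; rewrite distrC.
Qed.

(** Serves to discard tails: [f_ m] will be an integrable function cut to sets that decrease to the
    empty set. *)
Lemma small_integral_eventually0 (f_ : nat -> T -> R) (g : T -> R) (eta : R) :
  (forall m, measurable_fun setT (f_ m)) -> (forall m x, 0 <= f_ m x) ->
  (forall x, exists N, forall m, (N <= m)%N -> f_ m x = 0) ->
  mu.-integrable setT (EFin \o g) -> (forall m x, f_ m x <= g x) -> 0 < eta ->
  exists m, (\int[mu]_x (f_ m x)%:E <= eta%:E)%E.
Proof.
move=> mf f0 fN gi fg eta0.
have fg' m x : `|f_ m x| <= g x by rewrite ger0_norm.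
have ff x : f_ ^~ x @ \oo --> (0 : R).
  have [N HN] := fN x; apply: cvg_near_cst; exists N => // m /= Nm.
have [m Hm] := @dominated_Rintegral_dist f_ (fun=> 0) g eta mf ff gi fg' eta0.
have fi := integrable_le (mf m) (fg' m) gi.
exists m; rewrite (EFin_Rintegral fi) lee_fin (le_trans _ Hm)//.
by rewrite Rintegral_cst// mul0r subr0 ler_norm.
Qed.

End dominated.

Section translation_continuity.
Context {R : realType} {n : nat}.
Notation V := 'rV[R]_n.
Notation gR := (measurableTypeR R).
Notation mu := (@lebesgue_rV R n).
Notation mu1 := (@lebesgue_measure R).

Let flip (A : set V) (h x : V) : R := `|\1_A (x + h) - \1_A x|.

Let mflip A h : measurable A -> measurable_fun setT (flip A h).
Proof. by move=> mA; have m1 := measurable_indicR mA; rewrite /flip; mfun. Qed.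

Let flip_le1 A h x : flip A h x <= 1.
Proof.
rewrite /flip !indicE; case: (_ \in _); case: (_ \in _); rewrite ?subrr ?subr0 ?sub0r ?normrN ?normr1 ?normr0//.
Qed.

Let flip_gauss_ge0 A h x : 0 <= flip A h x * gauss x.
Proof. by rewrite mulr_ge0 ?normr_ge0// gauss_ge0. Qed.

Definition gauss_flip (A : set V) (h : V) : \bar R :=
  (\int[mu]_x (flip A h x * gauss x)%:E)%E.

(* The sets moved little by small translations in Gaussian measure form a
   sigma-algebra containing the half-spaces. *)
Definition translation_stable (A : set V) : Prop := measurable A /\
  forall eta : R, 0 < eta -> exists2 delta : R, 0 < delta &
    forall h, enorm h <= delta -> (gauss_flip A h <= eta%:E)%E.

(** An integrable bound for all [gauss (x - h)] with |h| <= 1, because |x - h|^2 >= |x|^2 / 2 -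
    |h|^2. *)
Let kappa (x : V) : R := expR 1 * gauss ((Num.sqrt 2)^-1 *: x).

Let mkappa : measurable_fun setT kappa.
Proof. by have mg := @measurable_gauss R n; rewrite /kappa; mfun. Qed.

Let kappa_ge0 x : 0 <= kappa x.
Proof. by rewrite mulr_ge0 ?expR_ge0 ?gauss_ge0. Qed.

Let kappai : mu.-integrable setT (EFin \o kappa).
Proof.
have mg := @measurable_gauss R n.
apply: ge0_integrable => //; rewrite /kappa.
under eq_integral do rewrite EFinM.
rewrite ge0_integralZl//; first last.
- by move=> x _; rewrite lee_fin gauss_ge0.
- by mfun.
rewrite (integral_scale (f := fun x => (gauss x)%:E)) ?invr_gt0 ?sqrtr_gt0//; last by mfun.
by rewrite integral_gauss mule1 -EFinM ltry.
Qed.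

Let gauss_kappa h x : enorm h <= 1 -> gauss (x - h) <= kappa x.
Proof.
move=> h1; rewrite /kappa /gauss mulrCA ler_wpM2l//.
rewrite -expRD ler_expR !enorm_sqr dotvZl dotvZr mulrA -invfM -expr2 sqr_sqrtr//.
rewrite -ler_sqr ?nnegrE ?enorm_ge0// enorm_sqr expr1n in h1.
have := dotv_ge0 (2^-1 *: x - h).
rewrite !(dotvDl, dotvDr, dotvNl, dotvNr, dotvZl, dotvZr) (dotvC h x); lra.
Qed.

Let gauss_kappa0 x : gauss x <= kappa x.
Proof. by rewrite -{1}[x]subr0 gauss_kappa// enorm0. Qed.

Let translation_stable0 : translation_stable set0.
Proof.
split=> // eta eta0; exists 1 => // h _; rewrite /gauss_flip integral0_eq ?lee_fin ?(ltW eta0)//.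
by move=> x _; rewrite /flip !indic0 subrr normr0 mul0r.
Qed.

Let translation_stableC A : translation_stable A -> translation_stable (~` A).
Proof.
move=> [mA HA]; split; first exact: measurableC.
move=> eta /HA[delta d0 Hd]; exists delta => // h /Hd.
rewrite /gauss_flip (_ : flip (~` A) h = flip A h)//; apply/funext => x.
rewrite /flip !indicE !in_setC.
by case: (_ \in _); case: (_ \in _); rewrite //= ?subrr// ?subr0 ?sub0r ?normrN.
Qed.

Let gauss_flip_le (A B C : set V) h : measurable A -> measurable B -> measurable C ->
  (forall x, flip A h x <= flip B h x + flip C h x) ->
  (gauss_flip A h <= gauss_flip B h + gauss_flip C h)%E.
Proof.
move=> mA mB mC H; have mg := @measurable_gauss R n.
have m1 := mflip h mB; have m2 := mflip h mC.
rewrite /gauss_flip -ge0_integralD//; first last.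
- by mfun.
- by move=> x _; rewrite lee_fin flip_gauss_ge0.
- by mfun.
- by move=> x _; rewrite lee_fin flip_gauss_ge0.
apply: ge0_le_integralW => x _; first by rewrite lee_fin flip_gauss_ge0.
by rewrite -EFinD lee_fin -mulrDl ler_wpM2r ?gauss_ge0.
Qed.

Let translation_stableU A B : translation_stable A -> translation_stable B ->
  translation_stable (A `|` B).
Proof.
move=> [mA HA] [mB HB]; split; first exact: measurableU.
move=> eta eta0; have e2 : 0 < eta / 2 by rewrite divr_gt0.
have [d1 d10 H1] := HA _ e2; have [d2 d20 H2] := HB _ e2.
exists (Num.min d1 d2); first by rewrite lt_min d10.
move=> h; rewrite le_min => /andP[/H1 h1 /H2 h2].
apply: (@le_trans _ _ (gauss_flip A h + gauss_flip B h)%E); last first.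
  by rewrite (splitr eta) EFinD leeD.
apply: gauss_flip_le => //; first exact: measurableU.
move=> x; rewrite /flip !indicE !in_setU.
do 4 (case: (_ \in _)); rewrite /= ?subrr ?subr0 ?sub0r ?normrN ?normr1 ?normr0; lra.
Qed.

(** The union is approximated by a finite union [S m]. The remainder [W] and its translate each cost
    at most [eta / 4]; both are measured by [kappa], which dominates the shifted Gaussian uniformly
    in [h]. *)
Let translation_stable_bigcup (F : nat -> set V) : (forall i, translation_stable (F i)) ->
  translation_stable (\bigcup_i F i).
Proof.
move=> HF; have mF i : measurable (F i) by case: (HF i).
set U := \bigcup_i F i.
have mU : measurable U by exact: bigcup_measurable.
split=> // eta eta0.
pose S m := \big[setU/set0]_(i < m) F i.
have HS m : translation_stable (S m).
  rewrite /S; elim: m => [|m IH]; first by rewrite big_ord0.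
  by rewrite big_ord_recr/=; exact: translation_stableU.
have mS m : measurable (S m) by case: (HS m).
have mD m : measurable (U `\` S m) by exact: measurableD.
have e4 : 0 < eta / 4 by rewrite divr_gt0.
have [m Hm] : exists m, (\int[mu]_x (\1_(U `\` S m) x * kappa x)%:E <= (eta / 4)%:E)%E.
  apply: (@small_integral_eventually0 _ _ _ _ _ kappa) => //.
  - by move=> m; have m1 := measurable_indicR (mD m); mfun.
  - by move=> m x; rewrite mulr_ge0// indic_ge0.
  - move=> x; have [[i _ Fix]|nUx] := pselect (U x).
      exists i.+1 => m im; rewrite indicE memNset ?mul0r// => -[_]; apply.
      by rewrite /S -bigcup_mkord; exists i.
    by exists 0%N => m _; rewrite indicE memNset ?mul0r// => -[].
  - move=> m x; rewrite ler_piMl//.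
have [delta d0 Hd] := (HS m).2 _ (divr_gt0 eta0 (ltr0n _ 2)).
exists (Num.min delta 1); first by rewrite lt_min d0/=.
move=> h; rewrite le_min => /andP[/Hd h1 h2].
have mg := @measurable_gauss R n.
set W := U `\` S m; have mW : measurable_fun setT (\1_W : V -> R) := measurable_indicR (mD m).
have mfl := mflip h (mS m).
have W0 x : 0 <= \1_W x :> R by exact: indic_ge0.
apply: (@le_trans _ _ (gauss_flip (S m) h + (\int[mu]_x (\1_W (x + h) * gauss x)%:E +
    \int[mu]_x (\1_W x * gauss x)%:E))%E).
  rewrite -ge0_integralD//; first last.
  - by mfun.
  - by move=> x _; rewrite lee_fin ?flip_gauss_ge0// mulr_ge0 ?gauss_ge0.
  - by mfun.
  - by move=> x _; rewrite lee_fin ?flip_gauss_ge0// mulr_ge0 ?gauss_ge0.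
  rewrite -ge0_integralD//; first last.
  - by mfun.
  - by move=> x _; rewrite -EFinD lee_fin addr_ge0// ?flip_gauss_ge0// mulr_ge0 ?gauss_ge0.
  - by mfun.
  - by move=> x _; rewrite lee_fin ?flip_gauss_ge0// mulr_ge0 ?gauss_ge0.
  apply: ge0_le_integralW => x _; first by rewrite lee_fin ?flip_gauss_ge0// mulr_ge0 ?gauss_ge0.
  rewrite -!EFinD lee_fin -!mulrDl ler_wpM2r ?gauss_ge0// /flip !indicE /W !in_setD.
  have SU y : y \in S m -> y \in U.
    rewrite !inE /S -bigcup_mkord => -[i _ Fi]; by exists i.
  have := SU (x + h); have := SU x.
  case: (x + h \in U); case: (x \in U); case: (x + h \in S m); case: (x \in S m);
    rewrite /= => H1 H2; rewrite ?subrr ?subr0 ?sub0r ?normrN ?normr1 ?normr0 ?addr0 ?add0r//;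
    try (by have := H1 isT); try (by have := H2 isT).
have K1 : (\int[mu]_x (\1_W x * gauss x)%:E <= (eta / 4)%:E)%E.
  apply: le_trans Hm; apply: ge0_le_integralW => x _; rewrite lee_fin ?mulr_ge0 ?gauss_ge0//.
  by rewrite ler_wpM2l.
have K2 : (\int[mu]_x (\1_W (x + h) * gauss x)%:E <= (eta / 4)%:E)%E.
  under eq_integral => x _ do rewrite -{2}[x](addrK h).
  rewrite (integral_shift (f := fun y => (\1_W y * gauss (y - h))%:E)); last by mfun.
  apply: le_trans Hm; apply: ge0_le_integralW => x _; rewrite lee_fin ?mulr_ge0 ?gauss_ge0//.
  by rewrite ler_wpM2l// gauss_kappa.
apply: le_trans (leeD h1 (leeD K2 K1)) _.
by rewrite -!EFinD lee_fin; lra.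
Qed.

Let gauss1_le1 (s : R) : gauss1 s <= 1.
Proof.
rewrite /gauss1 mulr_ile1 ?expR_ge0 ?invr_ge0 ?sqrtr_ge0//.
  rewrite invf_le1 ?sqrtr_gt0 ?mulr_gt0 ?pi_gt0//.
  by rewrite -{1}sqrtr1 ler_wsqrtr//; have := @pi_ge2 R; lra.
by rewrite expR_le1 oppr_le0 divr_ge0// sqr_ge0.
Qed.

(** A shift by [h] affects only the slab of points whose i-th coordinate is within [dl] of [c]. Its
    Gaussian measure is at most its width [2 * dl = eta], since the density [gauss1] is at most
    1. *)
Let translation_stable_half (i : 'I_n) (c : R) :
  translation_stable [set x : V | c < x ord0 i].
Proof.
have mH : measurable [set x : V | c < x ord0 i].
  have := @measurable_coord R n i measurableT `]c, +oo[%classic (measurable_itv _).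
  by rewrite setTI; congr measurable; apply/seteqP; split => x /=; rewrite in_itv/= andbT.
split=> // eta eta0.
exists (eta / 2); first by rewrite divr_gt0.
move=> h hd.
set dl := eta / 2 in hd *.
have hi : `|h ord0 i| <= dl.
  exact: le_trans (normr_coord_le_enorm h i) hd.
have e1 : enorm (delta_mx ord0 i : V) = 1.
  by rewrite /enorm dotv_delta mxE !eqxx sqrtr1.
pose f (s : gR) : \bar R := (\1_(`[c - dl, c + dl]%classic) s)%:E.
have mf : measurable_fun setT f by apply/measurable_EFinP; exact: measurable_indic.
apply: (@le_trans _ _ (\int[mu]_x (f (dotv x (delta_mx ord0 i)) * (gauss x)%:E))%E).
  apply: ge0_le_integralW => x _; first by rewrite lee_fin ?flip_gauss_ge0// mulr_ge0 ?gauss_ge0.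
  rewrite dotv_delta /f -EFinM lee_fin ler_wpM2r ?gauss_ge0//.
  rewrite [leRHS]indicE; case: (boolP (_ \in _)) => [_|/negP].
    exact: flip_le1.
  rewrite inE/= in_itv/= => /negP; rewrite negb_and -!ltNge => H.
  rewrite /flip !indicE.
  rewrite (_ : (x + h \in _) = (x \in [set x : V | c < x ord0 i])) ?subrr ?normr0//.
  apply/idP/idP; rewrite !inE/= mxE; move: hi; rewrite ler_norml => /andP[h1 h2]; case/orP: H; lra.
rewrite ge0_integral_gauss_dotv//; last by move=> t; rewrite lee_fin indicE.
rewrite e1; under eq_integral do rewrite mul1r.
apply: (@le_trans _ _ (\int[mu1]_s f s)%E).
  apply: ge0_le_integralW => s _; rewrite /f -EFinM lee_fin.
    by rewrite mulr_ge0 ?gauss1_ge0// indicE.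
  by rewrite ler_piMr ?gauss1_le1// indicE.
rewrite /f integral_indic; first last.
- exact: measurable_itv.
- exact: measurableT.
rewrite setIT [X in (X <= _)%E]lebesgue_measure_itv/= lte_fin.
case: ifPn => _; rewrite ?lee_fin ?(ltW eta0)//.
by rewrite /dl; lra.
Qed.

Lemma measurable_translation_stable A : measurable A -> translation_stable A.
Proof.
have sa : sigma_algebra setT translation_stable.
  split.
  - exact: translation_stable0.
  - by move=> B HB; rewrite setTD; exact: translation_stableC.
  - exact: translation_stable_bigcup.
apply: smallest_sub => //.
rewrite -bigcup_seq => B [i /= _ [C mC <-]].
(* The subsets of the line with stable preimage form a sigma-algebra, so it suffices that it
   contains the open rays. *)
have : image_set_system setT (fun x : V => x ord0 i : R) translation_stable C.
  have : (RGenOInfty.G (R:=R)).-sigma.-measurable C by rewrite -RGenOInfty.measurableE.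
  move: C {mC}; apply: smallest_sub.
    exact: sigma_algebra_image.
  move=> _ [c ->]; rewrite /image_set_system/= setTI.
  have := translation_stable_half i c; congr translation_stable.
  by apply/seteqP; split => x /=; rewrite in_itv/= andbT.
by [].
Qed.

(** Back from Gaussian to Lebesgue measure: on a large ball the density is at least [c > 0], and
    outside only the small tail [W] of [A] and its translate contribute. *)
Lemma L1diff_continuous0 A (eta : R) : measurable A -> (mu A < +oo)%E -> 0 < eta ->
  exists2 delta : R, 0 < delta &
    forall h, enorm h <= delta -> (L1diff (\1_A : V -> R) h <= eta%:E)%E.
Proof.
move=> mA Aoo eta0.
have mAi := @measurable_indicR R n A mA.
have mg := @measurable_gauss R n.
have e4 : 0 < eta / 4 by rewrite divr_gt0.
pose ball (M : R) : set V := [set x | enorm x < M].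
have mball M : measurable (ball M).
  have me : measurable_fun setT (fun x : V => enorm x) by mfun.
  have := me measurableT `]-oo, M[%classic (measurable_itv _); rewrite setTI.
  by congr measurable; apply/seteqP; split => x /=; rewrite in_itv/=.
have [m Hm] : exists m, (\int[mu]_x (\1_(A `\` ball m%:R) x)%:E <= (eta / 4)%:E)%E.
  apply: (@small_integral_eventually0 _ _ _ _ _ (\1_A : V -> R)) => //.
  - by move=> m; apply: measurable_indicR; exact: measurableD.
  - move=> x; exists (Num.truncn (enorm x)).+1 => m xm; rewrite indicE memNset// => -[_]; apply.
    rewrite /ball/=; apply: lt_le_trans (truncnS_gt _) _.
    by rewrite ler_nat.
  - exact: integrable_indicR.
  - by move=> m x; rewrite !indicE in_setD; case: (_ \in A) => //=; case: (_ \in _).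
set W := A `\` ball m%:R in Hm.
have mW : measurable_fun setT (\1_W : V -> R) by apply: measurable_indicR; exact: measurableD.
(* The margin 1 ensures that for |x| > M and |h| <= 1 both x and x + h lie outside the ball of
   radius m. *)
pose M : R := m%:R + 1.
have M0 : 0 < M by rewrite ltr_wpDl.
pose c : R := Num.sqrt (2 * pi) ^- n * expR (- (M ^+ 2 / 2)).
have c0 : 0 < c.
  by rewrite mulr_gt0 ?expR_gt0// invr_gt0 exprn_gt0// sqrtr_gt0 mulr_gt0// pi_gt0.
have [_ /(_ (c * (eta / 2)))[|delta d0 Hd]] := measurable_translation_stable mA.
  by rewrite mulr_gt0// divr_gt0.
exists (Num.min delta 1); first by rewrite lt_min d0/=.
move=> h; rewrite le_min => /andP[/Hd h1 h2].
have mfl := mflip h mA.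
apply: (@le_trans _ _ ((c^-1)%:E * gauss_flip A h + (\int[mu]_x (\1_W (x + h))%:E + \int[mu]_x (\1_W x)%:E))%E).
  rewrite /gauss_flip -ge0_integralZl//; first last.
  - by rewrite lee_fin invr_ge0 ltW.
  - by move=> x _; rewrite lee_fin ?flip_gauss_ge0// mulr_ge0 ?gauss_ge0.
  - by mfun.
  have i0 y : (0 <= (\1_W y : R)%:E)%E by rewrite lee_fin indic_ge0.
  rewrite -ge0_integralD; first last.
  - by mfun.
  - by move=> x _; exact: i0.
  - by mfun.
  - by move=> x _; exact: i0.
  - exact: measurableT.
  rewrite -ge0_integralD; first last.
  - by mfun.
  - by move=> x _; rewrite adde_ge0.
  - by mfun.
  - by move=> x _; rewrite -EFinM lee_fin mulr_ge0 ?invr_ge0 ?(ltW c0)// flip_gauss_ge0.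
  - exact: measurableT.
  apply: ge0_le_integralW => x _; first by rewrite lee_fin.
  rewrite -EFinM -!EFinD lee_fin -/(flip A h x).
  have [xM|xM] := leP (enorm x) M.
    rewrite ler_wpDr ?addr_ge0 ?indic_ge0// ler_pdivlMl// mulrC ler_wpM2l ?normr_ge0//.
    rewrite /c /gauss ler_wpM2l ?invr_ge0 ?exprn_ge0 ?sqrtr_ge0//.
    rewrite ler_expR lerN2 ler_wpM2r ?invr_ge0// ler_sqr ?nnegrE ?enorm_ge0//.
    exact: ltW.
  rewrite ler_wpDl ?mulr_ge0 ?invr_ge0 ?(ltW c0) ?gauss_ge0 ?normr_ge0//.
  have WA y : m%:R <= enorm y -> \1_W y = \1_A y :> R.
    move=> ym; rewrite !indicE in_setD (memNset _ : (y \in ball _) = false) ?andbT//=.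
    by rewrite /ball/= ltNge ym.
  rewrite !WA; first last.
  - have := enormD (x + h) (- h); rewrite addrK enormN; rewrite /M in xM; lra.
  - rewrite /M in xM; lra.
  by rewrite /flip (le_trans (ler_normB _ _))// !ger0_norm ?indic_ge0.
rewrite (integral_shift (f := fun y => (\1_W y)%:E)); last by mfun.
have K1 : ((c^-1)%:E * gauss_flip A h <= (eta / 2)%:E)%E.
  by rewrite lee_pdivrMl// -EFinM.
apply: le_trans (leeD K1 (leeD Hm Hm)) _.
by rewrite -!EFinD lee_fin; lra.
Qed.

End translation_continuity.

Section Rintegral_sum.
Context {R : realType} d (T : measurableType d) (mu : {measure set T -> \bar R}).

Lemma integrable_Rsum k (f : 'I_k -> T -> R) :
  (forall i, mu.-integrable setT (EFin \o f i)) ->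
  mu.-integrable setT (fun x => (\sum_(i < k) f i x)%:E).
Proof.
move=> fi; have := integrable_sum measurableT (index_enum 'I_k) (P := xpredT) (fun i _ => fi i).
by apply: eq_integrable => // x _; rewrite -sumEFin.
Qed.

Lemma Rintegral_sum k (f : 'I_k -> T -> R) :
  (forall i, mu.-integrable setT (EFin \o f i)) ->
  \int[mu]_x (\sum_(i < k) f i x) = \sum_(i < k) \int[mu]_x f i x.
Proof.
move=> fi; have H := integrable_Rsum fi.
apply: EFin_inj; rewrite -(EFin_Rintegral H) -sumEFin.
under eq_integral do rewrite -sumEFin.
rewrite (integral_sum measurableT fi).
by apply: eq_bigr => i _; exact: EFin_Rintegral.
Qed.

Lemma EFin_normr_RintegralW (f : T -> R) : mu.-integrable setT (EFin \o f) ->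
  ((`|\int[mu]_x f x|)%:E <= \int[mu]_x `|f x|%:E)%E.
Proof.
move=> fi; rewrite (EFin_Rintegral (f := fun x => `|f x|)); last first.
  exact: (integrable_norm fi).
by rewrite lee_fin le_normr_Rintegral.
Qed.

End Rintegral_sum.

(** * Mollification *)

Section mollifier.
Context {R : realType} {n : nat}.
Notation V := 'rV[R]_n.
Notation mu := (@lebesgue_rV R n).

(** The gradient [G] is specified by a quadratic Taylor bound in L^1, the form in which it passes to
    convolutions and correlations. *)
Record mollifier (delta : R) (rho : V -> R) (G : V -> V) (C : R) : Prop := Mollifier {
  mollifier_measurable : measurable_fun setT rho;
  mollifier_const_ge0 : 0 <= C;
  mollifier_ge0 : forall x, 0 <= rho x;
  mollifier_integral : (\int[mu]_x (rho x)%:E = 1)%E;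
  mollifier_support : forall x, delta < enorm x -> rho x = 0;
  mollifier_gradient : forall i, mu.-integrable setT (fun x => (G x ord0 i)%:E);
  mollifier_taylor : forall h,
    (\int[mu]_x `|rho (x + h) - rho x - dotv (G x) h|%:E <= (C * dotv h h)%:E)%E }.

Section mollifier_integrals.
Variables (delta : R) (rho : V -> R) (G : V -> V) (C : R).
Hypothesis rhoG : mollifier delta rho G C.

Lemma integrable_mollifier : mu.-integrable setT (EFin \o rho).
Proof.
apply: ge0_integrable; [exact: mollifier_measurable rhoG|exact: mollifier_ge0 rhoG|].
by rewrite (mollifier_integral rhoG) ltry.
Qed.

Lemma integrable_dotv_gradient h : mu.-integrable setT (fun y => (dotv (G y) h)%:E).
Proof.
apply: integrable_Rsum => i.
have := integrableZl measurableT (h ord0 i) (mollifier_gradient rhoG i).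
by apply: eq_integrable => // y _; rewrite /= -EFinM mulrC.
Qed.

Definition taylor_remainder h (y : V) := rho (y + h) - rho y - dotv (G y) h.

Lemma integrable_taylor_remainder h : mu.-integrable setT (EFin \o taylor_remainder h).
Proof.
have i1 := integrableB measurableT (integrable_shift h integrable_mollifier) integrable_mollifier.
exact: (integrableB measurableT i1 (integrable_dotv_gradient h)).
Qed.

End mollifier_integrals.

Definition posr (s : R) : R := Num.max 0 s.

Lemma measurable_posr : measurable_fun [set: R] posr.
Proof. by apply: measurable_maxr => //; exact: measurable_cst. Qed.

Lemma posr_ge0 s : 0 <= posr s. Proof. by rewrite /posr le_max lexx. Qed.

Lemma posr_id s : 0 <= s -> posr s = s.
Proof. by move=> s0; rewrite /posr max_r. Qed.

Lemma posr_eq0 s : s <= 0 -> posr s = 0.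
Proof. by move=> s0; rewrite /posr max_l. Qed.

(** The square is the lowest power of the positive part with a Lipschitz gradient, hence with a
    quadratic Taylor bound. *)
Definition bump (x : V) : R := posr (1 - dotv x x) ^+ 2.

Definition bump_grad (x : V) : V := (- 4 * posr (1 - dotv x x)) *: x.

Lemma bump_ge0 x : 0 <= bump x. Proof. exact: sqr_ge0. Qed.

Lemma bump_le1 x : bump x <= 1.
Proof.
rewrite /bump expr_le1 ?posr_ge0// /posr ge_max ler01/= gerBl; exact: dotv_ge0.
Qed.

Lemma bump_out x : 1 <= dotv x x -> bump x = 0.
Proof. by move=> x1; rewrite /bump posr_eq0 ?expr0n// subr_le0. Qed.

Lemma bump_grad_out x : 1 <= dotv x x -> bump_grad x = 0.
Proof. by move=> x1; rewrite /bump_grad posr_eq0 ?subr_le0// mulr0 scale0r. Qed.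

Lemma measurable_bump : measurable_fun setT bump.
Proof. by have mp := measurable_posr; rewrite /bump; mfun. Qed.

Lemma measurable_bump_grad : measurable_fun setT bump_grad.
Proof. by have mp := measurable_posr; rewrite /bump_grad; mfun. Qed.

Lemma cauchy_schwarz_sqr (x y : V) : dotv x y ^+ 2 <= dotv x x * dotv y y.
Proof.
rewrite -!enorm_sqr -exprMn -(real_normK (num_real (dotv x y))).
by rewrite ler_sqr ?nnegrE ?mulr_ge0 ?enorm_ge0// cauchy_schwarz.
Qed.

(** With P, Q, H the squared lengths of p, p + h, h and c = p.h, one has Q = P + 2 c + H. For |p| <
    1 and H < 4 the expansion of the squared positive part is exact up to (P - Q)^2 <= 16 H, and
    replacing 2 (1 - P)(P - Q) by the gradient term costs 2 (1 - P) H <= 2 H; hence 18. The other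
    cases are cruder. *)
Lemma bump_taylor p h :
  `|bump (p + h) - bump p - dotv (bump_grad p) h| <= 18 * dotv h h.
Proof.
rewrite /bump /bump_grad dotvZl.
have cs1 := cauchy_schwarz_sqr p h; have cs2 := cauchy_schwarz_sqr (p + h) h.
have : dotv (p + h) (p + h) = dotv p p + 2 * dotv p h + dotv h h.
  by rewrite !(dotvDl, dotvDr) (dotvC h p); ring.
have : dotv (p + h) h = dotv p h + dotv h h by rewrite dotvDl.
have := dotv_ge0 (p + h); have := dotv_ge0 h; have := dotv_ge0 p.
move: cs1 cs2; move: (dotv (p + h) (p + h)) (dotv (p + h) h) (dotv p p) (dotv h h) (dotv p h).
move=> Q d P H c cs1 cs2 P0 H0 Q0 dE QE.
have [s0|s0] := leP (1 - P) 0.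
  rewrite (posr_eq0 s0) expr0n/= mulr0 mul0r !subr0 ger0_norm ?sqr_ge0//.
  have [s1|s1] := leP (1 - Q) 0; first by rewrite (posr_eq0 s1) expr0n/= mulr_ge0.
  rewrite (posr_id (ltW s1)).
  have [H4|H4] := leP 4 H; first by nra.
  have d2 : d ^+ 2 <= H by apply: le_trans cs2 _; rewrite ler_piMl//; lra.
  have h1 : (1 - Q) ^+ 2 <= (H - 2 * d) ^+ 2 by rewrite ler_sqr ?nnegrE; lra.
  have h2 := sqr_ge0 (H + 2 * d).
  have h3 : H * H <= 4 * H by rewrite ler_wpM2r// ltW.
  by nra.
have c2 : c ^+ 2 <= H by apply: le_trans cs1 _; rewrite ler_piMl//; lra.
rewrite (posr_id (ltW s0)).
have q0 := posr_ge0 (1 - Q).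
have q1 : posr (1 - Q) <= 1 by rewrite /posr ge_max ler01/=; lra.
have [H4|H4] := leP 4 H.
  have c1 : - H <= c <= H by apply/andP; split; nra.
  case/andP: c1 => c1 c1'.
  move: q0 q1; move: (posr _) => q q0 q1; rewrite ler_norml; apply/andP; split; nra.
have qE : `|posr (1 - Q) ^+ 2 - (1 - P) ^+ 2 - 2 * (1 - P) * (P - Q)| <= (P - Q) ^+ 2.
  have [s1|s1] := leP (1 - Q) 0.
    rewrite (posr_eq0 s1) expr0n/= ler_norml; apply/andP; split; nra.
  rewrite (posr_id (ltW s1)) ger0_norm.
    by rewrite le_eqVlt; apply/orP; left; apply/eqP; ring.
  rewrite (_ : _ - _ - _ = (P - Q) ^+ 2) ?sqr_ge0//; by ring.
have PQ : (P - Q) ^+ 2 <= 16 * H.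
  have h3 := sqr_ge0 (2 * c - H); have h4 : H * H <= 4 * H by rewrite ler_wpM2r// ltW.
  by rewrite QE; nra.
move: qE; rewrite !ler_norml => /andP[h1 h2].
have sH : 0 <= (1 - P) * H <= H.
  by apply/andP; split; [rewrite mulr_ge0 ?(ltW s0)|rewrite ler_piMl//; lra].
case/andP: sH => sH1 sH2.
by move: h1 h2 PQ; rewrite QE => h1 h2 PQ; apply/andP; split; lra.
Qed.

Let ball_ind (delta : R) (x : V) : R := \1_[set y : V | dotv y y < delta ^+ 2] x.

Let mball delta : measurable_fun setT (ball_ind delta).
Proof.
apply: measurable_indicR.
have md : measurable_fun setT (fun x : V => dotv x x) by mfun.
have := md measurableT `]-oo, delta ^+ 2[%classic (measurable_itv _); rewrite setTI.
by congr measurable; apply/seteqP; split => x /=; rewrite in_itv/=.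
Qed.

Let ball_ge0 delta x : 0 <= ball_ind delta x. Proof. exact: indic_ge0. Qed.

Let gauss_lower (delta x : R) (y : V) : dotv y y <= delta ^+ 2 ->
  Num.sqrt (2 * pi) ^- n * expR (- (delta ^+ 2 / 2)) <= gauss y.
Proof.
move=> yd; rewrite /gauss ler_wpM2l ?invr_ge0 ?exprn_ge0 ?sqrtr_ge0//.
by rewrite ler_expR lerN2 ler_wpM2r ?invr_ge0// enorm_sqr.
Qed.

Let gauss_lower_gt0 (delta : R) : 0 < Num.sqrt (2 * pi) ^- n * expR (- (delta ^+ 2 / 2)) :> R.
Proof. by rewrite mulr_gt0 ?expR_gt0// invr_gt0 exprn_gt0// sqrtr_gt0 mulr_gt0// pi_gt0. Qed.

(** Balls have finite Lebesgue measure because the Gaussian density, of total mass 1, is bounded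
    below on them. *)
Let balli delta : mu.-integrable setT (EFin \o ball_ind delta).
Proof.
set c := Num.sqrt (2 * pi) ^- n * expR (- (delta ^+ 2 / 2)) : R.
have c0 : 0 < c := gauss_lower_gt0 delta.
apply: (@integrable_le _ _ _ _ _ (fun x => c^-1 * gauss x)); first exact: mball.
- move=> x; rewrite ger0_norm// /ball_ind indicE; case: (boolP (_ \in _)); last first.
    by rewrite mulr_ge0 ?gauss_ge0// invr_ge0 ltW.
  by rewrite inE/= => xd; rewrite ler_pdivlMl// mulr1 gauss_lower// ltW.
- exact: (integrableZl measurableT c^-1 (integrable_gauss n)).
Qed.

Let bump_le_ball delta x : 0 < delta -> bump (delta^-1 *: x) <= ball_ind delta x.
Proof.
move=> d0; rewrite /ball_ind indicE; case: (boolP (_ \in _)) => [_|]; first exact: bump_le1.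
move=> /negP; rewrite inE/= => /negP; rewrite -leNgt => h.
rewrite bump_out// dotvZl dotvZr mulrA -invfM -expr2 mulrC ler_pdivlMr ?exprn_gt0//.
by rewrite mul1r.
Qed.

Let integral_bump_gt0 delta : 0 < delta -> (0 < \int[mu]_x (bump (delta^-1 *: x))%:E)%E.
Proof.
move=> d0.
have mb := measurable_bump.
rewrite (integral_scale (f := fun x => (bump x)%:E)) ?invr_gt0//; last by mfun.
rewrite mule_gt0 ?lte_fin ?invr_gt0 ?exprn_gt0 ?invr_gt0//.
(* On the cube with side [r] the squared length is at most n r^2 <= 1/2, so [bump] is at least 1/4
   there. *)
pose r : R := (2 * n.+1%:R)^-1.
have r0 : 0 < r by rewrite invr_gt0 mulr_gt0.
pose B := [set x : V | forall i, `]0, r[%classic (x ord0 i)].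
have BE : mu B = (r ^+ n)%:E.
  rewrite (@lebesgue_rV_box R n (fun=> `]0, r[%classic)); last by move=> i; exact: measurable_itv.
  rewrite (eq_bigr (fun=> r%:E)); last first.
    by move=> i _; rewrite lebesgue_measure_itv/= lte_fin r0 oppr0 adde0.
  by rewrite prodEFin prodr_const card_ord.
have mB : measurable B.
  rewrite (_ : B = \bigcap_(i in [set: 'I_n]) (fun x : V => x ord0 i) @^-1` `]0, r[%classic).
    apply: fin_bigcap_measurable; first exact: finite_finset.
    move=> i _; rewrite -[X in measurable X]setTI; exact: measurable_coord.
  by apply/seteqP; split => x /= H i; [move=> _; exact: H|exact: H].
apply: (@lt_le_trans _ _ (\int[mu]_(x in B) (2^-1 ^+ 2)%:E)%E).
  have -> : (\int[mu]_(x in B) (2^-1 ^+ 2)%:E = (2^-1 ^+ 2 * r ^+ n)%:E)%E.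
    by rewrite integral_cst// [in RHS]EFinM; congr (_ * _)%E; exact: BE.
  by rewrite lte_fin mulr_gt0 ?exprn_gt0.
apply: (@le_trans _ _ (\int[mu]_(x in B) (bump x)%:E)%E); last first.
  by apply: ge0_subset_integral => //; [mfun|move=> x _; rewrite lee_fin bump_ge0].
apply: ge0_le_integralW => x Bx; rewrite lee_fin ?sqr_ge0//.
have xx : dotv x x <= 2^-1.
  apply: (@le_trans _ _ (\sum_(i < n) r ^+ 2)).
    apply: ler_sum => i _; have := Bx i; rewrite /= in_itv/= => /andP[x0 xr].
    by rewrite -expr2 ler_sqr ?nnegrE ?ltW.
  have rm : r * (2 * (n%:R + 1)) = 1 by rewrite natr1 mulVf// mulf_neq0// pnatr_eq0.
  rewrite sumr_const card_ord -[leLHS]mulr_natr.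
  have n0 : 0 <= n%:R :> R by [].
  have rn : 0 <= r * n%:R by rewrite mulr_ge0// ltW.
  have r2 : r <= 2^-1 by lra.
  rewrite expr2 -mulrA (le_trans (ler_wpM2r rn r2))//; lra.
by rewrite /bump ler_sqr ?nnegrE ?posr_ge0 ?invr_ge0// posr_id; lra.
Qed.

Lemma exists_mollifier (delta : R) : 0 < delta ->
  exists rho G C, mollifier delta rho G C.
Proof.
move=> d0.
have mb := measurable_bump; have mbg := measurable_bump_grad; have mba := mball delta.
have i0 := integral_bump_gt0 d0.
have ki : mu.-integrable setT (fun x => (bump (delta^-1 *: x))%:E).
  apply: (@integrable_le _ _ _ _ _ (ball_ind delta)); [by mfun| |exact: balli].
  by move=> x; rewrite ger0_norm ?bump_ge0// bump_le_ball.
pose N : R := \int[mu]_x bump (delta^-1 *: x).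
have NE : (\int[mu]_x (bump (delta^-1 *: x))%:E)%E = N%:E := EFin_Rintegral ki.
have N0 : 0 < N by rewrite -lte_fin -NE.
have [D DE] : exists D : R, (\int[mu]_x (ball_ind delta x)%:E)%E = D%:E.
  by eexists; exact: (EFin_Rintegral (balli delta)).
pose rho x := N^-1 * bump (delta^-1 *: x).
pose G x := (N^-1 * delta^-1) *: bump_grad (delta^-1 *: x).
pose c := N^-1 * (18 * delta^-1 ^+ 2).
have c0 : 0 <= c by rewrite mulr_ge0 ?invr_ge0 ?(ltW N0)// mulr_ge0// sqr_ge0.
(* The remainder at [x] vanishes unless [x] or [x + h] lies in the ball of measure [D], which
   accounts for [D + D]; [c] is the constant of [bump_taylor] after dilation and normalization. *)
exists rho, G, (c * (D + D)); split.
- by rewrite /rho; mfun.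
- rewrite mulr_ge0// addr_ge0// -lee_fin -DE; apply: integral_ge0 => x _;
    by rewrite lee_fin ball_ge0.
- by move=> x; rewrite mulr_ge0 ?bump_ge0// invr_ge0 ltW.
- rewrite /rho; under eq_integral do rewrite EFinM.
  rewrite ge0_integralZl//; first last.
  - by rewrite lee_fin invr_ge0 ltW.
  - by move=> x _; rewrite lee_fin bump_ge0.
  - by mfun.
  by rewrite NE -EFinM mulVf// gt_eqF.
- move=> x dx; rewrite /rho bump_out ?mulr0// dotvZl dotvZr mulrA -invfM -expr2 mulrC.
  rewrite ler_pdivlMr ?exprn_gt0// mul1r -enorm_sqr ler_sqr ?nnegrE ?enorm_ge0 ?(ltW d0)//.
  exact: ltW.
- move=> i.
  apply: (@integrable_le _ _ _ _ _ (fun x => (N^-1 * delta^-1 * 4) * ball_ind delta x)).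
  + have mG : measurable_fun setT G by rewrite /G; mfun.
    exact: measurable_fun_coord.
  + move=> x; rewrite /ball_ind indicE; case: (boolP (_ \in _)); last first.
      move=> /negP; rewrite inE/= => /negP; rewrite -leNgt => h.
      rewrite /G bump_grad_out ?scaler0 ?mxE ?normr0 ?mulr0//.
      rewrite dotvZl dotvZr mulrA -invfM -expr2 mulrC ler_pdivlMr ?exprn_gt0//.
      by rewrite mul1r.
    rewrite inE/= => h; rewrite mulr1 /G /bump_grad 2!mxE normrM.
    rewrite ger0_norm ?mulr_ge0 ?invr_ge0 ?(ltW N0) ?(ltW d0)//.
    rewrite ler_wpM2l ?mulr_ge0 ?invr_ge0 ?(ltW N0) ?(ltW d0)//.
    rewrite normrM normrM normrN normr_nat -mulrA ler_piMr//.
    set y := delta^-1 *: x.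
    have y1 : dotv y y <= 1.
      rewrite dotvZl dotvZr mulrA -invfM -expr2 mulrC ler_pdivrMr ?exprn_gt0//.
      by rewrite mul1r ltW.
    rewrite mulr_ile1 ?normr_ge0//.
      rewrite ger0_norm ?posr_ge0// /posr ge_max ler01/= gerBl; exact: dotv_ge0.
    apply: le_trans (normr_coord_le_enorm y i) _.
    by rewrite -ler_sqr ?nnegrE ?enorm_ge0// enorm_sqr expr1n.
  + exact: (integrableZl measurableT (N^-1 * delta^-1 * 4) (balli delta)).
- move=> h; have mhB : measurable_fun setT (fun x : V => ball_ind delta (x + h)) by mfun.
  have C0 : 0 <= c * dotv h h by rewrite mulr_ge0// dotv_ge0.
  apply: (@le_trans _ _ (\int[mu]_x ((c * dotv h h)%:E *
      ((ball_ind delta (x + h))%:E + (ball_ind delta x)%:E)))%E).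
    apply: ge0_le_integralW => x _; rewrite -?EFinD -?EFinM lee_fin//.
    set y := delta^-1 *: x; set k := delta^-1 *: h.
    have -> : rho (x + h) - rho x - dotv (G x) h =
        N^-1 * (bump (y + k) - bump y - dotv (bump_grad y) k).
      by rewrite /rho /G scalerDr -/y -/k dotvZl /k dotvZr; ring.
    rewrite normrM ger0_norm ?invr_ge0 ?(ltW N0)//.
    rewrite /c -2!(mulrA N^-1) ler_wpM2l ?invr_ge0 ?(ltW N0)//.
    have kk : 18 * dotv k k = 18 * delta^-1 ^+ 2 * dotv h h.
      by rewrite /k dotvZl dotvZr; ring.
    have p0 : 0 <= 18 * delta^-1 ^+ 2 * dotv h h by rewrite -kk mulr_ge0// dotv_ge0.
    have [bx|bx] := leP (delta ^+ 2) (dotv x x); last first.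
      apply: (le_trans (bump_taylor y k)).
      rewrite kk ler_peMr// {2}/ball_ind [X in _ + X]indicE mem_set// lerDr.
      exact: ball_ge0.
    have [bx'|bx'] := leP (delta ^+ 2) (dotv (x + h) (x + h)); last first.
      apply: (le_trans (bump_taylor y k)).
      rewrite kk ler_peMr// {1}/ball_ind [X in X + _]indicE mem_set// lerDl.
      exact: ball_ge0.
    have out z : delta ^+ 2 <= dotv z z -> 1 <= dotv (delta^-1 *: z) (delta^-1 *: z).
      move=> hz; rewrite dotvZl dotvZr mulrA -invfM -expr2 mulrC ler_pdivlMr ?exprn_gt0//.
      by rewrite mul1r.
    rewrite /y /k -scalerDr !bump_out ?out// bump_grad_out ?out// dotv0l !subr0 normr0.
    by rewrite mulr_ge0// addr_ge0// ball_ge0.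
  rewrite ge0_integralZl//; first last.
  - by move=> x _; rewrite -EFinD lee_fin addr_ge0// ball_ge0.
  - by mfun.
  rewrite ge0_integralD//; first last.
  - by mfun.
  - by move=> x _; rewrite lee_fin ball_ge0.
  - by mfun.
  - by move=> x _; rewrite lee_fin ball_ge0.
  rewrite (integral_shift (f := fun x => (ball_ind delta x)%:E)); last by mfun.
  by rewrite DE -EFinD -EFinM lee_fin le_eqVlt; apply/orP; left; apply/eqP; rewrite mulrAC.
Qed.

End mollifier.

(** * Variation of the mollified indicator function *)

Lemma gauss1_absmoment_ge0 (R : realType) : 0 <= gauss1_absmoment :> R.
Proof. by apply: Rintegral_ge0 => s _; rewrite mulr_ge0 ?gauss1_ge0. Qed.

Section L1diff_theory.
Context {R : realType} {n : nat}.
Notation V := 'rV[R]_n.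
Notation mu := (@lebesgue_rV R n).
Variables (w : V -> R).
Hypothesis mw : measurable_fun setT w.

Lemma L1diff0 : L1diff w 0 = 0%E.
Proof. by apply: integral0_eq => x _; rewrite addr0 subrr normr0. Qed.

Lemma L1diffD (h k : V) : (L1diff w (h + k) <= L1diff w h + L1diff w k)%E.
Proof.
rewrite addeC -[L1diff w h](integral_shift (f := fun x => `|w (x + h) - w x|%:E) k); last by mfun.
rewrite addeC -ge0_integralD//; [|by mfun|by mfun].
apply: ge0_le_integralW => x _; rewrite -?EFinD lee_fin//.
rewrite (_ : x + (h + k) = x + k + h); last by rewrite -addrA (addrC k).
by rewrite (le_trans _ (ler_normD _ _))// subrKA.
Qed.

Lemma L1diffMn (h : V) k : (L1diff w (k%:R *: h) <= k%:R%:E * L1diff w h)%E.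
Proof.
elim: k => [|k IH]; first by rewrite scale0r L1diff0 mul0e.
rewrite -natr1 scalerDl scale1r EFinD ge0_muleDl ?mul1e//.
by apply: le_trans (L1diffD _ _) _; exact: leeD.
Qed.

Lemma L1diff_dist (v : V -> R) h : measurable_fun setT v ->
  (L1diff w h <= L1diff v h + 2%:E * \int[mu]_x `|v x - w x|%:E)%E.
Proof.
move=> mv; have mvw : measurable_fun setT (fun x => v x - w x) by mfun.
rewrite mule_natl mule2n.
rewrite -[X in (_ <= _ + (X + _))%E](integral_shift (f := fun x => `|v x - w x|%:E) h); last by mfun.
rewrite -ge0_integralD//; [|by mfun|by mfun].
rewrite -ge0_integralD; first last.
- by mfun.
- by move=> x _; rewrite adde_ge0// lee_fin.
- by mfun.
- by move=> x _; rewrite lee_fin.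
- exact: measurableT.
apply: ge0_le_integralW => x _; rewrite -?EFinD lee_fin//.
rewrite (_ : w (x + h) - w x = (v (x + h) - v x) + (- (v (x + h) - w (x + h)) + (v x - w x))); last by ring.
by rewrite (le_trans (ler_normD _ _))// lerD2l (le_trans (ler_normD _ _))// normrN.
Qed.

End L1diff_theory.

Section smoothing.
Context {R : realType} {n : nat}.
Notation V := 'rV[R]_n.
Notation mu := (@lebesgue_rV R n).
Variables (A : set V).
Hypotheses (mA : measurable A) (Aoo : (mu A < +oo)%E).
Variables (delta : R) (rho : V -> R) (G : V -> V) (C : R).
Hypothesis rhoG : mollifier delta rho G C.

Let u : V -> R := \1_A.
Let m : R := fine (mu A).
Let mu' : measurable_fun setT u. Proof. exact: measurable_indicR. Qed.
Let ui : mu.-integrable setT (EFin \o u). Proof. exact: integrable_indicR. Qed.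
Let u1 x : `|u x| <= 1. Proof. exact: normr_indic_le1. Qed.
Let iu : (\int[mu]_x (u x)%:E)%E = m%:E. Proof. exact: integral_indicR. Qed.
Let inu : (\int[mu]_x `|u x|%:E)%E = m%:E.
Proof. by rewrite -iu; apply: eq_integral => x _; rewrite ger0_norm// indic_ge0. Qed.

Let mrho := mollifier_measurable rhoG.
Let rho0 := mollifier_ge0 rhoG.
Let rhoi := integrable_mollifier rhoG.

Definition smoothing_grad (x : V) : V :=
  \row_i convolution (fun y => G y ord0 i) (\1_A : V -> R) x.
Let us := convolution rho u.
Let g := smoothing_grad.

Lemma integrable_smoothing : mu.-integrable setT (EFin \o us).
Proof. exact: integrable_conv rhoi ui u1. Qed.

Lemma measurable_smoothing : measurable_fun setT us.
Proof. exact: measurable_conv rhoi ui. Qed.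

Lemma integrable_smoothing_grad i : mu.-integrable setT (fun x => (g x ord0 i)%:E).
Proof.
have := integrable_conv (mollifier_gradient rhoG i) ui u1.
by apply: eq_integrable => // x _; rewrite /= /g mxE.
Qed.

Lemma measurable_smoothing_grad : measurable_fun setT g.
Proof.
apply: measurable_fun_rVP => i; apply/measurable_EFinP.
exact: measurable_int (integrable_smoothing_grad i).
Qed.

Lemma conv_L1_le (k w : V -> R) M : mu.-integrable setT (EFin \o k) ->
  mu.-integrable setT (EFin \o w) -> (forall x, `|w x| <= M) ->
  (\int[mu]_x `|convolution k w x|%:E <=
   \int[mu]_x `|k x|%:E * \int[mu]_x `|w x|%:E)%E.
Proof.
move=> ki wi wM; rewrite -(integral_conv_abs ki wi).
apply: ge0_le_integralW => x _ //.
exact: EFin_normr_RintegralW (integrable_conv_integrand ki wi wM x).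
Qed.

Lemma dotv_smoothing_grad x h :
  dotv (g x) h = convolution (fun y => dotv (G y) h) u x.
Proof.
have Gi i : mu.-integrable setT (fun y => (h ord0 i * (G (x - y) ord0 i * u y))%:E).
  exact: (integrableZl measurableT (h ord0 i)
    (integrable_conv_integrand (mollifier_gradient rhoG i) ui u1 x)).
transitivity (\int[mu]_y (\sum_(i < n) h ord0 i * (G (x - y) ord0 i * u y))); last first.
  apply: eq_Rintegral => y _; rewrite /dotv mulr_suml; apply: eq_bigr => i _.
  by rewrite mulrCA mulrA.
rewrite (Rintegral_sum Gi); apply: eq_bigr => i _.
rewrite (RintegralZl _ measurableT (integrable_conv_integrand (mollifier_gradient rhoG i) ui u1 x)).
by rewrite mxE mulrC.
Qed.

(** The remainder of the convolution is the convolution of the remainder, and [conv_L1_le], Young's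
    inequality in L^1, bounds it. *)
Lemma smoothing_taylor h :
  (\int[mu]_x `|us (x + h)%R - us x - dotv (g x) h|%:E <= (C * dotv h h * m)%:E)%E.
Proof.
have E x : us (x + h) - us x - dotv (g x) h = convolution (taylor_remainder rho G h) u x.
  have i1 : mu.-integrable setT (fun y => (rho (x + h - y) * u y)%:E).
    exact: integrable_conv_integrand rhoi ui u1 (x + h).
  have i2 : mu.-integrable setT (fun y => (rho (x - y) * u y)%:E).
    exact: integrable_conv_integrand rhoi ui u1 x.
  have i3 := integrable_conv_integrand (integrable_dotv_gradient rhoG h) ui u1 x.
  have i12 := integrableB measurableT i1 i2.
  rewrite dotv_smoothing_grad /us /convolution -(RintegralB measurableT i1 i2).
  rewrite -(RintegralB measurableT _ i3); last first.
    by move: i12; apply: eq_integrable => // y _; rewrite /= -EFinB.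
  apply: eq_Rintegral => y _; rewrite /taylor_remainder -!mulrBl.
  by rewrite (_ : x - y + h = x + h - y)// addrAC.
under eq_integral do rewrite E.
apply: le_trans (conv_L1_le (integrable_taylor_remainder rhoG h) ui u1) _.
rewrite inu [leRHS]EFinM lee_wpmul2r ?lee_fin ?fine_ge0//.
exact: mollifier_taylor rhoG h.
Qed.

Lemma L1diff_smoothing h : (L1diff us h <= L1diff u h)%E.
Proof.
have ush := integrable_shift h ui.
have di : mu.-integrable setT (EFin \o (fun y => u (y + h) - u y)).
  exact: (integrableB measurableT ush ui).
have d2 x : `|u (x + h) - u x| <= 2.
  by rewrite (le_trans (ler_normB _ _))//; have := u1 x; have := u1 (x + h); lra.
have E x : us (x + h) - us x = convolution rho (fun y => u (y + h) - u y) x.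
  have i1 := integrable_conv_integrand rhoi ush (fun y => u1 (y + h)) x.
  have i2 := integrable_conv_integrand rhoi ui u1 x.
  rewrite /us /convolution -(Rintegral_shift h (f := fun y => rho (x + h - y) * u y)); last by mfun.
  have -> : \int[mu]_y (rho (x + h - (y + h)) * u (y + h)) = \int[mu]_y (rho (x - y) * u (y + h)).
    by apply: eq_Rintegral => y _; rewrite opprD addrACA subrr addr0.
  rewrite -(RintegralB measurableT i1 i2).
  by apply: eq_Rintegral => y _; rewrite mulrBr.
rewrite /L1diff; under eq_integral do rewrite E.
apply: le_trans (conv_L1_le rhoi di d2) _.
rewrite (_ : (\int[mu]_x `|rho x|%:E = 1)%E) ?mul1e//.
by rewrite -(mollifier_integral rhoG); apply: eq_integral => x _; rewrite ger0_norm.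
Qed.

(** [us x - u x] is the mean of [u (x - y) - u x] for the density [rho], and only |y| <= delta
    contributes. *)
Lemma smoothing_dist (eta : R) :
  (forall h, enorm h <= delta -> (L1diff u h <= eta%:E)%E) ->
  (\int[mu]_x `|us x - u x|%:E <= eta%:E)%E.
Proof.
move=> H.
have ri x : mu.-integrable setT (fun y => (rho y * u (x - y))%:E).
  have mux : measurable_fun setT (fun y : V => u (x - y)) by mfun.
  have := integrable_mul_bounded mux (fun y => u1 (x - y)) rhoi.
  by apply: eq_integrable => // y _; rewrite mulrC.
have ci x : mu.-integrable setT (fun y => (rho y * u x)%:E).
  have := integrableZl measurableT (u x) rhoi.
  by apply: eq_integrable => // y _; rewrite /= mulrC EFinM.
have E x : us x - u x = \int[mu]_y (rho y * (u (x - y) - u x)).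
  rewrite /us /convolution -(Rintegral_reflect x (f := fun y => rho (x - y) * u y)); last by mfun.
  have -> : \int[mu]_y (rho (x - (x - y)) * u (x - y)) = \int[mu]_y (rho y * u (x - y)).
    by apply: eq_Rintegral => y _; rewrite subKr.
  have uE : u x = \int[mu]_y (rho y * u x).
    under eq_Rintegral do rewrite mulrC.
    rewrite (RintegralZl _ measurableT rhoi).
    by rewrite (_ : \int[mu]_x0 rho x0 = 1) ?mulr1// /Rintegral (mollifier_integral rhoG).
  rewrite [X in _ - X = _]uE -(RintegralB measurableT (ri x) (ci x)).
  by apply: eq_Rintegral => y _; rewrite mulrBr.
have bi x : mu.-integrable setT (fun y => (rho y * (u (x - y) - u x))%:E).
  have := integrableB measurableT (ri x) (ci x).
  by apply: eq_integrable => // y _; rewrite /= -EFinB mulrBr.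
pose h (p : V * V) : \bar R := (rho p.2 * `|u (p.1 - p.2) - u p.1|)%:E.
have mh : measurable_fun setT h by rewrite /h; mfun.
have h0 p : (0 <= h p)%E by rewrite lee_fin mulr_ge0.
apply: (@le_trans _ _ (\int[mu]_x \int[mu]_y h (x, y))%E).
  apply: ge0_le_integralW => x _ //.
  rewrite E; apply: le_trans (EFin_normr_RintegralW (bi x)) _.
  by apply: ge0_le_integralW => y _ //; rewrite /h lee_fin normrM ger0_norm.
rewrite (@fubini_tonelli _ _ V V R mu mu h mh h0).
apply: (@le_trans _ _ (\int[mu]_y (eta%:E * (rho y)%:E))%E).
  apply: ge0_le_integralW => y _; first exact: integral_ge0.
  have mL : measurable_fun setT (fun x : V => (`|u (x - y) - u x|)%:E) by mfun.
  rewrite /h; under eq_integral do rewrite /= EFinM.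
  rewrite ge0_integralZl//; last by rewrite lee_fin.
  have [yd|yd] := leP (enorm y) delta; last by rewrite (mollifier_support rhoG yd) mul0e mule0.
  by rewrite muleC lee_wpmul2r ?lee_fin//; apply: H; rewrite enormN.
(* Take [h = 0] in the hypothesis. A negative [delta] is impossible: [rho] would vanish everywhere
   and could not have integral 1. *)
have eta0 : (0 <= eta%:E)%E.
  have [d0|d0] := leP 0 delta.
    by apply: le_trans (H 0 _); rewrite ?enorm0// L1diff_ge0.
  have := mollifier_integral rhoG; rewrite integral0_eq.
    by move=> /eqP; rewrite eqe eq_sym oner_eq0.
  by move=> x _; rewrite (mollifier_support rhoG)// (lt_le_trans d0)// enorm_ge0.
rewrite ge0_integralZl//; first last.
- by move=> y _; rewrite lee_fin rho0.
- by mfun.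
by rewrite (mollifier_integral rhoG) mule1.
Qed.

Let mus := measurable_smoothing.
Let mg := measurable_smoothing_grad.

Definition directional_tv (h : V) : \bar R := (\int[mu]_x `|dotv (g x) h|%:E)%E.

Lemma directional_tv_ge0 h : (0 <= directional_tv h)%E.
Proof. exact: integral_ge0. Qed.

Lemma measurable_directional_tv : measurable_fun setT directional_tv.
Proof.
pose h (p : V * V) : \bar R := `|dotv (g p.2) p.1|%:E.
have mh : measurable_fun setT h by rewrite /h; mfun.
by apply: (measurable_ge0_integral1 mu mh) => p; rewrite lee_fin.
Qed.

Let L1diff_le_grad0 h :
  (L1diff us h <= directional_tv h + (C * dotv h h * m)%:E)%E.
Proof.
apply: le_trans (leeD2l _ (smoothing_taylor h)).
rewrite -ge0_integralD//; [|by mfun|by mfun].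
apply: ge0_le_integralW => x _; rewrite -?EFinD lee_fin//.
by rewrite (le_trans _ (ler_normD _ _))// addrCA subrr addr0.
Qed.

Lemma grad_le_L1diff h :
  (directional_tv h <= L1diff u h + (C * dotv h h * m)%:E)%E.
Proof.
apply: le_trans (leeD (L1diff_smoothing h) (smoothing_taylor h)).
rewrite -ge0_integralD//; [|by mfun|by mfun].
apply: ge0_le_integralW => x _; rewrite -?EFinD lee_fin//.
rewrite -[X in _ <= _ + X]normrN.
by rewrite (le_trans _ (ler_normD _ _))// opprB addrCA subrr addr0.
Qed.

(* Subadditivity of [h |-> L1diff us h] removes the quadratic error. *)
Lemma L1diff_le_grad h : (L1diff us h <= directional_tv h)%E.
Proof.
apply/lee_addgt0Pr => e e0.
pose K := C * dotv h h * m.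
pose k := (Num.truncn (K / e)).+1.
have k0 : 0 < k%:R :> R by [].
have hk : h = k%:R *: (k%:R^-1 *: h) by rewrite scalerA divff ?scale1r// gt_eqF.
rewrite {1}hk; apply: le_trans (L1diffMn mus _ _) _.
apply: le_trans (lee_wpmul2l _ (L1diff_le_grad0 _)) _; first by rewrite lee_fin ltW.
rewrite ge0_muleDr ?directional_tv_ge0//; last first.
  apply: le_trans (smoothing_taylor (k%:R^-1 *: h)); exact: integral_ge0.
apply: leeD.
  rewrite /directional_tv -ge0_integralZl//; [|by mfun].
  apply: ge0_le_integralW => x _; rewrite -EFinM lee_fin.
    by rewrite mulr_ge0// ltW.
  by rewrite dotvZr normrM ger0_norm ?invr_ge0 ?(ltW k0)// mulrA divff ?mul1r// gt_eqF.
rewrite -EFinM lee_fin dotvZl dotvZr.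
have aux (j c d p : R) : j != 0 -> j * (c * (j^-1 * (j^-1 * d)) * p) = c * d * p / j.
  by move=> j0; field.
rewrite aux ?gt_eqF// -/K.
rewrite ler_pdivrMr// mulrC -ler_pdivrMr//.
exact: ltW (truncnS_gt _).
Qed.

Definition smoothing_tv : \bar R := (\int[mu]_x (enorm (g x))%:E)%E.

Lemma smoothing_tv_ge0 : (0 <= smoothing_tv)%E.
Proof. by apply: integral_ge0 => x _; rewrite lee_fin enorm_ge0. Qed.

Let gauss_grad t : 0 <= t ->
  (\int[mu]_z (directional_tv (t *: z)%R * (gauss z)%:E) =
   (t * gauss1_absmoment)%:E * smoothing_tv)%E.
Proof.
move=> t0; have mga := @measurable_gauss R n.
pose h (p : V * V) : \bar R := (`|dotv (g p.2) (t *: p.1)| * gauss p.1)%:E.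
have mh : measurable_fun setT h by rewrite /h; mfun.
have h0 p : (0 <= h p)%E by rewrite lee_fin mulr_ge0 ?gauss_ge0.
transitivity (\int[mu]_z \int[mu]_x h (z, x))%E.
  apply: eq_integral => z _; rewrite /h; under [RHS]eq_integral do rewrite /= EFinM.
  by rewrite ge0_integralZr//; [mfun|rewrite lee_fin gauss_ge0].
rewrite (@fubini_tonelli _ _ V V R mu mu h mh h0).
rewrite /smoothing_tv -ge0_integralZl//; first last.
- by rewrite lee_fin mulr_ge0 ?gauss1_absmoment_ge0.
- by move=> x _; rewrite lee_fin enorm_ge0.
- by mfun.
apply: eq_integral => x _; rewrite /h/=.
transitivity (t%:E * \int[mu]_z (`|dotv z (g x)| * gauss z)%:E)%E.
  rewrite -ge0_integralZl//; first last.
  - by move=> z _; rewrite lee_fin mulr_ge0 ?gauss_ge0.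
  - by mfun.
  by apply: eq_integral => z _; rewrite -EFinM dotvZr normrM (ger0_norm t0) -mulrA dotvC.
by rewrite integral_gauss_abs_dotv -!EFinM mulrA.
Qed.

(** The error is free of [C], so at a fixed [t] the mollifier can be refined until [eta] is
    negligible; this gives the upper bound at every [t]. *)
Lemma gauss_L1diff_le_smoothing_tv t eta : 0 <= t ->
  (forall h, enorm h <= delta -> (L1diff u h <= eta%:E)%E) ->
  (gauss_L1diff u t <= (t * gauss1_absmoment)%:E * smoothing_tv + (2 * eta)%:E)%E.
Proof.
move=> t0 H; have mga := @measurable_gauss R n.
have mD := measurable_directional_tv; have D0 := directional_tv_ge0.
have eta0 : (0 <= (2 * eta)%:E)%E.
  rewrite lee_fin mulr_ge0// -lee_fin; apply: le_trans (smoothing_dist H).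
  exact: integral_ge0.
rewrite -(gauss_grad t0) -[X in (_ <= _ + X)%E]mule1 -(integral_gauss n).
rewrite -ge0_integralZl//; first last.
- by move=> x _; rewrite lee_fin gauss_ge0.
- by mfun.
rewrite -ge0_integralD//; first last.
- by mfun.
- by move=> x _; rewrite mule_ge0// lee_fin gauss_ge0.
- by mfun.
- by move=> x _; rewrite mule_ge0// lee_fin gauss_ge0.
apply: ge0_le_integralW => z _; first by rewrite mule_ge0 ?L1diff_ge0// lee_fin gauss_ge0.
rewrite -ge0_muleDl// lee_wpmul2r ?lee_fin ?gauss_ge0//.
apply: le_trans (L1diff_dist mu' _ mus) _.
apply: leeD; first exact: L1diff_le_grad.
rewrite EFinM lee_wpmul2l//.
apply: smoothing_dist H.
Qed.

(** Here the error contains [C], but it is quadratic in [t], hence o(t) for a mollifier fixed in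
    advance. *)
Lemma smoothing_tv_le_gauss_L1diff t : 0 <= t ->
  ((t * gauss1_absmoment)%:E * smoothing_tv <= gauss_L1diff u t +
   (C * m * t ^+ 2)%:E * \int[mu]_z (dotv z z * gauss z)%:E)%E.
Proof.
move=> t0; have mga := @measurable_gauss R n.
have mD := measurable_L1diff mu'.
have C0 : 0 <= C * m * t ^+ 2.
  by rewrite mulr_ge0 ?sqr_ge0// mulr_ge0 ?(mollifier_const_ge0 rhoG)// fine_ge0.
have mD' := measurable_directional_tv; have D0 := directional_tv_ge0.
rewrite -(gauss_grad t0).
rewrite -ge0_integralZl//; first last.
- by move=> z _; rewrite lee_fin mulr_ge0 ?dotv_ge0// gauss_ge0.
- by mfun.
rewrite -ge0_integralD//; first last.
- by mfun.
- by move=> z _; rewrite -EFinM lee_fin mulr_ge0// mulr_ge0 ?dotv_ge0// gauss_ge0.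
- by mfun.
- by move=> z _; rewrite mule_ge0 ?L1diff_ge0// lee_fin gauss_ge0.
apply: ge0_le_integralW => z _; first by rewrite mule_ge0// lee_fin gauss_ge0.
rewrite [(dotv z z * gauss z)%:E]EFinM muleA -ge0_muleDl ?L1diff_ge0//; last first.
  by rewrite -EFinM lee_fin mulr_ge0// dotv_ge0.
rewrite lee_wpmul2r ?lee_fin ?gauss_ge0//.
apply: le_trans (grad_le_L1diff _) _.
rewrite leeD2l// -EFinM lee_fin dotvZl dotvZr le_eqVlt; apply/orP; left; apply/eqP.
have aux (c d p : R) : c * (t * (t * d)) * p = c * p * t ^+ 2 * d by ring.
exact: aux.
Qed.

End smoothing.

(** * Differentiability from Taylor bounds *)

Section normed_modules.
Context {R : realType} {U W : normedModType R}.

Lemma differentiable_eps (f : U -> W) (df : {linear U -> W}) x : continuous df ->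
  (forall e : R, 0 < e -> exists2 d : R, 0 < d &
    forall h : U, `|h| <= d -> `|f (x + h) - f x - df h| <= e * `|h|) ->
  differentiable f x /\ 'd f x = df :> (U -> W).
Proof.
move=> cdf H.
have dfx : f \o shift x = cst (f x) + df +o_ 0 id.
  apply/eqaddoP => e e0; have [d d0 Hd] := H e e0.
  near=> h.
  have -> : ((f \o shift x) - (cst (f x) + df)) h = f (x + h) - f x - df h.
    change (f (h + x) - (f x + df h) = f (x + h) - f x - df h).
    by rewrite (addrC h) opprD addrA.
  apply: Hd; near: h; apply/nbhs_ballP; exists d => // y.
  by rewrite -ball_normE/= sub0r normrN => /ltW.
have dE : 'd f x = df :> (U -> W) := diff_unique cdf dfx.
by split=> //; apply/diff_locallyP; rewrite dE.
Unshelve. all: by end_near. Qed.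

Lemma continuous_eps (F : U -> W) x :
  (forall e : R, 0 < e -> exists2 d : R, 0 < d &
    forall h : U, `|h| <= d -> `|F (x + h) - F x| <= e) -> {for x, continuous F}.
Proof.
move=> H; apply/cvgrPdist_le => e /H[d d0 Hd].
near=> y; rewrite distrC (_ : y = x + (y - x)); last by rewrite addrC subrK.
apply: Hd; near: y; apply/nbhs_ballP; exists d => // y.
by rewrite -ball_normE/= distrC => /ltW.
Unshelve. all: by end_near. Qed.

End normed_modules.

Section norms.
Context {R : realType} {n : nat}.
Notation V := 'rV[R]_n.

Lemma normr_le_enorm (x : V) : `|x| <= enorm x.
Proof.
rewrite /Num.Def.normr/= mx_normrE; apply: bigmax_le; first exact: enorm_ge0.
by move=> [i j] _ /=; rewrite (ord1 i) normr_coord_le_enorm.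
Qed.

Lemma normr_coord_le (x : V) i : `|x ord0 i| <= `|x|.
Proof.
by rewrite [leRHS]/Num.Def.normr/= mx_normrE; exact: (le_bigmax _ (fun ij : 'I_1 * 'I_n => `|x ij.1 ij.2|) (ord0, i)).
Qed.

Lemma enorm_le_dual (z : V) B : 0 <= B ->
  (forall w, dotv z w <= B * enorm w) -> enorm z <= B.
Proof.
move=> B0 /(_ z); rewrite -enorm_sqr expr2.
have := enorm_ge0 z; rewrite le_eqVlt => /predU1P[<-//|z0].
by rewrite ler_pM2r.
Qed.

Lemma enorm_le_sum (z : V) : enorm z <= \sum_(i < n) `|z ord0 i|.
Proof.
apply: enorm_le_dual => [|w]; first exact: sumr_ge0.
rewrite mulr_suml; apply: ler_sum => i _; apply: le_trans (ler_norm _) _.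
by rewrite normrM ler_wpM2l// normr_coord_le_enorm.
Qed.

Lemma enorm_le_norm (x : V) : enorm x <= n%:R * `|x|.
Proof.
apply: le_trans (enorm_le_sum x) _.
rewrite mulr_natl -[X in _ *+ X]card_ord -sumr_const; apply: ler_sum => i _.
exact: normr_coord_le.
Qed.

Lemma continuous_mulmxr (J : 'M[R]_n) : continuous (mulmxr J : V -> V).
Proof.
apply: bounded_linear_continuous; apply/linear_boundedP.
pose B := n%:R * \sum_(j < n) enorm (col j J)^T.
exists B; split; first exact: num_real.
move=> M BM x; apply: (@le_trans _ _ (B * `|x|)); last by rewrite ler_wpM2r// ltW.
apply: le_trans (normr_le_enorm _) _; apply: le_trans (enorm_le_sum _) _.
rewrite /B mulrC mulrA mulr_sumr; apply: ler_sum => j _.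
rewrite (_ : (mulmxr J x) ord0 j = dotv x (col j J)^T); last first.
  by rewrite /mulmxr mxE; apply: eq_bigr => i _; rewrite !mxE.
apply: le_trans (cauchy_schwarz _ _) _.
by rewrite ler_wpM2r ?enorm_ge0// mulrC enorm_le_norm.
Qed.

Lemma taylor_differentiable (f : V -> V) (J : 'M[R]_n) x K : 0 <= K ->
  (forall h, enorm (f (x + h) - f x - h *m J) <= K * dotv h h) ->
  differentiable f x /\ forall v, 'D_v f x = v *m J.
Proof.
move=> K0 H.
have [df dE] : differentiable f x /\ 'd f x = (mulmxr J : V -> V) :> (V -> V).
  apply: differentiable_eps; first exact: continuous_mulmxr.
  (* The factor [n] compares the Euclidean norm with the sup norm, to which differentiability
     refers; adding 1 makes [c] positive. *)
  move=> e e0; pose c := K * n%:R ^+ 2 + 1.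
  have c0 : 0 < c by rewrite ltr_wpDl// mulr_ge0 ?sqr_ge0.
  exists (e / c); first by rewrite divr_gt0.
  move=> h hc; apply: le_trans (normr_le_enorm _) _; apply: le_trans (H h) _.
  apply: (@le_trans _ _ (K * (n%:R * `|h|) ^+ 2)).
    by rewrite ler_wpM2l// -enorm_sqr ler_sqr ?nnegrE ?mulr_ge0 ?enorm_ge0 ?enorm_le_norm.
  rewrite exprMn mulrA expr2 mulrA ler_wpM2r//.
  rewrite ler_pdivlMr// in hc; apply: le_trans hc.
  by rewrite mulrC ler_wpM2l// /c lerDl.
by split=> // v; rewrite deriveE// dE.
Qed.

(** A Taylor bound uniform in the base point makes [J] Lipschitz. With t = |h|, the increment of f
    from x to x + h + t v is expanded directly and through x + h; comparison leaves t (v J(x + h) -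
    v J(x)) and three remainders of order t^2. *)
Lemma taylor_C1 (f : V -> V) (J : V -> 'M[R]_n) K : 0 <= K ->
  (forall x h, enorm (f (x + h) - f x - h *m J x) <= K * dotv h h) ->
  forall v, continuous ('D_v f).
Proof.
move=> K0 H v x.
have DE y : 'D_v f y = v *m J y by have [_ ->] := taylor_differentiable K0 (H y).
have lip h : enorm (v *m J (x + h) - v *m J x) <=
    K * (enorm v ^+ 2 + (1 + enorm v) ^+ 2 + 1) * enorm h.
  set c := K * _.
  have c0 : 0 <= c by rewrite mulr_ge0// !addr_ge0// sqr_ge0.
  have [h0|h0] := eqVneq h 0; first by rewrite h0 addr0 subrr !enorm0 mulr0.
  pose t := enorm h.
  have t0 : 0 < t.
    by rewrite lt_neqAle enorm_ge0 andbT eq_sym; apply: contra_neq h0 => /enorm_eq0.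
  have h1 := H (x + h) (t *: v); have h2 := H x (h + t *: v); have h3 := H x h.
  rewrite -(ler_pM2l t0) -[X in X * enorm _](gtr0_norm t0) -enormZ.
  rewrite (_ : t *: _ = (f (x + (h + t *: v)) - f x - (h + t *: v) *m J x)
     - (f (x + h + t *: v) - f (x + h) - (t *: v) *m J (x + h))
     - (f (x + h) - f x - h *m J x)); last first.
    rewrite mulmxDl scalerBr !scalemxAl (addrA x).
    set a := f _; set b := f _; set d := f _.
    set p := _ *m J (x + h); set q := _ *m J x; set r := _ *m J x.
    apply/matrixP => i j; rewrite !mxE; ring.
  apply: le_trans (enormD _ _) _; rewrite enormN.
  apply: le_trans (lerD (enormD _ _) (lexx _)) _; rewrite enormN.
  apply: le_trans (lerD (lerD h2 h1) h3) _.
  have hv : dotv (h + t *: v) (h + t *: v) <= (t * (1 + enorm v)) ^+ 2.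
    rewrite -enorm_sqr ler_sqr ?nnegrE ?enorm_ge0 ?mulr_ge0 ?addr_ge0 ?enorm_ge0//.
    by apply: le_trans (enormD _ _) _; rewrite enormZ gtr0_norm// mulrDr mulr1.
  have := ler_wpM2l K0 hv.
  rewrite dotvZl dotvZr -(enorm_sqr v) -(enorm_sqr h) /c -/t.
  move: (dotv _ _) (enorm v) => Q nv; lra.
apply: continuous_eps => e e0.
set c := K * (enorm v ^+ 2 + (1 + enorm v) ^+ 2 + 1) in lip.
have c0 : 0 <= c by rewrite mulr_ge0// !addr_ge0// sqr_ge0.
have d0 : 0 < c * n%:R + 1 by rewrite ltr_wpDl// mulr_ge0.
exists (e / (c * n%:R + 1)); first by rewrite divr_gt0.
move=> h hd; rewrite !DE.
apply: le_trans (normr_le_enorm _) _; apply: le_trans (lip _) _.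
rewrite ler_pdivlMr// in hd; apply: le_trans hd.
apply: le_trans (ler_wpM2l c0 (enorm_le_norm h)) _.
by rewrite mulrDr mulr1 mulrA mulrC lerDl.
Qed.

Lemma compact_support_ball (f : V -> V) M :
  (forall x, M < enorm x -> f x = 0) -> compact (closure [set x | f x != 0]).
Proof.
move=> fM; apply: bounded_closed_compact; last exact: closed_closure.
exists M; split; first exact: num_real.
move=> N MN x cx.
have : closure [set x : V | `|x| <= N] x.
  apply: closureS cx => y /= fy.
  apply: le_trans (normr_le_enorm y) _; rewrite leNgt; apply: contra fy => yM.
  by rewrite fM// (lt_trans MN).
have cl : closed [set x : V | `|x| <= N].
  apply: (@preimage_closed _ _ (fun x : V => `|x|) [set t : R | t <= N]).
    by move=> y _; exact: norm_continuous.
  exact: closed_le.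
by move/closure_id : cl => <-.
Qed.

End norms.

(** * Test fields for the perimeter *)

Section correlation.
Context {R : realType} {n : nat}.
Notation V := 'rV[R]_n.
Notation mu := (@lebesgue_rV R n).

(** The adjoint of convolution with [k], in the sense of [Rintegral_conv]. *)
Definition correlation (a k : V -> R) (y : V) : R := \int[mu]_x (a x * k (x - y)).

Variables (a : V -> R) (B : R).
Hypothesis ma : measurable_fun setT a.
Hypothesis aB : forall x, `|a x| <= B.

Lemma integrable_correlation_integrand (k : V -> R) y :
  mu.-integrable setT (EFin \o k) -> mu.-integrable setT (fun x => (a x * k (x - y))%:E).
Proof. by move=> ki; exact: integrable_mul_bounded ma aB (integrable_shift (- y) ki). Qed.

Lemma normr_correlation_le (k : V -> R) y : mu.-integrable setT (EFin \o k) ->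
  (`|correlation a k y|%:E <= B%:E * \int[mu]_x `|k x|%:E)%E.
Proof.
move=> ki; have mk : measurable_fun setT k by exact/measurable_EFinP/measurable_int/ki.
apply: le_trans (EFin_normr_RintegralW (integrable_correlation_integrand y ki)) _.
have B0 : 0 <= B := le_trans (normr_ge0 _) (aB 0).
rewrite -(integral_shift (f := fun x => `|k x|%:E) (- y)); last by mfun.
rewrite -ge0_integralZl//; [|by mfun].
by apply: ge0_le_integralW => x _ //; rewrite -EFinM lee_fin normrM ler_wpM2r.
Qed.

Lemma measurable_correlation (k : V -> R) : measurable_fun setT k ->
  measurable_fun setT (correlation a k).
Proof.
move=> mk; pose h (p : V * V) := a p.2 * k (p.2 - p.1).
have mh : measurable_fun setT h by rewrite /h; mfun.
exact: (measurable_Rintegral1 mu mh).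
Qed.

End correlation.

Section test_field.
Context {R : realType} {n : nat}.
Notation V := 'rV[R]_n.
Notation mu := (@lebesgue_rV R n).
Variables (delta : R) (rho : V -> R) (G : V -> V) (C : R).
Hypothesis rhoG : mollifier delta rho G C.
Variables (psi : V -> V) (M : R).
Hypothesis mpsi : measurable_fun setT psi.
Hypothesis psi1 : forall x, enorm (psi x) <= 1.
Hypothesis psiM : forall x, M < enorm x -> psi x = 0.

Let mrho := mollifier_measurable rhoG.
Let rho0 := mollifier_ge0 rhoG.
Let rhoi := integrable_mollifier rhoG.
Let Gi i : mu.-integrable setT (EFin \o (fun x => G x ord0 i)).
Proof. exact: mollifier_gradient rhoG i. Qed.

Let mpsii i : measurable_fun setT (fun x => psi x ord0 i).
Proof. exact: measurable_fun_coord. Qed.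
Let psii1 i x : `|psi x ord0 i| <= 1.
Proof. exact: le_trans (normr_coord_le_enorm _ _) (psi1 x). Qed.

(* The sign makes the divergence of [test_field] the correlation of [psi] with [G],
   because the gradient of [y |-> rho (x - y)] is [- G (x - y)]. *)
Definition test_field (y : V) : V :=
  \row_i - correlation (fun x => psi x ord0 i) rho y.

Definition test_jacobian (y : V) : 'M[R]_n :=
  \matrix_(i, j) correlation (fun x => psi x ord0 j) (fun x => G x ord0 i) y.

Let mdot w : measurable_fun setT (fun x => dotv (psi x) w).
Proof. by mfun. Qed.
Let dotB w x : `|dotv (psi x) w| <= enorm w.
Proof.
apply: le_trans (cauchy_schwarz _ _) _.
by rewrite ler_piMl ?enorm_ge0.
Qed.

Let dotv_field y w : dotv (test_field y) w = - correlation (fun x => dotv (psi x) w) rho y.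
Proof.
have ii i : mu.-integrable setT (fun x => (w ord0 i * (psi x ord0 i * rho (x - y)))%:E).
  exact: (integrableZl measurableT (w ord0 i)
    (integrable_correlation_integrand (mpsii i) (psii1 i) y rhoi)).
transitivity (- \int[mu]_x (\sum_(i < n) w ord0 i * (psi x ord0 i * rho (x - y)))); last first.
  congr (- _); apply: eq_Rintegral => x _; rewrite /dotv mulr_suml; apply: eq_bigr => i _.
  by rewrite mulrCA mulrA.
rewrite (Rintegral_sum ii) -sumrN; apply: eq_bigr => i _.
rewrite (RintegralZl _ measurableT (integrable_correlation_integrand (mpsii i) (psii1 i) y rhoi)).
by rewrite mxE mulNr mulrC.
Qed.

Let Ghi := integrable_dotv_gradient rhoG.

Let dotv_jacobian y h w : dotv (h *m test_jacobian y) w =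
  correlation (fun x => dotv (psi x) w) (fun x => dotv (G x) h) y.
Proof.
have i0 i j := integrable_correlation_integrand (mpsii j) (psii1 j) y (Gi i).
have i1 j i : mu.-integrable setT (EFin \o (fun x => w ord0 j * h ord0 i * (psi x ord0 j * G (x - y) ord0 i))).
  exact: (integrableZl measurableT (w ord0 j * h ord0 i) (i0 i j)).
have i2 j := integrable_Rsum (i1 j).
transitivity (\int[mu]_x (\sum_(j < n) \sum_(i < n) w ord0 j * h ord0 i * (psi x ord0 j * G (x - y) ord0 i))); last first.
  apply: eq_Rintegral => x _; rewrite /dotv mulr_suml; apply: eq_bigr => j _.
  rewrite mulr_sumr; apply: eq_bigr => i _; ring.
rewrite (Rintegral_sum i2); apply: eq_bigr => j _.
rewrite (Rintegral_sum (i1 j)) mxE mulr_suml; apply: eq_bigr => i _.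
by rewrite (RintegralZl _ measurableT (i0 i j)) mxE mulrC mulrA.
Qed.

Let C0 := mollifier_const_ge0 rhoG.

(** Paired with a fixed [w], the field is a scalar correlation. Moving [y] by [h] moves the argument
    of [rho] by [- h], so the remainder is the correlation with [taylor_remainder] at [- h]. *)
Lemma test_field_taylor y h :
  enorm (test_field (y + h) - test_field y - h *m test_jacobian y) <= C * dotv h h.
Proof.
have Ch : 0 <= C * dotv h h by rewrite mulr_ge0// dotv_ge0.
apply: enorm_le_dual => // w.
rewrite !(dotvDl, dotvNl) !dotv_field dotv_jacobian opprK.
set a := fun x => dotv (psi x) w.
have ma : measurable_fun setT a := mdot w.
have i1 := integrable_correlation_integrand ma (dotB w) (y + h) rhoi.
have i2 := integrable_correlation_integrand ma (dotB w) y rhoi.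
have i3 := integrable_correlation_integrand ma (dotB w) y (Ghi h).
have -> : - correlation a rho (y + h) + correlation a rho y - correlation a (fun x => dotv (G x) h) y
    = - correlation a (taylor_remainder rho G (- h)) y.
  rewrite -[LHS]opprK; congr (- _); rewrite !opprD !opprK.
  have i12 : mu.-integrable setT (fun x => (a x * rho (x - (y + h)) - a x * rho (x - y))%:E).
    exact: (integrableB measurableT i1 i2).
  rewrite /correlation -(RintegralB measurableT i1 i2) -(RintegralD measurableT i12 i3).
  apply: eq_Rintegral => x _; rewrite /taylor_remainder dotvNr opprD addrA; ring.
apply: le_trans (ler_norm _) _; rewrite normrN -lee_fin.
apply: le_trans (normr_correlation_le ma (dotB w) y (integrable_taylor_remainder rhoG (- h))) _.
rewrite mulrC EFinM lee_wpmul2l ?lee_fin ?enorm_ge0//.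
have := mollifier_taylor rhoG (- h); rewrite dotvNl dotvNr opprK; exact.
Qed.

(** Pairing with vectors [w] gives the Euclidean bound 1, whereas bounds on the coordinates would
    lose a dimensional factor. *)
Lemma test_field_le1 y : enorm (test_field y) <= 1.
Proof.
apply: enorm_le_dual => // w; rewrite mul1r dotv_field.
apply: le_trans (ler_norm _) _; rewrite normrN -lee_fin.
apply: le_trans (normr_correlation_le (mdot w) (dotB w) y rhoi) _.
have -> : (\int[mu]_x `|rho x|%:E = 1)%E.
  by rewrite -(mollifier_integral rhoG); apply: eq_integral => x _; rewrite ger0_norm.
by rewrite mule1.
Qed.

Lemma C1c_test_field : C1c test_field.
Proof.
split.
- by move=> x; have [] := taylor_differentiable C0 (test_field_taylor x).
- exact: taylor_C1 C0 test_field_taylor.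
- apply: (@compact_support_ball _ _ _ (M + delta)) => y hy.
  apply/rowP => i; rewrite !mxE /correlation.
  rewrite (_ : (fun x => _) = cst 0) ?Rintegral_cst// ?mul0r ?oppr0//.
  apply/funext => x /=; have [xM|xM] := leP (enorm x) M.
    rewrite (mollifier_support rhoG) ?mulr0//.
    have := enormD x (- (x - y)); rewrite subKr enormN; lra.
  by rewrite psiM// mxE mul0r.
Qed.

Lemma divergence_test_field y : divergence test_field y =
  \sum_(i < n) correlation (fun x => psi x ord0 i) (fun x => G x ord0 i) y.
Proof.
rewrite /divergence; apply: eq_bigr => i _.
have [_ ->] := taylor_differentiable C0 (test_field_taylor y).
by rewrite -rowE !mxE.
Qed.

Variables (A : set V).
Hypotheses (mA : measurable A) (Aoo : (mu A < +oo)%E).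

Lemma integral_dotv_smoothing_grad :
  (\int[mu]_x (dotv (psi x) (smoothing_grad A G x))%:E =
   \int[mu]_(x in A) (divergence test_field x)%:E)%E.
Proof.
pose u : V -> R := \1_A.
have ui : mu.-integrable setT (EFin \o u) by exact: integrable_indicR.
have u1 x : `|u x| <= 1 by exact: normr_indic_le1.
have mu' : measurable_fun setT u by exact: measurable_indicR.
pose gi i := convolution (fun y => G y ord0 i) u.
have gii i : mu.-integrable setT (EFin \o (fun x => psi x ord0 i * gi i x)).
  exact: integrable_mul_bounded (mpsii i) (psii1 i) (integrable_conv (Gi i) ui u1).
have mG i : measurable_fun setT (fun x => G x ord0 i) by exact/measurable_EFinP/measurable_int/(Gi i).
pose ci i := correlation (fun x => psi x ord0 i) (fun x => G x ord0 i).
have mc i : measurable_fun setT (ci i) := measurable_correlation (mpsii i) (mG i).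
have cB i : exists B : R, forall x, `|ci i x| <= B.
  have /integrableP[_ /=] := Gi i => ioo.
  exists (fine (1%:E * \int[mu]_x `|G x ord0 i|%:E)%E) => x.
  rewrite -lee_fin fineK; first exact: (normr_correlation_le (mpsii i) (psii1 i) x (Gi i)).
  by rewrite mul1e ge0_fin_numE// integral_ge0.
have cii i : mu.-integrable setT (EFin \o (fun x => u x * ci i x)).
  have [B HB] := cB i; have := integrable_mul_bounded (mc i) HB ui.
  by apply: eq_integrable => // x _; rewrite /= mulrC.
rewrite [RHS]integral_indic_mul.
transitivity (\int[mu]_x (\sum_(i < n) psi x ord0 i * gi i x)%:E)%E.
  apply: eq_integral => x _; congr EFin.
  by apply: eq_bigr => i _; rewrite mxE.
transitivity (\int[mu]_x (\sum_(i < n) u x * ci i x)%:E)%E; last first.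
  by apply: eq_integral => x _; rewrite divergence_test_field mulrC mulr_sumr.
rewrite (EFin_Rintegral (integrable_Rsum gii)) (EFin_Rintegral (integrable_Rsum cii)).
congr EFin; rewrite (Rintegral_sum gii) (Rintegral_sum cii); apply: eq_bigr => i _.
have := Rintegral_conv (Gi i) ui u1 (mpsii i) (psii1 i); rewrite /gi /ci /correlation /=; exact.
Qed.

End test_field.

Section smoothing_tv_perimeter.
Context {R : realType} {n : nat}.
Notation V := 'rV[R]_n.
Notation mu := (@lebesgue_rV R n).
Variables (delta : R) (rho : V -> R) (G : V -> V) (C : R).
Hypothesis rhoG : mollifier delta rho G C.
Variables (A : set V).
Hypotheses (mA : measurable A) (Aoo : (mu A < +oo)%E).

Lemma smoothing_tv_le_perimeter : (smoothing_tv A G <= perimeter A)%E.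
Proof.
pose g := smoothing_grad A G.
have mg : measurable_fun setT g := measurable_smoothing_grad mA Aoo rhoG.
have gi : mu.-integrable setT (EFin \o (fun x => enorm (g x))).
  apply: (@integrable_le _ _ _ _ _ (fun x => \sum_(i < n) `|g x ord0 i|)); [by mfun| |].
    by move=> x; rewrite ger0_norm ?enorm_ge0// enorm_le_sum.
  apply: integrable_Rsum => i.
  exact: integrable_norm (integrable_smoothing_grad mA Aoo rhoG i).
apply/lee_addgt0Pr => e e0.
pose far (M : R) : set V := [set x | M < enorm x].
have mfar M : measurable_fun setT (\1_(far M) : V -> R).
  apply: measurable_indicR.
  have me : measurable_fun setT (fun x : V => enorm x) by mfun.
  have := me measurableT `]M, +oo[%classic (measurable_itv _); rewrite setTI.
  by congr measurable; apply/seteqP; split => x /=; rewrite in_itv/= andbT.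
have [m Hm] : exists m, (\int[mu]_x (\1_(far m%:R) x * enorm (g x))%:E <= e%:E)%E.
  apply: (@small_integral_eventually0 _ _ _ _ _ (fun x => enorm (g x))) => //.
  - by move=> m; have m1 := mfar m%:R; mfun.
  - by move=> m x; rewrite mulr_ge0 ?enorm_ge0// indicE.
  - move=> x; exists (Num.truncn (enorm x)).+1 => m xm; rewrite indicE memNset ?mul0r//.
    rewrite /far/= => /lt_trans/(_ (truncnS_gt (enorm x))); rewrite ltr_nat.
    by rewrite ltnNge xm.
  - by move=> m x; rewrite ler_piMl ?enorm_ge0// indicE; case: (_ \in _).
have m1 := mfar m%:R; have mi : measurable_fun [set: R] (fun x : R => x^-1) by exact: measurable_invR.
(* The direction of [g], cut off at radius [m] to give the test field compact support. Where [g]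
   vanishes so does [psi]. *)
pose psi x : V := ((1 - \1_(far m%:R) x) * (enorm (g x))^-1) *: g x.
have mpsi : measurable_fun setT psi.
  apply: measurable_fun_scalev => //; apply: measurable_funM; first by mfun.
  by apply: (measurableT_comp mi); mfun.
have psi1 x : enorm (psi x) <= 1.
  rewrite /psi enormZ normrM (ger0_norm (_ : 0 <= (enorm (g x))^-1)) ?invr_ge0 ?enorm_ge0//.
  have [->|g0] := eqVneq (enorm (g x)) 0; first by rewrite mulr0.
  by rewrite -mulrA mulVf// mulr1 indicE; case: (_ \in _); rewrite ?subrr ?subr0 ?normr0 ?normr1.
have psiM x : m%:R < enorm x -> psi x = 0.
  by move=> xm; rewrite /psi indicE mem_set// subrr mul0r scale0r.
have psig x : dotv (psi x) (g x) = (1 - \1_(far m%:R) x) * enorm (g x).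
  rewrite /psi dotvZl -enorm_sqr; have [->|g0] := eqVneq (enorm (g x)) 0.
    by rewrite expr0n/= !mulr0.
  by rewrite -mulrA; congr (_ * _); rewrite expr2 mulKf.
have p0 x : 0 <= dotv (psi x) (g x).
  by rewrite psig mulr_ge0 ?enorm_ge0// indicE; case: (_ \in _); rewrite ?subrr ?subr0.
apply: (@le_trans _ _ (\int[mu]_x (dotv (psi x) (g x))%:E + \int[mu]_x (\1_(far m%:R) x * enorm (g x))%:E)%E).
  rewrite -ge0_integralD//; first last.
  - by mfun.
  - by move=> x _; rewrite lee_fin mulr_ge0 ?enorm_ge0// indicE.
  - by mfun.
  - by move=> x _; rewrite lee_fin.
  apply: ge0_le_integralW => x _; first by rewrite lee_fin enorm_ge0.
  by rewrite -EFinD lee_fin psig -mulrDl subrK mul1r.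
apply: leeD => //.
rewrite (integral_dotv_smoothing_grad rhoG mpsi psi1 mA Aoo).
apply: ereal_sup_ubound; exists (test_field rho psi) => //; split.
  have := C1c_test_field rhoG mpsi psi1 psiM; exact.
by move=> y; exact: (test_field_le1 rhoG mpsi psi1 y).
Qed.

End smoothing_tv_perimeter.

(** * Integration by parts against a mollified indicator function *)

Section continuous_measurable.
Context {R : realType}.

Lemma measurable_fun_countable_comp d (T : measurableType d) (C : countType)
    (g : T -> C) (F : C -> R) :
  (forall c, measurable (g @^-1` [set c])) -> measurable_fun setT (F \o g).
Proof.
move=> mg _ B _; rewrite setTI.
rewrite (_ : _ @^-1` _ = \bigcup_k (match unpickle k with
  | Some c => if pselect (B (F c)) then g @^-1` [set c] else set0
  | None => set0 end)).
  apply: bigcup_measurable => k _; case: (unpickle k) => // c.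
  by case: pselect => ? /=; [exact: mg|exact: measurable0].
apply/seteqP; split => x /=.
  move=> BFx; exists (pickle (g x)) => //=; rewrite pickleK.
  by case: pselect.
by move=> [k _]; case: (unpickle k) => // c; case: pselect => //= BFc ->.
Qed.

Lemma continuous_dist (U : normedModType R) (f : U -> R) x (e : R) :
  {for x, continuous f} -> 0 < e ->
  exists2 d : R, 0 < d & forall y, `|x - y| < d -> `|f x - f y| <= e.
Proof.
move=> /cvgrPdist_le fx /fx /nbhs_ballP[d d0 Hd]; exists d => // y xy.
by apply: Hd; rewrite -ball_normE.
Qed.

(** The sigma-algebra is generated by the coordinates and not by the open sets. So [f] is written as
    the pointwise limit of its values at the grid points obtained by rounding each coordinate down
    to a multiple of 1 / (m + 1); these factor through a countable type. *)
Lemma continuous_measurable_rV n (f : 'rV[R]_n -> R) : continuous f ->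
  measurable_fun setT f.
Proof.
move=> cf.
pose g (m : nat) (x : 'rV[R]_n) : 'rV[int]_n := \row_i Num.floor (m.+1%:R * x ord0 i).
pose pt (m : nat) (c : 'rV[int]_n) : 'rV[R]_n := \row_i (m.+1%:R^-1 * (c ord0 i)%:~R).
have mg m (c : 'rV[int]_n) : measurable (g m @^-1` [set c]).
  rewrite (_ : _ @^-1` _ = \bigcap_(i in [set: 'I_n])
     ((fun x : 'rV[R]_n => m.+1%:R * x ord0 i) @^-1` `[(c ord0 i)%:~R, (c ord0 i + 1)%:~R[%classic)).
    apply: fin_bigcap_measurable; first exact: finite_finset.
    move=> i _; rewrite -[X in measurable X]setTI.
    have mf : measurable_fun setT (fun x : 'rV[R]_n => m.+1%:R * x ord0 i).
      apply: measurable_funM => //; exact: measurable_coord.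
    exact: mf measurableT _ (measurable_itv _).
  apply/seteqP; split => x /=.
    move=> <- i _ /=; rewrite in_itv/= mxE; exact: floor_itv.
  move=> H; apply/rowP => i; rewrite mxE; apply: floor_def.
  by have := H i I; rewrite /= in_itv.
apply: (@measurable_fun_cvg _ _ _ setT (fun m => (f \o pt m) \o g m)).
  by move=> m; exact: measurable_fun_countable_comp.
move=> x _; apply/cvgrPdist_le => e e0.
have [d d0 Hd] := continuous_dist (cf x) e0.
near=> m; apply: Hd; rewrite /Num.Def.normr/= mx_normrE.
apply/bigmax_ltP; split => // -[i j] _ /=; rewrite (ord1 i) !mxE.
have m0 : 0 < m.+1%:R :> R by [].
have := floor_itv (m.+1%:R * x ord0 j); set z := (Num.floor _)%:~R.
rewrite intrD -/z => /andP[z1 z2].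
have zE : x ord0 j - m.+1%:R^-1 * z = m.+1%:R^-1 * (m.+1%:R * x ord0 j - z).
  by rewrite mulrBr mulrA mulVf ?mul1r// gt_eqF.
rewrite zE ger0_norm; last by rewrite mulr_ge0 ?invr_ge0 ?(ltW m0)// subr_ge0.
apply: (@le_lt_trans _ _ m.+1%:R^-1); first by rewrite ler_piMr ?invr_ge0 ?(ltW m0)//; lra.
near: m; have := @cvg_harmonic R; move/cvgrPdist_lt => /(_ d d0).
apply: filterS => m /=; rewrite sub0r normrN ger0_norm//.
Unshelve. all: by end_near. Qed.

End continuous_measurable.

Section C1c_fields.
Context {R : realType} {n : nat}.
Notation V := 'rV[R]_n.
Variable phi : V -> V.
Hypothesis phiC : C1c phi.

Definition partial (i : 'I_n) (x : V) : R := ('D_(delta_mx ord0 i) phi x) ord0 i.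

Lemma C1c_differentiable x : differentiable phi x. Proof. by case: phiC. Qed.

Lemma C1c_coord_continuous i : continuous (fun x => phi x ord0 i).
Proof.
move=> x; apply: (@continuous_comp _ _ _ phi (fun M : V => M ord0 i)).
  exact: differentiable_continuous (C1c_differentiable x).
exact: coord_continuous.
Qed.

Lemma measurable_C1c_coord i : measurable_fun setT (fun x => phi x ord0 i).
Proof. by apply: continuous_measurable_rV; exact: C1c_coord_continuous. Qed.

Lemma continuous_partial i : continuous (partial i).
Proof.
move=> x; apply: (@continuous_comp _ _ _ ('D_(delta_mx ord0 i) phi) (fun M : V => M ord0 i)).
  by case: phiC => _ + _; exact.
exact: coord_continuous.
Qed.

Lemma measurable_partial i : measurable_fun setT (partial i).
Proof. by apply: continuous_measurable_rV; exact: continuous_partial. Qed.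

Lemma partial_bounded i : exists2 S : R, 0 <= S & forall x, `|partial i x| <= S.
Proof.
case: phiC => _ _ K; set D := closure _ in K.
have : bounded_set (partial i @` D).
  apply: compact_bounded; apply: continuous_compact => //.
  by apply: continuous_subspaceT; exact: continuous_partial.
move=> [M [_ HM]]; exists (Num.max 0 (M + 1)); first by rewrite le_max lexx.
move=> x; have [Dx|nDx] := pselect (D x).
  by rewrite le_max; apply/orP; right; apply: (HM (M + 1)); [rewrite ltrDl|exists x].
rewrite (_ : partial i x = 0) ?normr0 ?le_max ?lexx//.
rewrite /partial (near_eq_derive (g := cst 0)) ?derive_cst ?mxE//.
have oD : open (~` D) by apply: closed_openC; exact: closed_closure.
have := open_nbhs_nbhs (conj oD nDx).
apply: filterS => y nDy; apply/eqP; apply: contra_notT nDy => fy.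
exact: subset_closure.
Qed.

Let line i x (t : R) : R := phi (t *: delta_mx ord0 i + x) ord0 i.

Lemma is_derive_line i x (t : R) : is_derive t (1 : R) (line i x) (partial i (t *: delta_mx ord0 i + x)).
Proof.
set e : V := delta_mx ord0 i; set y := t *: e + x.
have dphi : derivable phi y e by apply: diff_derivable; exact: C1c_differentiable.
have dphii : derivable (fun z => phi z ord0 i) y e by exact: (derivable_mxP _ _ _).1.
have E : (fun h : R => h^-1 *: ((line i x \o shift t) (h *: 1) - line i x t)) =
    (fun h : R => h^-1 *: (((fun z => phi z ord0 i) \o shift y) (h *: e) - phi y ord0 i)).
  apply/funext => h; congr (_ *: (_ - _)); rewrite /line/= /y.
  by rewrite [h *: 1]mulr1 scalerDl addrA.
apply: DeriveDef; first by rewrite /derivable E.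
by rewrite /partial derive_mx// mxE /derive E.
Qed.

Definition quotient i (m : nat) (x : V) : R :=
  m.+1%:R * (phi (x + m.+1%:R^-1 *: delta_mx ord0 i) ord0 i - phi x ord0 i).

(** By the mean value theorem; this supplies the dominating function when [m] tends to infinity. *)
Lemma quotient_bounded i S : (forall x, `|partial i x| <= S) ->
  forall m x, `|quotient i m x| <= S.
Proof.
move=> HS m x.
have m0 : 0 < m.+1%:R^-1 :> R by rewrite invr_gt0.
have [|c _ Hc] := @MVT _ (line i x) _ 0 m.+1%:R^-1 m0 (fun t _ => is_derive_line i x t).
  by apply: derivable_within_continuous => t _; have [] := is_derive_line i x t.
rewrite /quotient (addrC x) -[phi x]/(phi x).
have -> : phi x ord0 i = line i x 0 by rewrite /line scale0r add0r.
rewrite -/(line i x _) Hc subr0 mulrCA divff ?mulr1 ?pnatr_eq0//.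
Qed.

Lemma cvg_quotient i x : quotient i ^~ x @ \oo --> partial i x.
Proof.
have [d dE] := is_derive_line i x 0.
rewrite scale0r add0r in dE.
apply/cvgrPdist_le => e e0.
have : (fun h : R => h^-1 *: ((line i x \o shift 0) (h *: 1) - line i x 0)) @ 0^' --> partial i x.
  by rewrite -dE; exact: d.
move=> /cvgrPdist_le /(_ _ e0) /nbhs_ballP[r r0 Hr].
near=> m.
have m0 : 0 < m.+1%:R^-1 :> R by rewrite invr_gt0.
have := Hr m.+1%:R^-1.
rewrite /= invrK /quotient /line scale0r add0r addr0 [_ *: 1]mulr1 (addrC x); apply.
  rewrite -ball_normE/= sub0r normrN gtr0_norm//.
  near: m; have := @cvg_harmonic R; move/cvgrPdist_lt => /(_ r r0).
  by apply: filterS => m /=; rewrite sub0r normrN ger0_norm.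
by rewrite gt_eqF.
Unshelve. all: by end_near. Qed.

End C1c_fields.

Section perimeter_smoothing_tv.
Context {R : realType} {n : nat}.
Notation V := 'rV[R]_n.
Notation mu := (@lebesgue_rV R n).
Variables (A : set V).
Hypotheses (mA : measurable A) (Aoo : (mu A < +oo)%E).
Variable phi : V -> V.
Hypothesis phiC : C1c phi.
Hypothesis phi1 : forall x, enorm (phi x) <= 1.

Let u : V -> R := \1_A.
Let mu' : measurable_fun setT u. Proof. exact: measurable_indicR. Qed.
Let ui : mu.-integrable setT (EFin \o u). Proof. exact: integrable_indicR. Qed.
Let u1 x : `|u x| <= 1. Proof. exact: normr_indic_le1. Qed.

Let mphi i := measurable_C1c_coord phiC i.
Let mphiv : measurable_fun setT phi.
Proof. by apply: measurable_fun_rVP => i; exact: mphi. Qed.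
Let phii1 i x : `|phi x ord0 i| <= 1.
Proof. exact: le_trans (normr_coord_le_enorm _ _) (phi1 x). Qed.

Section one_mollifier.
Variables (delta : R) (rho : V -> R) (G : V -> V) (C : R).
Hypothesis rhoG : mollifier delta rho G C.

Let us := convolution rho u.
Let g := smoothing_grad A G.
Let usi : mu.-integrable setT (EFin \o us) := integrable_smoothing mA Aoo rhoG.
Let mus : measurable_fun setT us := measurable_smoothing mA Aoo rhoG.
Let mg : measurable_fun setT g := measurable_smoothing_grad mA Aoo rhoG.
Let gi i : mu.-integrable setT (fun x => (g x ord0 i)%:E) :=
  integrable_smoothing_grad mA Aoo rhoG i.

Let mquot i m : measurable_fun setT (quotient phi i m).
Proof. by have mp := mphiv; rewrite /quotient; mfun. Qed.

(** Discrete integration by parts: a translation moves the difference quotient from [phi] to [us],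
    where it equals [- g] up to the L^1 Taylor remainder. *)
Let Rintegral_quotient i m :
  `|\int[mu]_x (us x * quotient phi i m x) + \int[mu]_x (phi x ord0 i * g x ord0 i)| <=
  C * fine (mu A) / m.+1%:R.
Proof.
have m0 : 0 < m.+1%:R :> R by [].
set k : V := m.+1%:R^-1 *: delta_mx ord0 i.
have mp := mphi i; have mgi : measurable_fun setT (fun x => g x ord0 i) by exact: measurable_fun_coord.
have usk : mu.-integrable setT (fun x => (us (x - k))%:E) := integrable_shift (- k) usi.
have pi1 : mu.-integrable setT (fun x => (phi x ord0 i * us (x - k))%:E).
  exact: (integrable_mul_bounded mp (phii1 i) usk).
have pi2 : mu.-integrable setT (fun x => (phi x ord0 i * us x)%:E).
  exact: (integrable_mul_bounded mp (phii1 i) usi).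
have pi3 : mu.-integrable setT (fun x => (phi x ord0 i * g x ord0 i)%:E).
  exact: (integrable_mul_bounded mp (phii1 i) (gi i)).
have pi4 : mu.-integrable setT (fun x => (phi (x + k) ord0 i * us x)%:E).
  have mpk : measurable_fun setT (fun x : V => phi (x + k) ord0 i) by have mpv := mphiv; mfun.
  exact: (integrable_mul_bounded mpk (fun x => phii1 i (x + k)) usi).
have di : mu.-integrable setT (fun x => (phi x ord0 i * us (x - k) - phi x ord0 i * us x)%:E).
  exact: (integrableB measurableT pi1 pi2).
have di' : mu.-integrable setT (fun x => (phi (x + k) ord0 i * us x - phi x ord0 i * us x)%:E).
  exact: (integrableB measurableT pi4 pi2).
have e1 : \int[mu]_x (us x * quotient phi i m x) =
    m.+1%:R * \int[mu]_x (phi x ord0 i * us (x - k) - phi x ord0 i * us x).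
  rewrite (RintegralB measurableT pi1 pi2).
  rewrite -(Rintegral_shift k (f := fun x => phi x ord0 i * us (x - k))); last by mfun.
  have -> : \int[mu]_x (phi (x + k) ord0 i * us (x + k - k)) = \int[mu]_x (phi (x + k) ord0 i * us x).
    by apply: eq_Rintegral => x _; rewrite addrK.
  rewrite -(RintegralB measurableT pi4 pi2) -(RintegralZl _ measurableT di').
  by apply: eq_Rintegral => x _; rewrite /quotient -/k; ring.
pose rem x := us (x - k) - us x - dotv (g x) (- k).
have mrem : measurable_fun setT rem by rewrite /rem; mfun.
have kE x : dotv (g x) k = m.+1%:R^-1 * g x ord0 i.
  by rewrite /k dotvZr dotv_delta.
have kk : dotv k k = m.+1%:R^-1 * m.+1%:R^-1.
  by rewrite /k dotvZl dotvZr dotv_delta mxE !eqxx mulr1.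
have remB : (\int[mu]_x `|rem x|%:E <= (C * dotv k k * fine (mu A))%:E)%E.
  have := smoothing_taylor mA Aoo rhoG (- k); rewrite dotvNl dotvNr opprK; exact.
have remi : mu.-integrable setT (EFin \o rem).
  apply/integrableP; split; first by apply/measurable_EFinP.
  by apply: le_lt_trans remB _; rewrite ltry.
have pri : mu.-integrable setT (fun x => (phi x ord0 i * rem x)%:E).
  exact: (integrable_mul_bounded mp (phii1 i) remi).
have -> : \int[mu]_x (us x * quotient phi i m x) + \int[mu]_x (phi x ord0 i * g x ord0 i) =
    m.+1%:R * \int[mu]_x (phi x ord0 i * rem x).
  rewrite e1 -(RintegralZl _ measurableT di) -(RintegralZl _ measurableT pri).
  have di2 := integrableZl measurableT m.+1%:R di.
  rewrite -(RintegralD measurableT _ pi3); last first.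
    by move: di2; apply: eq_integrable => // x _; rewrite /= EFinM.
  apply: eq_Rintegral => x _; rewrite /rem dotvNr kE opprK.
  by field; rewrite gt_eqF.
rewrite normrM ger0_norm ?(ltW m0)// -[leRHS]mulrC -ler_pdivlMl//.
rewrite -lee_fin; apply: le_trans (EFin_normr_RintegralW pri) _.
apply: (@le_trans _ _ (\int[mu]_x `|rem x|%:E)%E).
  apply: ge0_le_integralW => x _ //.
  by rewrite lee_fin normrM ler_piMl.
apply: le_trans remB _; rewrite kk lee_fin le_eqVlt; apply/orP; left; apply/eqP.
have aux (c p q : R) : c * (q * q) * p = q * (q * (c * p)) by ring.
exact: aux.
Qed.

Let Rintegral_smoothing_partial i :
  \int[mu]_x (us x * partial phi i x) = - \int[mu]_x (phi x ord0 i * g x ord0 i).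
Proof.
apply/eqP; rewrite -subr_eq0 opprK -normr_le0; apply/ler_addgt0Pr => e e0.
rewrite add0r.
have [S S0 HS] := partial_bounded phiC i.
have e2 : 0 < e / 2 by rewrite divr_gt0.
pose N := (Num.truncn (C * fine (mu A) / (e / 2))).+1.
have Sus : mu.-integrable setT (EFin \o (fun x => S * `|us x|)).
  exact: (integrableZl measurableT S (integrable_norm usi)).
(* Dominated convergence will supply a single index without a lower bound on it; the shift by [N]
   makes the error of [Rintegral_quotient] small at every index. *)
pose q m x := us x * quotient phi i (m + N) x.
have mq m : measurable_fun setT (q m).
  by have mq := mquot i (m + N); have mus' := mus; rewrite /q; mfun.
have cq x : q ^~ x @ \oo --> us x * partial phi i x.
  apply: cvgM; [exact: cvg_cst|]; have := @cvg_quotient _ _ _ phiC i x.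
  by rewrite -(cvg_shiftn N).
have qB m x : `|q m x| <= S * `|us x|.
  by rewrite normrM mulrC ler_wpM2r// quotient_bounded.
have [m Hm] := dominated_Rintegral_dist mq cq Sus qB e2.
rewrite /q in Hm.
have := Rintegral_quotient i (m + N).
set I1 := \int[mu]_x (us x * quotient _ _ _ x) in Hm *.
set I2 := \int[mu]_x (us x * partial _ _ x) in Hm *.
set I3 := \int[mu]_x _ => H1.
have H2 : C * fine (mu A) / (m + N).+1%:R <= e / 2.
  have HN : C * fine (mu A) / (e / 2) <= (m + N).+1%:R.
    apply: ltW; apply: lt_le_trans (truncnS_gt _) _.
    by rewrite ler_nat; apply: leq_trans (leq_addl m N) (leqnSn _).
  by rewrite ler_pdivrMr// in HN; rewrite ler_pdivrMr// [leRHS]mulrC.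
rewrite (_ : I2 + I3 = (I1 + I3) - (I1 - I2)); last by ring.
by rewrite (splitr e); apply: le_trans (ler_normB _ _) (lerD (le_trans H1 H2) Hm).
Qed.

(** Replacing the indicator function by [us] costs at most [S * eta]; integration by parts and |phi|
    <= 1 bound what remains by the L^1 norm of [g]. *)
Lemma integral_divergence_le S eta : (forall x, `|divergence phi x| <= S) ->
  (forall h, enorm h <= delta -> (L1diff u h <= eta%:E)%E) ->
  (\int[mu]_(x in A) (divergence phi x)%:E <= smoothing_tv A G + (S * eta)%:E)%E.
Proof.
move=> HS Heta.
have mdiv : measurable_fun setT (divergence phi).
  rewrite /divergence; apply: measurable_sum => i; exact: measurable_partial.
have S0 : 0 <= S := le_trans (normr_ge0 _) (HS 0).
have ri : mu.-integrable setT (fun x => (divergence phi x * u x)%:E).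
  exact: (integrable_mul_bounded mdiv HS ui).
have rsi : mu.-integrable setT (fun x => (divergence phi x * us x)%:E).
  exact: (integrable_mul_bounded mdiv HS usi).
have pii i : mu.-integrable setT (EFin \o (fun x => us x * partial phi i x)).
  have [Si _ HSi] := partial_bounded phiC i.
  have := integrable_mul_bounded (measurable_partial phiC i) HSi usi.
  by apply: eq_integrable => // x _; rewrite /= mulrC.
have pgi i : mu.-integrable setT (EFin \o (fun x => phi x ord0 i * g x ord0 i)).
  exact: (integrable_mul_bounded (mphi i) (phii1 i) (gi i)).
have e1 : \int[mu]_x (divergence phi x * us x) = - \int[mu]_x dotv (phi x) (g x).
  have -> : \int[mu]_x (divergence phi x * us x) = \int[mu]_x (\sum_(i < n) us x * partial phi i x).
    by apply: eq_Rintegral => x _; rewrite mulrC mulr_sumr.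
  rewrite (Rintegral_sum pii) (Rintegral_sum pgi) -sumrN.
  by apply: eq_bigr => i _; rewrite Rintegral_smoothing_partial.
rewrite integral_indic_mul (EFin_Rintegral ri).
have di : mu.-integrable setT (fun x => (us x - u x)%:E).
  exact: (integrableB measurableT usi ui).
have ddi : mu.-integrable setT (fun x => (divergence phi x * (us x - u x))%:E).
  exact: (integrable_mul_bounded mdiv HS di).
have dgi := integrable_Rsum pgi.
have -> : \int[mu]_x (divergence phi x * u x) =
    (- \int[mu]_x dotv (phi x) (g x)) - \int[mu]_x (divergence phi x * (us x - u x)).
  rewrite -e1 -(RintegralB measurableT rsi ddi).
  by apply: eq_Rintegral => x _; ring.
apply: (@le_trans _ _ (`|\int[mu]_x dotv (phi x) (g x)|%:E +
    `|\int[mu]_x (divergence phi x * (us x - u x))|%:E)%E).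
  rewrite -EFinD lee_fin; apply: lerD; last by rewrite -normrN ler_norm.
  by rewrite -normrN ler_norm.
have mus' := mus; have mg' := mg; have mp := mphiv.
apply: leeD.
  apply: le_trans (EFin_normr_RintegralW dgi) _.
  apply: ge0_le_integralW => x _ //; rewrite lee_fin.
  apply: le_trans (cauchy_schwarz _ _) _; by rewrite ler_piMl ?enorm_ge0.
apply: le_trans (EFin_normr_RintegralW ddi) _.
apply: (@le_trans _ _ (S%:E * \int[mu]_x `|us x - u x|%:E)%E).
  rewrite -ge0_integralZl//; [|by mfun].
  by apply: ge0_le_integralW => x _ //; rewrite -EFinM lee_fin normrM ler_wpM2r.
rewrite EFinM lee_wpmul2l ?lee_fin//.
exact: (smoothing_dist mA rhoG Heta).
Qed.

End one_mollifier.

Lemma divergence_bounded : exists2 S : R, 0 <= S & forall x, `|divergence phi x| <= S.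
Proof.
have H i : {S : R | 0 <= S & forall x, `|partial phi i x| <= S}.
  by apply: cid2; exact: partial_bounded.
exists (\sum_(i < n) s2val (H i)); first by apply: sumr_ge0 => i _; exact: (s2valP (H i)).
move=> x; apply: le_trans (ler_norm_sum _ _ _) _; apply: ler_sum => i _.
exact: (s2valP' (H i)).
Qed.

End perimeter_smoothing_tv.

Lemma perimeter_ge0 (R : realType) n (A : set 'rV[R]_n) : measurable A ->
  (lebesgue_rV A < +oo)%E -> (0 <= perimeter A)%E.
Proof.
move=> mA Aoo; have [rho [G [C rhoG]]] := @exists_mollifier R n 1 ltr01.
apply: le_trans (smoothing_tv_ge0 A G) _.
exact: (smoothing_tv_le_perimeter rhoG mA Aoo).
Qed.

(** * Asymptotics of the Gaussian variation *)

Section variation_perimeter.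
Context {R : realType} {n : nat}.
Notation V := 'rV[R]_n.
Notation mu := (@lebesgue_rV R n).
Variables (A : set V) (p : R).
Hypotheses (mA : measurable A) (Aoo : (mu A < +oo)%E).
Hypothesis pE : perimeter A = p%:E.

Let u : V -> R := \1_A.
Let c1 : R := gauss1_absmoment.
Let c10 : 0 <= c1. Proof. exact: gauss1_absmoment_ge0. Qed.
Let F t : R := fine (gauss_L1diff u t).
Let FE t : gauss_L1diff u t = (F t)%:E.
Proof. by rewrite /F fineK//; exact: gauss_L1diff_fin. Qed.

Lemma gauss_L1diff_le_perimeter t : 0 <= t -> F t <= t * c1 * p.
Proof.
move=> t0; apply/ler_addgt0Pr => e e0.
have e2 : 0 < e / 2 by rewrite divr_gt0.
have [delta d0 Hd] := L1diff_continuous0 mA Aoo e2.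
have [rho [G [C rhoG]]] := @exists_mollifier R n delta d0.
rewrite -lee_fin -FE.
apply: le_trans (gauss_L1diff_le_smoothing_tv mA Aoo rhoG t0 Hd) _.
rewrite [(2 * (e / 2))%R]mulrC divfK// EFinD [(t * c1 * p)%:E]EFinM -pE.
by rewrite leeD2r// lee_wpmul2l ?lee_fin ?mulr_ge0//; exact: (smoothing_tv_le_perimeter rhoG mA Aoo).
Qed.

Lemma gauss_L1diff_ge_perimeter eta : 0 < eta ->
  exists2 t0 : R, 0 < t0 & forall t, 0 < t -> t < t0 -> (c1 * p - eta) * t <= F t.
Proof.
move=> eta0.
(* Two losses of size [e] occur below, in the choice of [phi] and in the mollification; multiplied
   by [c1] they total at most [eta / 2]. *)
pose e := eta / (4 * (c1 + 1)).
have c11 : 0 < c1 + 1 by rewrite ltr_wpDl.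
have e0 : 0 < e by rewrite divr_gt0// mulr_gt0.
have pfin : perimeter A \is a fin_num by rewrite pE.
have [_ [phi [phiC phi1] <-] Hphi] := ub_ereal_sup_adherent e0 pfin.
rewrite -/(perimeter A) pE in Hphi.
(* The order of choices matters: the nearly optimal field [phi] determines [S], which determines
   [delta] and thus the mollifier with its [C]; only then is [t] taken small. *)
have [S S0 HS] := divergence_bounded phiC.
have eS : 0 < e / (S + 1) by rewrite divr_gt0// ltr_wpDl.
have [delta d0 Hd] := L1diff_continuous0 mA Aoo eS.
have [rho [G [C rhoG]]] := @exists_mollifier R n delta d0.
have Hdiv := integral_divergence_le mA Aoo phiC phi1 rhoG HS Hd.
have tvp := smoothing_tv_le_perimeter rhoG mA Aoo.
have tv0 := smoothing_tv_ge0 A G.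
have tvfin : smoothing_tv A G \is a fin_num.
  by rewrite ge0_fin_numE//; apply: le_lt_trans tvp _; rewrite pE ltry.
have tvE := fineK tvfin; set tv := fine _ in tvE.
have tvge : p - 2 * e <= tv.
  have := lt_le_trans Hphi Hdiv; rewrite -tvE -EFinB -EFinD lte_fin.
  have : S * (e / (S + 1)) <= e.
    by rewrite mulrCA ler_piMr ?(ltW e0)// ler_pdivrMr ?ltr_wpDl// mul1r lerDl.
  lra.
have M2oo := @gauss_moment2_lty R n.
have M20 : (0 <= \int[mu]_z (dotv z z * gauss z)%:E)%E.
  by apply: integral_ge0 => z _; rewrite lee_fin mulr_ge0 ?dotv_ge0 ?gauss_ge0.
have M2E : (\int[mu]_z (dotv z z * gauss z)%:E)%E \is a fin_num by rewrite ge0_fin_numE.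
have := fineK M2E; set M2 := fine _ => {}M2E.
pose K := C * fine (mu A) * M2.
have K0 : 0 <= K.
  rewrite mulr_ge0 ?fine_ge0// mulr_ge0 ?fine_ge0//; exact: mollifier_const_ge0 rhoG.
(* Below this value the quadratic error [K * t * t] is at most [eta / 2 * t]. *)
exists (eta / (2 * (K + 1))); first by rewrite divr_gt0// mulr_gt0// ltr_wpDl.
move=> t t0 tt.
have := smoothing_tv_le_gauss_L1diff mA Aoo rhoG (ltW t0).
rewrite -tvE -M2E -/u FE -!EFinM -EFinD lee_fin -/c1.
rewrite (_ : C * fine (mu A) * t ^+ 2 * M2 = K * t * t); last first.
  have aux (x y z : R) : x * y * t ^+ 2 * z = x * y * z * t * t by ring.
  exact: aux.
have Kt : K * t <= eta / 2.
  have K1 : 0 < K + 1 by rewrite ltr_wpDl.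
  rewrite ltr_pdivlMr ?mulr_gt0// in tt.
  have := mulr_ge0 K0 (ltW t0); lra.
have ce : c1 * (2 * e) <= eta / 2.
  rewrite /e [X in _ <= X](_ : _ = (c1 + 1) * (2 * (eta / (4 * (c1 + 1))))); last first.
    by field; rewrite gt_eqF.
  by rewrite ler_wpM2r ?lerDl// mulr_ge0// ltW.
have tvc : c1 * (p - 2 * e) <= c1 * tv by rewrite ler_wpM2l.
have h1 : t * (c1 * p - eta / 2) <= t * c1 * tv.
  rewrite -mulrA ler_wpM2l ?(ltW t0)//; lra.
have h2 : K * t * t <= eta / 2 * t by rewrite ler_wpM2r// ltW.
have aux (f : R) : t * c1 * tv <= f + K * t * t -> (c1 * p - eta) * t <= f by lra.
exact: aux.
Qed.

End variation_perimeter.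

(** * Replacing a Lebesgue measurable set by a Borel set *)

Section null_modification.
Import HBNNSimple.
Context {R : realType} d (T : measurableType d) (mu : {measure set T -> \bar R}).
Variable B : set T.
Hypotheses (mB : measurable B) (B0 : mu B = 0%E).

(* The library integral of a nonnegative function is a supremum over measurable
   simple functions, which may be set to 0 on [B]. *)
Let ge0_integral_le_off_null (f g : T -> \bar R) :
  (forall x, 0 <= f x)%E -> (forall x, 0 <= g x)%E -> (forall x, ~ B x -> f x = g x) ->
  (\int[mu]_x f x <= \int[mu]_x g x)%E.
Proof.
move=> f0 g0 fg.
rewrite [X in (X <= _)%E]ge0_integralE//; apply: ge_ereal_sup => _ /= [h hf <-].
rewrite -integralT_nnsfun.
have mh : measurable_fun setT (fun x : T => (h x)%:E) by exact/measurable_EFinP/measurable_funPT.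
rewrite (ge0_negligible_integral mB measurableT mh _ B0); last first.
  by move=> x _; rewrite lee_fin.
rewrite integral_mkcond; apply: ge0_le_integralW => x _.
  by rewrite patchE; case: ifPn => // _; rewrite lee_fin.
rewrite patchE; case: ifPn => // xB.
have nBx : ~ B x by move: xB; rewrite inE => -[].
rewrite -fg//; apply: le_trans (hf x) _; rewrite patchE.
by case: ifPn.
Qed.

Lemma eq_integral_off_null (f g : T -> \bar R) : (forall x, ~ B x -> f x = g x) ->
  (\int[mu]_x f x = \int[mu]_x g x)%E.
Proof.
move=> fg; rewrite [LHS]integralE [RHS]integralE.
congr (_ - _)%E; apply/eqP; rewrite eq_le; apply/andP; split;
  by apply: ge0_integral_le_off_null => // x nBx; rewrite ?funeposE ?funenegE fg.
Qed.

End null_modification.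

Theorem mainTheorem4 (R : realType) (n : nat) (a b : R) :
  (0 < n)%N -> 0 < a -> b != 0 ->
  exists c : R, forall E : set 'rV[R]_n,
    lebesgue_measurable E ->
    (lebesgue_rV^*%mu E < +oo)%E ->
    (perimeter E < +oo)%E ->
    (`|ln eps|^-1%:E * Hhalf_norm_sq a b (convolution (gauss_scaled eps) \1_E))%E
      @[eps --> 0^'+] --> (c%:E * perimeter E)%E.
Proof.
move=> _ _ b0.
have [sigma s0 gauss_cosE] := @gauss_cos R.
pose C := a ^+ 2 / (Num.sqrt (2 * sigma) * `|b|) / fine (@subordination_const R) *
  (@variation_const R n sigma b / 2).
(* [C] converts [log_energy] into the squared norm, and the second factor is the slope at 0 of
   [indic_variation] per unit of perimeter. The set [E] is a Borel set [A] together with a part [N]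
   of a Borel null set [B], so its convolutions and its perimeter are those of [A]. *)
exists (C * (Num.sqrt 2 * gauss1_absmoment)) => E [A mA [N [B [mB B0 NB]] AE]] Eoo Poo.
have AsubE : A `<=` E by rewrite -AE => x; left.
have EA x : ~ B x -> (x \in E) = (x \in A).
  move=> nBx; apply/idP/idP; rewrite !inE; last exact: AsubE.
  by rewrite -AE => -[//|/NB].
have Aoo : (lebesgue_rV A < +oo)%E.
  rewrite -(measurable_mu_extE _ mA); apply: le_lt_trans Eoo; exact: le_mu_ext.
have convE eps : convolution (gauss_scaled eps) (\1_E : 'rV[R]_n -> R) =
    convolution (gauss_scaled eps) \1_A.
  apply/funext => x; rewrite /convolution /Rintegral; congr fine.
  by apply: (eq_integral_off_null mB B0) => y nBy; rewrite !indicE EA.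
have perE : perimeter E = perimeter A.
  rewrite /perimeter; congr ereal_sup; apply: eq_imagel => phi _ /=.
  rewrite [LHS]integral_mkcond [RHS]integral_mkcond.
  by apply: (eq_integral_off_null mB B0) => y nBy; rewrite !patchE EA.
have pfin : perimeter A \is a fin_num.
  by rewrite ge0_fin_numE -?perE// perE perimeter_ge0.
have := fineK pfin; set p := fine _ => /esym pE.
rewrite perE pE -EFinM -mulrA EFinM.
have s20 : 0 < Num.sqrt 2 :> R by rewrite sqrtr_gt0.
have H : (`|ln eps|^-1%:E * log_energy (indic_variation A) eps)%E @[eps --> 0^'+] -->
    (Num.sqrt 2 * gauss1_absmoment * p)%:E.
  apply: (@cvg_log_energy R (indic_variation A) _ (2 * fine (lebesgue_rV A))).
  - exact: measurable_indic_variation.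
  - exact: (indic_variation_mono s0 b0 (gauss_cosE n)).
  - by move=> t _; exact: indic_variation_ge0.
  - by move=> t _; exact: indic_variation_le.
  - move=> t t0; rewrite /indic_variation.
    have := gauss_L1diff_le_perimeter mA Aoo pE (mulr_ge0 (ltW s20) (ltW t0)).
    by move=> /le_trans; apply; rewrite le_eqVlt; apply/orP; left; apply/eqP; ring.
  - move=> eta eta0.
    have e2 : 0 < eta / Num.sqrt 2 by rewrite divr_gt0.
    have [t0 t00 Ht] := gauss_L1diff_ge_perimeter mA Aoo pE e2.
    exists (t0 / Num.sqrt 2); first by rewrite divr_gt0.
    move=> t tp tt; rewrite ltr_pdivlMr// mulrC in tt.
    have := Ht _ (mulr_gt0 s20 tp) tt; rewrite /indic_variation; apply: le_trans.
    rewrite le_eqVlt; apply/orP; left; apply/eqP; field.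
    by rewrite gt_eqF.
  - by move=> eps r; exact: (indic_variation_cvx s0 b0 (gauss_cosE n)).
have Cfin : (C%:E : \bar R) \is a fin_num by [].
have := cvgeZl Cfin H.
apply: cvg_trans; apply: near_eq_cvg; near=> eps.
have eps0 : 0 < eps by near: eps; exact: nbhs_right_gt.
rewrite convE (Hhalf_norm_sq_log_energy s0 b0 (gauss_cosE n) mA Aoo a eps0).
by rewrite muleCA.
Unshelve. all: by end_near. Qed.
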